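(* Let $n \geq 2$ and $N \geq 1$ be integers. (A) Suppose $f \colon \mathbb{C}^n \setminus \overline{\mathbb{B}_n} \to \mathbb{C}^N \setminus \overline{\mathbb{B}_N}$ is a proper holomorphic map. Then $f$ is (the restriction of) a polynomial map $\mathbb{C}^n \to \mathbb{C}^N$, and the restriction of this polynomial map to $\mathbb{B}_n$ is a proper map from $\mathbb{B}_n$ to $\mathbb{B}_N$. (B) Conversely, suppose $p \colon \mathbb{C}^n \to \mathbb{C}^N$ is a polynomial map whose restriction to $\mathbb{B}_n$ is a proper map from $\mathbb{B}_n$ to $\mathbb{B}_N$. Then (i) $p(\mathbb{C}^n \setminus \overline{\mathbb{B}_n}) \subset \mathbb{C}^N \setminus \overline{\mathbb{B}_N}$, and (ii) if also $\lVert p(z)\rVert \to \infty$ as $\lVert z\rVert \to \infty$, then $p$ restricts to a proper map from $\mathbb{C}^n \setminus \overline{\mathbb{B}_n}$ to $\mathbb{C}^N \setminus \overline{\mathbb{B}_N}$.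
   Context: $\mathbb{B}_n = \{z \in \mathbb{C}^n : \lVert z\rVert < 1\}$ is the open unit ball for the Euclidean norm, and $\overline{\mathbb{B}_n}$ is its closure. A continuous map is proper if preimages of compact sets are compact. *)

(* Defs.v *)
From HB Require Import structures.
From mathcomp Require Import all_boot all_order all_algebra.
From mathcomp Require Import all_classical all_reals all_analysis.
From mathcomp Require Export complex.
(* The notations of mpoly clash with those of analysis. *)
From mathcomp Require Import -(notations) mpoly.
Export numFieldNormedType.Exports.

Set Implicit Arguments.
Unset Strict Implicit.
Unset Printing Implicit Defensive.

Import Order.TTheory GRing.Theory Num.Theory.

Local Open Scope classical_set_scope.
Local Open Scope ring_scope.

(* The instances of numFieldNormedType are keyed on abstract structures and do
   not fire on complex R; these give R[i] the same topology and norm. *)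
HB.instance Definition _ (R : realType) := GRing.ComAlgebra.copy R[i] R[i]^o.
HB.instance Definition _ (R : realType) := Vector.copy R[i] R[i]^o.
HB.instance Definition _ (R : realType) := NormedModule.copy R[i] R[i]^o.

(* C^n is 'rV[R[i]]_n with R : realType. Its library topology is that of the
   sup norm `|z|, which is also the Euclidean topology; the Euclidean norm has
   to be defined separately. *)
Definition enorm (R : realType) (n : nat) (z : 'rV[R[i]]_n) : R :=
  Num.sqrt (\sum_(j < n) (complex.Re (z 0 j) ^+ 2 + complex.Im (z 0 j) ^+ 2)).

Definition unit_ball (R : realType) (n : nat) : set 'rV[R[i]]_n :=
  [set z | enorm z < 1].

Definition ball_exterior (R : realType) (n : nat) : set 'rV[R[i]]_n :=
  ~` closure (@unit_ball R n).

Arguments unit_ball : clear implicits.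
Arguments ball_exterior : clear implicits.

(* f restricts to a proper map from U to V. A subset of V is compact for the
   subspace topology iff it is compact in T2, and likewise for U and T1; the
   values of f outside U are irrelevant. *)
Definition proper_map (T1 T2 : topologicalType) (U : set T1) (V : set T2)
    (f : T1 -> T2) : Prop :=
  [/\ forall x, U x -> V (f x),
      {within U, continuous f} &
      forall K : set T2, K `<=` V -> compact K -> compact (U `&` f @^-1` K)].

(* Here differentiable is Frechet differentiability over the field R[i]. U is
   meant to be open. *)
Definition holomorphic_on (R : realType) (n N : nat) (U : set 'rV[R[i]]_n)
    (f : 'rV[R[i]]_n -> 'rV[R[i]]_N) : Prop :=
  forall z, U z -> differentiable f z.

Definition polynomial_map (R : realType) (n N : nat)
    (p : 'rV[R[i]]_n -> 'rV[R[i]]_N) : Prop :=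
  exists P : 'I_N -> mpoly n R[i],
    forall z, p z = \row_(j < N) meval (fun k : 'I_n => z 0 k) (P j).

(* ||p z|| -> oo as ||z|| -> oo *)
Definition tends_to_infinity (R : realType) (n N : nat)
    (p : 'rV[R[i]]_n -> 'rV[R[i]]_N) : Prop :=
  forall M : R, exists r : R, forall z, r < enorm z -> M < enorm (p z).

(* Main.v *)
Require Import Defs.
From HB Require Import structures.
From mathcomp Require Import all_boot all_order all_algebra.
From mathcomp Require Import all_classical all_reals all_analysis.
From mathcomp Require Import ring lra.
From mathcomp Require Import -(notations) mpoly.

(** For (A), Hartogs' phenomenon extends f to an entire map F, and properness
    gives ||F|| = 1 on the unit sphere.  The reflection principle
    polarizes this to <F z, F w> = 1 whenever <z, w> = 1 and ||z|| < 1.  Fix z0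
    with 0 < ||z0|| < 1, a unit vector e orthogonal to z0, om = z0 / ||z0||^2, and
    expand F at om along the line tau |-> om + tau (e - conj(t) om), all of whose
    points w satisfy <z0 + t e, w> = 1.  The coefficients v_k are polynomials in
    conj(t), and on the circle ||z0 + t e|| = 1 the vector F(z0 + t e) has inner
    product 0 or 1 with every v_k and is itself the sum of the v_k t^k, hence
    lies in their span (here definiteness of the norm is used).  Solving the Gram
    system of a maximal independent family of the v_k, and replacing conj(t) by
    (1 - ||z0||^2) / t, shows that t |-> F(z0 + t e) is rational on the circle; being
    entire, it is a polynomial.  Baire's theorem makes the degree uniform in z0,
    and Lagrange interpolation in each variable makes F polynomial.  Finally
    Parseval's identity on the circle centred at z in a line orthogonal to z
    gives ||F z|| < 1 in the ball.

    For (B), properness gives ||p|| = 1 on the sphere, and by reflection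
    <p z, p (z / ||z||^2)> = 1, where the second vector has norm less than 1.

    The integrals needed are limits of dyadic midpoint sums over complex
    segments; their properties (existence, continuity in a parameter, Fubini,
    Goursat) all follow from one bisection principle. *)

Set Implicit Arguments.
Unset Strict Implicit.
Unset Printing Implicit Defensive.

Import Order.TTheory GRing.Theory Num.Theory.
Import complex.

Local Open Scope classical_set_scope.
Local Open Scope ring_scope.

(** The obstacle in (A) is that the relations [<F z, F w> = 1] need not determine F z, since the
    vectors F w may span a proper subspace of C^N. Two facts meet only on the circle ||z0 + t e|| =
    1. The point z0 + t e lies on its own line through om, at tau = t, so F (z0 + t e) has no
    component outside the span of the v_k. And conj(t) can be traded for a rational function of t.
    The polarized relation is available only inside the ball, so it is carried to the circle by
    continuity. The hyperplane [<z, w> = 1] depends antiholomorphically on z. This is why the v_k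
    are polynomials in conj(t), and their degree at most k comes from Cauchy's estimate. Holomorphy
    in several variables is used only through continuity and restrictions to complex lines, so
    one-variable theory suffices. The hypothesis n >= 2 supplies orthogonal directions: for Hartogs,
    for e, and for the final Parseval argument. *)

Local Notation cabs := Normc.normc.

(** * Absolute value and limits in the complex plane *)

Section Cabs.
Context {R : realType}.
Implicit Types z w : R[i].

Lemma normE z : `|z| = (cabs z)%:C%C. Proof. by []. Qed.

Lemma cabs_ge0 z : 0 <= cabs z.
Proof. by rewrite -ler0c -normE. Qed.

Lemma cabsN z : cabs (- z) = cabs z. Proof. exact: normcN. Qed.
Lemma cabsM z w : cabs (z * w) = cabs z * cabs w. Proof. exact: Normc.normcM. Qed.
Lemma cabsD z w : cabs (z + w) <= cabs z + cabs w. Proof. exact: le_normcD. Qed.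
Lemma cabsB z w : cabs (z - w) = cabs (w - z).
Proof. by rewrite -cabsN opprB. Qed.
Lemma cabs0 : cabs (0 : R[i]) = 0. Proof. exact: Normc.normc0. Qed.
Lemma cabs1 : cabs (1 : R[i]) = 1. Proof. exact: Normc.normc1. Qed.
Lemma cabsV z : cabs z^-1 = (cabs z)^-1. Proof. exact: Normc.normcV. Qed.
Lemma cabsX z n : cabs (z ^+ n) = cabs z ^+ n.
Proof. by elim: n => [|n IH]; rewrite ?expr0 ?cabs1// !exprS cabsM IH. Qed.
Lemma cabs_eq0 z : (cabs z == 0) = (z == 0).
Proof. by apply/eqP/eqP => [/Normc.eq0_normc|->]; rewrite ?cabs0. Qed.
Lemma cabs_gt0 z : (0 < cabs z) = (z != 0).
Proof. by rewrite lt_def cabs_ge0 cabs_eq0 andbT. Qed.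
Lemma cabsR (x : R) : cabs (x%:C%C) = `|x|.
Proof. by rewrite /= expr0n addr0 sqrtr_sqr. Qed.
Lemma cabs_tri z w u : cabs (z - u) <= cabs (z - w) + cabs (w - u).
Proof. by apply: le_trans (cabsD _ _); rewrite addrA subrK. Qed.

Lemma near_cabs (a : R[i]) (P : set R[i]) :
  (\forall x \near a, P x) <->
  exists2 d : R, 0 < d & forall x, cabs (x - a) < d -> P x.
Proof.
split=> [/nbhs_ballP[e /= e0 H]|[d d0 H]].
  (* The radius given by [nbhs_ballP] is a complex number; positivity in the order of [R[i]] forces
     its imaginary part to vanish. *)
  have [ee e'0] : (Re e)%:C%C = e /\ 0 < Re e.
    move: e0; rewrite ltcE => /andP[/eqP Ie]; split=> //.
    by rewrite [e in RHS]complexE Ie; rewrite /= mulr0 addr0.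
  exists (Re e) => // x xa; apply: H; rewrite -ball_normE /ball_/=.
  by rewrite -ee distrC normE ltcR.
apply/nbhs_ballP; exists (d%:C)%C; rewrite /= ?ltcR//.
by move=> x; rewrite -ball_normE /ball_ /= distrC normE ltcR; exact: H.
Qed.

Definition cont (T : topologicalType) (f : T -> R[i]) (a : T) : Prop :=
  {for a, continuous f}.

Lemma contP (T : topologicalType) (f : T -> R[i]) (a : T) :
  cont f a <->
  forall e : R, 0 < e -> \forall x \near a, cabs (f x - f a) < e.
Proof.
split=> [cf e e0|H].
  apply: (cf [set y | cabs (y - f a) < e]).
  by apply/near_cabs; exists e.
by move=> P /near_cabs[d d0 HP]; rewrite nbhs_filterE; near do apply: HP; exact: H.
Unshelve. all: by end_near. Qed.

End Cabs.

(** * Limits of complex sequences and the bisection principle *)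

Section Sequences.
Context {R : realType}.

Definition clim (u : nat -> R[i]) (l : R[i]) : Prop :=
  forall e : R, 0 < e -> exists M : nat, forall m, (M <= m)%N -> cabs (u m - l) <= e.

Lemma clim_uniq u l l' : clim u l -> clim u l' -> l = l'.
Proof.
move=> ul ul'; apply/eqP; rewrite -subr_eq0 -cabs_eq0 eq_le cabs_ge0 andbT.
apply/ler_addgt0Pl => e e0; rewrite addr0.
have [M HM] := ul _ (divr_gt0 e0 (ltr0n _ 2)).
have [M' HM'] := ul' _ (divr_gt0 e0 (ltr0n _ 2)).
have := HM (maxn M M') (leq_maxl _ _); have := HM' (maxn M M') (leq_maxr _ _).
have := cabs_tri l (u (maxn M M')) l'; rewrite (cabsB l (u _)); lra.
Qed.

Lemma clim_cst l : clim (fun=> l) l.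
Proof. by move=> e e0; exists 0 => m _; rewrite subrr cabs0 ltW. Qed.

Lemma climD u v l l' : clim u l -> clim v l' -> clim (fun m => u m + v m) (l + l').
Proof.
move=> ul vl e e0.
have [M HM] := ul _ (divr_gt0 e0 (ltr0n _ 2)).
have [M' HM'] := vl _ (divr_gt0 e0 (ltr0n _ 2)).
exists (maxn M M') => m; rewrite geq_max => /andP[/HM h /HM' h'].
rewrite opprD addrACA; apply: le_trans (cabsD _ _) _; lra.
Qed.

Lemma climM c u l : clim u l -> clim (fun m => c * u m) (c * l).
Proof.
move=> ul e e0.
have c0 : 0 < cabs c + 1 by have := cabs_ge0 c; lra.
have [M HM] := ul _ (divr_gt0 e0 c0).
exists M => m /HM h; rewrite -mulrBr cabsM.
apply: (@le_trans _ _ ((cabs c + 1) * (e / (cabs c + 1)))); last first.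
  by rewrite mulrC divfK// gt_eqF.
by apply: ler_pM => //; rewrite ?cabs_ge0//; lra.
Qed.

Lemma clim_bound u l (B : R) M :
  clim u l -> (forall m, (M <= m)%N -> cabs (u m) <= B) -> cabs l <= B.
Proof.
move=> ul H; apply/ler_addgt0Pl => e /ul[M' HM'].
have := H _ (leq_maxl M M'); have := HM' _ (leq_maxr M M').
have := cabs_tri l (u (maxn M M')) 0; rewrite !subr0 (cabsB l (u _)); lra.
Qed.

Lemma clim_shift u l : clim (fun m => u m.+1) l -> clim u l.
Proof.
move=> ul e /ul[M HM]; exists M.+1 => -[//|m] h; exact: HM.
Qed.

Lemma clim_ext u v l : u =1 v -> clim u l -> clim v l.
Proof. by move=> /funext->. Qed.

Lemma real_cauchy (u : nat -> R) :
  (forall e : R, 0 < e -> exists M : nat, forall m n, (M <= m)%N -> (M <= n)%N ->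
    `|u m - u n| <= e) ->
  exists l : R, forall e : R, 0 < e -> exists M : nat, forall m, (M <= m)%N -> `|u m - l| <= e.
Proof.
move=> H.
have : cvgn u.
  apply/cauchy_cvgP/cauchy_exP => e e0.
  have [M HM] := H _ (divr_gt0 e0 (ltr0n _ 2)).
  exists (u M), M => // m /= Mm; rewrite /ball/=.
  by apply: le_lt_trans (HM _ _ (leqnn _) Mm) _; lra.
move=> /cvg_ex[l ul]; exists l => e e0.
have /cvgrPdist_le/(_ _ e0)[M _ HM] := ul.
by exists M => m /HM; rewrite distrC.
Qed.

Lemma Re_le_cabs (z : R[i]) : `|Re z| <= cabs z.
Proof. by have := normc_ge_Re z; rewrite normE lecR. Qed.
Lemma Im_le_cabs (z : R[i]) : `|Im z| <= cabs z.
Proof.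
by case: z => a b /=; rewrite -[leLHS]sqrtr_sqr ler_wsqrtr// lerDr sqr_ge0.
Qed.
Lemma cabs_le_ReIm (z : R[i]) : cabs z <= `|Re z| + `|Im z|.
Proof.
rewrite [z in leLHS]complexE; apply: le_trans (cabsD _ _) _.
rewrite cabsM !cabsR (_ : cabs 'i%C = 1) ?mul1r//.
by rewrite /= expr0n add0r expr1n sqrtr1.
Qed.
Lemma ReB (z w : R[i]) : Re (z - w) = Re z - Re w.
Proof. by case: z => ? ?; case: w => ? ?. Qed.
Lemma ImB (z w : R[i]) : Im (z - w) = Im z - Im w.
Proof. by case: z => ? ?; case: w => ? ?. Qed.

Lemma complex_cauchy (u : nat -> R[i]) :
  (forall e : R, 0 < e -> exists M : nat, forall m n, (M <= m)%N -> (M <= n)%N ->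
    cabs (u m - u n) <= e) -> exists l, clim u l.
Proof.
move=> H.
have [|a Ha] := @real_cauchy (fun m => Re (u m)).
  move=> e /H[M HM]; exists M => m n Mm Mn; rewrite -ReB.
  exact: le_trans (Re_le_cabs _) (HM _ _ Mm Mn).
have [|b Hb] := @real_cauchy (fun m => Im (u m)).
  move=> e /H[M HM]; exists M => m n Mm Mn; rewrite -ImB.
  exact: le_trans (Im_le_cabs _) (HM _ _ Mm Mn).
exists (a +i* b)%C => e e0.
have [M HM] := Ha _ (divr_gt0 e0 (ltr0n _ 2)).
have [M' HM'] := Hb _ (divr_gt0 e0 (ltr0n _ 2)).
exists (maxn M M') => m; rewrite geq_max => /andP[/HM h /HM' h'].
by apply: le_trans (cabs_le_ReIm _) _; rewrite ReB ImB /=; lra.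
Qed.

Lemma half_pow_lt (L e : R) : 0 < e -> exists n : nat, L / 2 ^+ n < e.
Proof.
move=> e0; have [n Hn] : exists n : nat, L / e < n%:R.
  exists (Num.bound (`|L| / e)); apply: le_lt_trans (archi_boundP _).
    by rewrite ler_pM2r ?invr_gt0// ler_norm.
  by rewrite divr_ge0// ltW.
exists n; rewrite ltr_pdivrMr ?exprn_gt0// mulrC -ltr_pdivrMr//.
by apply: lt_trans Hn _; rewrite -natrX ltr_nat ltn_expl.
Qed.

Lemma geometric_cauchy (p : nat -> R[i]) (L : R) :
  (forall n, cabs (p n.+1 - p n) <= L / 2 ^+ n) ->
  exists c, forall n, cabs (p n - c) <= 2 * (L / 2 ^+ n).
Proof.
move=> H.
(* The subtracted term, the part of the geometric series not yet spent, is what lets the induction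
   on [k] close. *)
have Hk n k : cabs (p (n + k)%N - p n) <= 2 * (L / 2 ^+ n) - 2 * (L / 2 ^+ (n + k)).
  elim: k => [|k IH]; first by rewrite addn0 !subrr cabs0.
  have := cabs_tri (p (n + k.+1)%N) (p (n + k)%N) (p n).
  move: IH (H (n + k)%N); rewrite addnS.
  have -> : L / 2 ^+ (n + k).+1 = (L / 2 ^+ (n + k)) / 2.
    by rewrite exprS invfM mulrCA mulrC.
  lra.
have L0 n : 0 <= L / 2 ^+ n by exact: le_trans (cabs_ge0 _) (H n).
have Hk' n k : cabs (p (n + k)%N - p n) <= 2 * (L / 2 ^+ n).
  by have := Hk n k; have := L0 (n + k)%N; lra.
have [|c Hc] := @complex_cauchy p.
  move=> e e0; have [M HM] := half_pow_lt L (divr_gt0 e0 (ltr0n _ 4)).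
  exists M => m n /subnKC <- /subnKC <-.
  have := cabs_tri (p (M + (m - M))%N) (p M) (p (M + (n - M))%N).
  have := Hk' M (m - M)%N; have := Hk' M (n - M)%N; rewrite (cabsB (p M)); lra.
exists c => n; apply/ler_addgt0Pl => e /Hc[M HM].
have := HM _ (leq_addl n M); have := Hk' n M.
have := cabs_tri (p n) (p (n + M)%N) c; rewrite (cabsB (p n) (p _)); lra.
Qed.

(** A counterexample has a child that is again a counterexample. Along an infinite chain of them the
    marked points converge to some [c] and [c'], and the local hypothesis contradicts the failure
    far down the chain. That hypothesis may use that [c] and [c'] are limits of marked points of
    admissible pieces, which is how membership in a closed set reaches them. Two marked points are
    needed for products of segments in Fubini's theorem. *)
Lemma bisection_ind2 (T : Type) (I : T -> Prop) (ch : T -> T -> Prop) (pt pt' : T -> R[i])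
    (dm : T -> R) (P : T -> Prop) :
  (forall x y, I x -> ch x y ->
    [/\ I y, dm y = dm x / 2, cabs (pt y - pt x) <= dm x & cabs (pt' y - pt' x) <= dm x]) ->
  (forall x, I x -> (forall y, ch x y -> P y) -> P x) ->
  (forall c c', (forall e : R, 0 < e ->
      exists x, [/\ I x, cabs (pt x - c) < e & cabs (pt' x - c') < e]) ->
    exists2 d : R, 0 < d &
      forall x, I x -> dm x < d -> cabs (pt x - c) <= 2 * dm x ->
        cabs (pt' x - c') <= 2 * dm x -> P x) ->
  forall x, I x -> P x.
Proof.
move=> Hch Hstep Hloc x0 Ix0; apply: contrapT => nP0.
have next (x : {x | I x /\ ~ P x}) :
    {y : {x | I x /\ ~ P x} | ch (sval x) (sval y)}.
  apply/cid; case: x => x [Ix nPx] /=; apply: contrapT => H.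
  apply: nPx; apply: Hstep => // y xy; apply: contrapT => nPy.
  by apply: H; have [Iy _ _ _] := Hch _ _ Ix xy; exists (exist _ y (conj Iy nPy)).
pose u := fix u n := if n is n'.+1 then sval (next (u n')) else
  (exist (fun x => I x /\ ~ P x) x0 (conj Ix0 nP0)).
have Iu n : I (sval (u n)) by case: (u n) => ? [].
have uP n : ch (sval (u n)) (sval (u n.+1)) by exact: svalP (next (u n)).
have dmu n : dm (sval (u n)) = dm x0 / 2 ^+ n.
  elim: n => [|n IH]; first by rewrite expr0 divr1.
  by have [_ -> _ _] := Hch _ _ (Iu n) (uP n); rewrite IH exprSr invfM mulrA.
have [|c Hc] := @geometric_cauchy (fun n => pt (sval (u n))) (dm x0).
  by move=> n; have [_ _] := Hch _ _ (Iu n) (uP n); rewrite dmu.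
have [|c' Hc'] := @geometric_cauchy (fun n => pt' (sval (u n))) (dm x0).
  by move=> n; have [_ _ _] := Hch _ _ (Iu n) (uP n); rewrite dmu.
have [|d d0 Hd] := Hloc c c'.
  move=> e e0; have [n Hn] := half_pow_lt (dm x0) (divr_gt0 e0 (ltr0n _ 2)).
  by exists (sval (u n)); split=> //; [have := Hc n|have := Hc' n]; lra.
have [n Hn] := half_pow_lt (dm x0) d0.
by have [_] := svalP (u n); apply; apply: Hd; rewrite ?dmu.
Qed.

Lemma bisection_ind (T : Type) (I : T -> Prop) (ch : T -> T -> Prop) (pt : T -> R[i])
    (dm : T -> R) (P : T -> Prop) :
  (forall x y, I x -> ch x y ->
    [/\ I y, dm y = dm x / 2 & cabs (pt y - pt x) <= dm x]) ->
  (forall x, I x -> (forall y, ch x y -> P y) -> P x) ->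
  (forall c, (forall e : R, 0 < e -> exists2 x, I x & cabs (pt x - c) < e) ->
    exists2 d : R, 0 < d &
      forall x, I x -> dm x < d -> cabs (pt x - c) <= 2 * dm x -> P x) ->
  forall x, I x -> P x.
Proof.
move=> Hch Hstep Hloc; apply: (@bisection_ind2 _ I ch pt pt dm) => //.
  by move=> x y Ix xy; have [] := Hch _ _ Ix xy.
move=> c c' H; have [|d d0 Hd] := Hloc c.
  by move=> e /H[x [Ix xc _]]; exists x.
by exists d => // x Ix xd xc _; exact: Hd.
Qed.

End Sequences.

(** * Integrals along complex segments *)

Section SegmentIntegral.
Context {R : realType}.
Implicit Types (p q : R[i]) (f g : R[i] -> R[i]) (O : set R[i]).

Definition mid p q : R[i] := (p + q) / 2.

(** The midpoint rule on [2 ^ m] equal pieces. The recursion makes additivity over the two halves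
    definitional, and the rule is exact for affine integrands, which Goursat's lemma exploits. *)
Fixpoint midsum f (m : nat) p q : R[i] :=
  if m is m'.+1 then midsum f m' p (mid p q) + midsum f m' (mid p q) q
  else (q - p) * f (mid p q).

(** The value is [0] when the sums diverge, so additivity, scaling and bounds below ask for
    [icvg]. *)
Definition cint f p q : R[i] := xget 0 [set l | clim (fun m => midsum f m p q) l].

Definition icvg f p q := exists l, clim (fun m => midsum f m p q) l.

(** Together with [lim_closed] this stands in for closed convex sets: midpoint sums and bisection
    visit only dyadic points of a segment and their limits. *)
Definition mid_closed O := forall p q, O p -> O q -> O (mid p q).

Definition lim_closed O :=
  forall c, (forall e : R, 0 < e -> exists2 x, O x & cabs (x - c) < e) -> O c.

Lemma cabs2 : cabs (2 : R[i]) = 2.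
Proof.
have -> : (2 : R[i]) = (2 : R)%:C%C by rewrite rmorphD/= rmorph1.
by rewrite cabsR ger0_norm.
Qed.
Lemma cabs_half (z : R[i]) : cabs (z / 2) = cabs z / 2.
Proof. by rewrite cabsM cabsV cabs2. Qed.
Lemma midBl p q : mid p q - p = (q - p) / 2. Proof. by rewrite /mid; field. Qed.
Lemma midBr p q : q - mid p q = (q - p) / 2. Proof. by rewrite /mid; field. Qed.
Lemma midC p q : mid p q = mid q p. Proof. by rewrite /mid addrC. Qed.
Lemma cabs_midl p q : cabs (mid p q - p) = cabs (q - p) / 2.
Proof. by rewrite midBl cabs_half. Qed.
Lemma cabs_midr p q : cabs (q - mid p q) = cabs (q - p) / 2.
Proof. by rewrite midBr cabs_half. Qed.

Lemma mid_closed_ball (c : R[i]) (r : R) : mid_closed [set z | cabs (z - c) <= r].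
Proof.
move=> p q /= hp hq; have -> : mid p q - c = (p - c) / 2 + (q - c) / 2.
  by rewrite /mid; field.
by apply: le_trans (cabsD _ _) _; rewrite !cabs_half; lra.
Qed.

Lemma midsum_ext O f g m p q : mid_closed O -> O p -> O q ->
  (forall z, O z -> f z = g z) -> midsum f m p q = midsum g m p q.
Proof.
move=> mO + + fg; elim: m p q => [|m IH] p q Op Oq /=; first by rewrite fg//; exact: mO.
by rewrite !IH//; exact: mO.
Qed.

Lemma midsum_bound O f m p q (B : R) : mid_closed O -> O p -> O q ->
  (forall z, O z -> cabs (f z) <= B) -> cabs (midsum f m p q) <= B * cabs (q - p).
Proof.
move=> mO + + fB; elim: m p q => [|m IH] p q Op Oq /=.
  by rewrite cabsM mulrC ler_wpM2r ?cabs_ge0//; apply: fB; exact: mO.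
apply: le_trans (cabsD _ _) _.
have := IH _ _ Op (mO _ _ Op Oq); have := IH _ _ (mO _ _ Op Oq) Oq.
by rewrite cabs_midl cabs_midr; lra.
Qed.

Lemma midsumD f g m p q : midsum (fun z => f z + g z) m p q = midsum f m p q + midsum g m p q.
Proof.
elim: m p q => [|m IH] p q /=; first by rewrite mulrDr.
by rewrite !IH addrACA.
Qed.

Lemma midsumZ c f m p q : midsum (fun z => c * f z) m p q = c * midsum f m p q.
Proof.
elim: m p q => [|m IH] p q /=; first by rewrite mulrCA.
by rewrite !IH mulrDr.
Qed.

Lemma midsum_affine (a b : R[i]) m p q :
  midsum (fun z => a + b * z) m p q = (q - p) * (a + b * mid p q).
Proof.
by elim: m p q => [|m IH] p q //=; rewrite !IH /mid; field.
Qed.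

Lemma midsum_cst (a : R[i]) m p q : midsum (fun=> a) m p q = (q - p) * a.
Proof.
by elim: m p q => [|m IH] p q //=; rewrite !IH /mid; field.
Qed.

Lemma midsum_swap f m p q : midsum f m q p = - midsum f m p q.
Proof.
elim: m p q => [|m IH] p q /=; first by rewrite (midC q p) -(opprB q p) mulNr.
by rewrite (midC q p) (IH (mid p q) q) (IH p (mid p q)) opprD addrC.
Qed.

Lemma cintP f p q : icvg f p q -> clim (fun m => midsum f m p q) (cint f p q).
Proof.
by move=> [l Hl]; rewrite /cint; case: xgetP => [x -> //|/(_ l)]; case.
Qed.

Lemma cint_eq f p q l : clim (fun m => midsum f m p q) l -> cint f p q = l.
Proof. by move=> H; have /cintP/clim_uniq := ex_intro _ l H : icvg f p q; exact. Qed.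

Lemma cint_ext O f g p q : mid_closed O -> O p -> O q ->
  (forall z, O z -> f z = g z) -> cint f p q = cint g p q.
Proof.
move=> mO Op Oq fg; rewrite /cint.
suff -> : (fun m => midsum f m p q) = (fun m => midsum g m p q) by [].
by apply/funext => m; exact: midsum_ext fg.
Qed.

Lemma cint_bound O f p q (B : R) : mid_closed O -> O p -> O q -> icvg f p q ->
  (forall z, O z -> cabs (f z) <= B) -> cabs (cint f p q) <= B * cabs (q - p).
Proof.
move=> mO Op Oq /cintP cf fB; apply: (clim_bound (M := 0) cf) => m _.
exact: midsum_bound fB.
Qed.

Lemma cintD f g p q : icvg f p q -> icvg g p q ->
  cint (fun z => f z + g z) p q = cint f p q + cint g p q.
Proof.
move=> /cintP cf /cintP cg; apply: cint_eq; apply: clim_ext (climD cf cg) => m.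
by rewrite midsumD.
Qed.

Lemma cintZ c f p q : icvg f p q -> cint (fun z => c * f z) p q = c * cint f p q.
Proof.
move=> /cintP cf; apply: cint_eq; apply: clim_ext (climM c cf) => m.
by rewrite midsumZ.
Qed.

Lemma cint_swap f p q : icvg f p q -> cint f q p = - cint f p q.
Proof.
move=> /cintP cf; rewrite -mulN1r; apply: cint_eq; apply: clim_ext (climM _ cf) => m.
by rewrite (midsum_swap f m p q) mulN1r.
Qed.

Lemma cint_mid f p q : icvg f p (mid p q) -> icvg f (mid p q) q ->
  cint f p q = cint f p (mid p q) + cint f (mid p q) q.
Proof.
move=> /cintP cf /cintP cg; apply: cint_eq; apply: clim_shift.
exact: climD cf cg.
Qed.

Definition halves (x y : R[i] * R[i]) :=
  y = (x.1, mid x.1 x.2) \/ y = (mid x.1 x.2, x.2).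

(** Bisection with the left end as marked point: it is within twice the length of [c], hence the
    right end is within three times the length. *)
Lemma half_ind O (P : R[i] -> R[i] -> Prop) : mid_closed O -> lim_closed O ->
  (forall p q, O p -> O q -> P p (mid p q) -> P (mid p q) q -> P p q) ->
  (forall c, O c -> exists2 d : R, 0 < d &
    forall p q, O p -> O q -> cabs (q - p) < d ->
      cabs (p - c) <= 3 * cabs (q - p) -> cabs (q - c) <= 3 * cabs (q - p) -> P p q) ->
  forall p q, O p -> O q -> P p q.
Proof.
move=> mO lO Hstep Hloc p q Op Oq.
apply: (@bisection_ind R (R[i] * R[i])%type (fun x => O x.1 /\ O x.2) halves
  (fun x => x.1) (fun x => cabs (x.2 - x.1)) (fun x => P x.1 x.2)
  _ _ _ (p, q)) => //=.
- move=> [a b] y /= [Oa Ob] [|] -> /=; split=> //.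
  + by split=> //; exact: mO.
  + exact: cabs_midl.
  + by rewrite subrr cabs0 cabs_ge0.
  + by split=> //; exact: mO.
  + exact: cabs_midr.
  + by rewrite cabs_midl; have := cabs_ge0 (b - a); lra.
- move=> [a b] /= [Oa Ob] H; apply: Hstep => //.
    by apply: (H (a, mid a b)); left.
  by apply: (H (mid a b, b)); right.
- move=> c Hc; have /Hloc[d d0 Hd] : O c.
    by apply: lO => e /Hc[[a b] [/= Oa _] ac]; exists a.
  exists d => // -[a b] /= [Oa Ob] abd ac; apply: Hd => //.
    by have := cabs_ge0 (b - a); lra.
  by have := cabs_tri b a c; lra.
Qed.

Lemma midsum_near O f p q v (e : R) m : mid_closed O -> O p -> O q ->
  (forall z, O z -> cabs (f z - v) <= e) ->
  cabs (midsum f m p q - (q - p) * v) <= e * cabs (q - p).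
Proof.
move=> mO Op Oq H.
have -> : midsum f m p q - (q - p) * v = midsum (fun z => f z + (- v)) m p q.
  by rewrite midsumD midsum_cst mulrN.
exact: midsum_bound H.
Qed.

Lemma cint_near O f p q v (e : R) : mid_closed O -> O p -> O q -> icvg f p q ->
  (forall z, O z -> cabs (f z - v) <= e) ->
  cabs (cint f p q - (q - p) * v) <= e * cabs (q - p).
Proof.
move=> mO Op Oq /cintP cf H.
apply: (@clim_bound _ (fun m => midsum f m p q - (q - p) * v) _ _ 0).
  by apply: climD cf _; exact: clim_cst.
by move=> m _; exact: midsum_near H.
Qed.

(** The Cauchy estimate is taken relative to the length, as [e * cabs (q - p)]. Such an error adds
    up under halving, so bisection reduces it to short segments, where every sum is close to
    [(q - p) * f c]. *)
Lemma icvg_cont O f p q : mid_closed O -> lim_closed O ->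
  (forall c, O c -> cont f c) -> O p -> O q -> icvg f p q.
Proof.
move=> mO lO cf Op Oq; apply: complex_cauchy => e e0.
have L0 : 0 < cabs (q - p) + 1 by have := cabs_ge0 (q - p); lra.
suff : exists M : nat, forall m n, (M <= m)%N -> (M <= n)%N ->
  cabs (midsum f m p q - midsum f n p q) <= e / (cabs (q - p) + 1) * cabs (q - p).
  move=> [M HM]; exists M => m n Mm Mn; apply: le_trans (HM _ _ Mm Mn) _.
  by rewrite mulrAC ler_pdivrMr// ler_pM2l//; lra.
have e'0 : 0 < e / (cabs (q - p) + 1) by rewrite divr_gt0.
move: (e / _) e'0 => {L0 e0}e e0; move: p q Op Oq; apply: (half_ind mO lO).
- move=> p q Op Oq [M HM] [M' HM']; exists (maxn M M').+1 => -[//|m] [//|n].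
  rewrite !ltnS !geq_max => /andP[Mm Mm'] /andP[Mn Mn'] /=.
  have := HM _ _ Mm Mn; have := HM' _ _ Mm' Mn'.
  rewrite cabs_midl cabs_midr opprD addrACA => h h'.
  by apply: le_trans (cabsD _ _) _; lra.
- move=> c Oc.
  have /near_cabs[d d0 Hd] := (contP _ _).1 (cf _ Oc) _ (divr_gt0 e0 (ltr0n _ 2)).
  exists (d / 4) => [|p q Op Oq pq pc qc]; first by rewrite divr_gt0.
  exists 0 => m n _ _.
  have H z : cabs (z - c) <= 3 * cabs (q - p) -> cabs (f z - f c) <= e / 2.
    by move=> h; apply/ltW/Hd; have := cabs_ge0 (q - p); lra.
  have := midsum_near m (@mid_closed_ball c (3 * cabs (q - p))) pc qc H; have := midsum_near n (@mid_closed_ball c (3 * cabs (q - p))) pc qc H.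
  have := cabs_tri (midsum f m p q) ((q - p) * f c) (midsum f n p q).
  by rewrite (cabsB ((q - p) * f c) (midsum f n p q)); lra.
Qed.

(** The neighbourhood of [s0] belongs to the statement proved by bisection, and each halving
    intersects two of them. This does the work of uniform continuity along the segment. *)
Lemma cint_continuous (T : topologicalType) O (phi : T -> R[i] -> R[i]) s0 p q :
  mid_closed O -> lim_closed O -> O p -> O q ->
  (forall c, O c -> cont (fun st => phi st.1 st.2) (s0, c)) ->
  (\forall s \near s0, icvg (phi s) p q) ->
  cont (fun s => cint (phi s) p q) s0.
Proof.
move=> mO lO Op Oq cphi icv; apply/contP => e e0.
have L0 : 0 < cabs (q - p) + 1 by have := cabs_ge0 (q - p); lra.
suff [M HM] : exists M : nat, \forall s \near s0, forall m, (M <= m)%N ->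
  cabs (midsum (phi s) m p q - midsum (phi s0) m p q) <=
     e / (cabs (q - p) + 1) * cabs (q - p).
  have i0 := nbhs_singleton icv.
  near=> s; have icvs : icvg (phi s) p q by near: s.
  have : cabs (cint (phi s) p q - cint (phi s0) p q) <=
     e / (cabs (q - p) + 1) * cabs (q - p).
    apply: (@clim_bound _
      (fun m => midsum (phi s) m p q + -1 * midsum (phi s0) m p q) _ _ M).
      by rewrite -[X in _ + X]mulN1r; apply: climD (cintP icvs) (climM _ (cintP i0)).
    by move=> m Mm; rewrite mulN1r; move: m Mm; near: s.
  move=> /le_lt_trans; apply; rewrite mulrAC ltr_pdivrMr//.
  by rewrite ltr_pM2l//; lra.
have e'0 : 0 < e / (cabs (q - p) + 1) by rewrite divr_gt0.
move: (e / _) e'0 => {L0 icv e0}e e0; move: p q Op Oq; apply: (half_ind mO lO).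
- move=> p q Op Oq [M HM] [M' HM']; exists (maxn M M').+1.
  near=> s => -[//|m]; rewrite ltnS geq_max => /andP[Mm Mm'] /=.
  have h : cabs (midsum (phi s) m p (mid p q) - midsum (phi s0) m p (mid p q)) <=
    e * cabs (mid p q - p) by move: m Mm {Mm'}; near: s.
  have h' : cabs (midsum (phi s) m (mid p q) q - midsum (phi s0) m (mid p q) q) <=
    e * cabs (q - mid p q) by move: m Mm' {Mm h}; near: s.
  move: h h'; rewrite cabs_midl cabs_midr opprD addrACA => h h'.
  by apply: le_trans (cabsD _ _) _; lra.
- move=> c Oc.
  have [[A B] /= [s0A]] := (contP _ _).1 (cphi _ Oc) _ (divr_gt0 e0 (ltr0n _ 2)).
  move=> /near_cabs[d d0 Hd] HAB.
  exists (d / 4) => [|p q Op Oq pq pc qc]; first by rewrite divr_gt0.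
  have As0 := nbhs_singleton s0A.
  exists 0; apply: filterS s0A => s As m _.
  have H z : cabs (z - c) <= 3 * cabs (q - p) -> cabs (phi s z - phi s0 c) <= e / 2.
    move=> h; apply/ltW/(HAB (s, z)); split=> //=; apply: Hd.
    by have := cabs_ge0 (q - p); lra.
  have H0 z : cabs (z - c) <= 3 * cabs (q - p) -> cabs (phi s0 z - phi s0 c) <= e / 2.
    move=> h; apply/ltW/(HAB (s0, z)); split=> //=.
    by apply: Hd; have := cabs_ge0 (q - p); lra.
  have := midsum_near m (@mid_closed_ball c (3 * cabs (q - p))) pc qc H; have := midsum_near m (@mid_closed_ball c (3 * cabs (q - p))) pc qc H0.
  have := cabs_tri (midsum (phi s) m p q) ((q - p) * phi s0 c) (midsum (phi s0) m p q).
  by rewrite (cabsB ((q - p) * phi s0 c) (midsum (phi s0) m p q)); lra.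
Unshelve. all: by end_near. Qed.

End SegmentIntegral.

(** * Complex derivatives and Goursat's lemma *)

Section Continuity.
Context {R : realType} {T : topologicalType}.
Implicit Types (f g : T -> R[i]) (a : T).

Lemma cont_ext f g a : f =1 g -> cont f a -> cont g a.
Proof. by move=> /funext->. Qed.

Lemma cont_cst (c : R[i]) a : cont (fun=> c : R[i]) a.
Proof. exact: cvg_cst. Qed.

Lemma contD f g a : cont f a -> cont g a ->
  cont (fun t => f t + g t) a.
Proof. by move=> cf cg; exact: cvgD cf cg. Qed.

Lemma contN f a : cont f a -> cont (fun t => - f t) a.
Proof. by move=> cf; exact: cvgN cf. Qed.

Lemma contB f g a : cont f a -> cont g a ->
  cont (fun t => f t - g t) a.
Proof. by move=> cf cg; exact: cvgB cf cg. Qed.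

Lemma contM f g a : cont f a -> cont g a ->
  cont (fun t => f t * g t) a.
Proof. by move=> cf cg; exact: cvgM cf cg. Qed.

Lemma contV f a : f a != 0 -> cont f a -> cont (fun t => (f t)^-1) a.
Proof. by move=> fa cf; exact: cvgV fa cf. Qed.

Lemma cont_comp (S : topologicalType) (h : S -> T) f (s : S) :
  {for s, continuous h} -> cont f (h s) -> cont (fun x => f (h x)) s.
Proof. by move=> ch cf; exact: continuous_comp ch cf. Qed.

Lemma contX f n a : cont f a -> cont (fun t => f t ^+ n) a.
Proof.
move=> cf; elim: n => [|n IH].
  exact: cont_cst.
by apply: cont_ext (contM cf IH) => t; rewrite exprS.
Qed.

End Continuity.

Section ComplexDerivative.
Context {R : realType}.
Implicit Types (f g : R[i] -> R[i]) (a : R[i]).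

(** Caratheodory's form of complex differentiability: the difference quotient extends to a function
    continuous at [a], whose value there is the derivative. Sum, product and chain rules become
    algebra. *)
Definition cdiff f a := exists2 phi : R[i] -> R[i], cont phi a &
  \forall t \near a, f t - f a = phi t * (t - a).

Lemma cont_id a : cont (fun t : R[i] => t) a.
Proof. exact: cvg_id. Qed.

Lemma cdiff_continuous f a : cdiff f a -> cont f a.
Proof.
move=> [phi cphi H].
have c : cont (fun t => f a + phi t * (t - a)) a.
  exact: contD (@cont_cst _ _ (f a) a) (contM cphi (contB (@cont_id a) (@cont_cst _ _ a a))).
apply/contP => e e0; move/contP : c => /(_ _ e0).
rewrite subrr mulr0 addr0; apply: filterS2 H => t Ht.
by rewrite -Ht addrCA subrr addr0.
Qed.

Lemma cdiff_near f g a : (\forall t \near a, f t = g t) -> cdiff f a -> cdiff g a.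
Proof.
move=> fg [phi cphi H]; exists phi => //.
by rewrite -(nbhs_singleton fg); near=> t; rewrite -(near fg t)//; near: t.
Unshelve. all: by end_near. Qed.

Lemma cdiff_cst (c : R[i]) a : cdiff (fun=> c) a.
Proof.
by exists (fun=> 0); [exact: cont_cst|near=> t; rewrite subrr mul0r].
Unshelve. all: by end_near. Qed.

Lemma cdiff_id a : cdiff id a.
Proof.
by exists (fun=> 1); [exact: cont_cst|near=> t; rewrite mul1r].
Unshelve. all: by end_near. Qed.

Lemma cdiffD f g a : cdiff f a -> cdiff g a -> cdiff (fun t => f t + g t) a.
Proof.
move=> [phi cphi H] [psi cpsi H']; exists (fun t => phi t + psi t).
  exact: contD.
by near=> t; rewrite opprD addrACA (near H t)// (near H' t)// mulrDl.
Unshelve. all: by end_near. Qed.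

Lemma cdiffM f g a : cdiff f a -> cdiff g a -> cdiff (fun t => f t * g t) a.
Proof.
move=> [phi cphi H] dg; have cg := cdiff_continuous dg; case: dg => [psi cpsi H'].
exists (fun t => phi t * g t + f a * psi t).
  exact: contD (contM cphi cg) (contM (@cont_cst _ _ (f a) a) cpsi).
near=> t.
have -> : f t * g t - f a * g a = (f t - f a) * g t + f a * (g t - g a) by ring.
by rewrite (near H t)// (near H' t)//; ring.
Unshelve. all: by end_near. Qed.

Lemma cdiffN f a : cdiff f a -> cdiff (fun t => - f t) a.
Proof.
move=> [phi cphi H]; exists (fun t => - phi t); first exact: contN.
by near=> t; rewrite -opprD (near H t)// mulNr.
Unshelve. all: by end_near. Qed.

Lemma cdiffB f g a : cdiff f a -> cdiff g a -> cdiff (fun t => f t - g t) a.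
Proof. by move=> df dg; apply: cdiffD => //; exact: cdiffN. Qed.

Lemma cdiffZ (c : R[i]) f a : cdiff f a -> cdiff (fun t => c * f t) a.
Proof. by move=> df; apply: cdiffM => //; exact: cdiff_cst. Qed.

Lemma near_neq0 (T : topologicalType) (f : T -> R[i]) (a : T) :
  cont f a -> f a != 0 -> \forall t \near a, f t != 0.
Proof.
move=> cf fa; move/contP : cf => /(_ (cabs (f a))).
rewrite cabs_gt0 => /(_ fa); apply: filterS => t; apply: contraTneq => ->.
by rewrite sub0r cabsN ltxx.
Qed.

Lemma cdiffV f a : f a != 0 -> cdiff f a -> cdiff (fun t => (f t)^-1) a.
Proof.
move=> fa df; have cf := cdiff_continuous df; case: df => [phi cphi H].
exists (fun t => - (phi t * (f t)^-1 * (f a)^-1)).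
  exact: contN (contM (contM cphi (contV fa cf)) (@cont_cst _ _ (f a)^-1 a)).
have f0 := near_neq0 cf fa.
near=> t; have ft : f t != 0 by near: t.
have -> : (f t)^-1 - (f a)^-1 = - ((f t - f a) * (f t)^-1 * (f a)^-1).
  by field; rewrite ft fa.
by rewrite (near H t)//; ring.
Unshelve. all: by end_near. Qed.

Lemma cdiff_comp f g a : cdiff f a -> cdiff g (f a) -> cdiff (fun t => g (f t)) a.
Proof.
move=> df [psi cpsi H']; have cf := cdiff_continuous df; case: df => [phi cphi H].
exists (fun t => psi (f t) * phi t).
  exact: contM (cont_comp cf cpsi) cphi.
have {}H' := cf _ H'.
near=> t; have -> : g (f t) - g (f a) = psi (f t) * (f t - f a) by near: t.
by rewrite (near H t)// mulrA.
Unshelve. all: by end_near. Qed.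

Lemma cdiffX f n a : cdiff f a -> cdiff (fun t => f t ^+ n) a.
Proof.
move=> df; elim: n => [|n IH].
  by under eq_fun do rewrite expr0; exact: cdiff_cst.
by under eq_fun do rewrite exprS; exact: cdiffM.
Qed.

Lemma cdiff_sum (I : Type) (r : seq I) (P : pred I) (F : I -> R[i] -> R[i]) a :
  (forall i, P i -> cdiff (F i) a) -> cdiff (fun t => \sum_(i <- r | P i) F i t) a.
Proof.
move=> H; elim: r => [|i r IH].
  by under eq_fun do rewrite big_nil; exact: cdiff_cst.
under eq_fun do rewrite big_cons.
by case: (boolP (P i)) => // Pi; apply: cdiffD => //; exact: H.
Qed.

Lemma cdiff_horner (P : {poly R[i]}) a : cdiff (fun t => P.[t]) a.
Proof.
under eq_fun do rewrite horner_coef.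
by apply: cdiff_sum => i _; apply: cdiffZ; apply: cdiffX; exact: cdiff_id.
Qed.

Lemma cabs_conj (z : R[i]) : cabs (z^*)%C = cabs z.
Proof. by case: z => x y /=; rewrite sqrrN. Qed.

Lemma cont_conj : continuous (fun z : R[i] => (z^*)%C).
Proof.
move=> a; apply/contP => e e0; apply/near_cabs; exists e => // x.
by rewrite -rmorphB cabs_conj.
Qed.

Lemma cdiff_conj f a : cdiff f (a^*)%C -> cdiff (fun t => (f (t^*)%C)^*%C) a.
Proof.
move=> [phi cphi H]; exists (fun t => (phi (t^*)%C)^*%C).
  apply: (@cont_comp _ _ _ (fun t => phi (t^*)%C) conjc a); last exact: cont_conj.
  exact: cont_comp (@cont_conj a) cphi.
have {}H := cont_conj H.
near=> t; have e : f (t^*)%C - f (a^*)%C = phi (t^*)%C * ((t^*)%C - (a^*)%C) by near: t.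
by rewrite -rmorphB e rmorphM rmorphB /= !conjcK.
Unshelve. all: by end_near. Qed.

(** The bound [e * per ^ 2] is stable when a triangle is cut into four of half the size, and it
    holds for small triangles because [f] is nearly affine there and affine functions integrate to
    zero around a triangle. *)
Lemma goursat (O : set R[i]) f p q s : mid_closed O -> lim_closed O ->
  (forall c, O c -> cdiff f c) -> O p -> O q -> O s ->
  cint f p q + cint f q s + cint f s p = 0.
Proof.
move=> mO lO df Op Oq Os.
have icv a b : O a -> O b -> icvg f a b.
  by move=> Oa Ob; apply: icvg_cont mO lO _ Oa Ob => c /df/cdiff_continuous.
pose per (x : R[i] * R[i] * R[i]) :=
  cabs (x.1.2 - x.1.1) + cabs (x.2 - x.1.2) + cabs (x.1.1 - x.2).
pose T (x : R[i] * R[i] * R[i]) :=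
  cint f x.1.1 x.1.2 + cint f x.1.2 x.2 + cint f x.2 x.1.1.
suff H (e : R) : 0 < e -> cabs (T (p, q, s)) <= e * per (p, q, s) ^+ 2.
  apply/eqP; rewrite -cabs_eq0 eq_le cabs_ge0 andbT.
  apply/ler_addgt0Pl => e e0; rewrite addr0.
  have per0 : 0 < per (p, q, s) ^+ 2 + 1 by have := sqr_ge0 (per (p, q, s)); lra.
  have := H _ (divr_gt0 e0 per0) => /le_trans; apply.
  by rewrite mulrAC ler_pdivrMr// ler_pM2l//; lra.
move=> e0.
(* Three corner triangles and the medial one. The medial triangle traverses its sides against the
   corner triangles, so the inner sides cancel. *)
pose ch (x y : R[i] * R[i] * R[i]) := let: (a, b, c) := x in
  [\/ y = (a, mid a b, mid a c), y = (mid a b, b, mid b c),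
      y = (mid a c, mid b c, c) | y = (mid b c, mid a c, mid a b)].
have cmid (a b c : R[i]) : cabs (mid b c - mid a c) = cabs (b - a) / 2.
  by rewrite -cabs_half; congr cabs; rewrite /mid; field.
have cmid' (a b c : R[i]) : cabs (mid c b - mid c a) = cabs (b - a) / 2.
  by rewrite (midC c b) (midC c a).
have cmid2 (a b c : R[i]) : cabs (mid b c - mid a b) = cabs (c - a) / 2.
  by rewrite -cabs_half; congr cabs; rewrite /mid; field.
have cmid3 (a b : R[i]) : cabs (a - mid a b) = cabs (a - b) / 2.
  by rewrite -cabs_half; congr cabs; rewrite /mid; field.
have := @bisection_ind R (R[i] * R[i] * R[i])%type
  (fun x => [/\ O x.1.1, O x.1.2 & O x.2]) ch (fun x => x.1.1) per
  (fun x => cabs (T x) <= e * per x ^+ 2) _ _ _ (p, q, s); apply=> //=.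
- move=> [[a b] c] y [/= Oa Ob Oc] [] -> /=; split=> /=.
  + by split => //; exact: mO.
  + rewrite /per /= cabs_midl cmid' cmid3; lra.
  + by rewrite subrr cabs0 !addr_ge0 ?cabs_ge0.
  + by split => //; exact: mO.
  + rewrite /per /= cabs_midr cabs_midl (cabsB (mid a b)) cmid2 (cabsB c a); lra.
  + rewrite cabs_midl /per /=; have := cabs_ge0 (b - a); have := cabs_ge0 (c - b).
    have := cabs_ge0 (a - c); lra.
  + by split => //; exact: mO.
  + rewrite /per /= cabs_midr cmid (cabsB (mid a c)) cabs_midr (cabsB c a); lra.
  + rewrite cabs_midl /per /= (cabsB c a); have := cabs_ge0 (b - a).
    have := cabs_ge0 (c - b); have := cabs_ge0 (a - c); lra.
  + by split => //; exact: mO.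
  + rewrite /per /= cmid2 (cabsB (mid a c) (mid b c)) cmid (cabsB (mid a b)) cmid'.
    rewrite (cabsB c a); lra.
  + rewrite /per /=; have := cabs_tri (mid b c) b a.
    rewrite cabs_midl (cabsB b a) => /le_trans; apply.
    have := cabs_ge0 (b - a); have := cabs_ge0 (c - b); have := cabs_ge0 (a - c).
    rewrite (cabsB a b); lra.
- move=> [[a b] c] [/= Oa Ob Oc] H.
  have h1 := H _ (Or41 _ _ _ erefl); have h2 := H _ (Or42 _ _ _ erefl).
  have h3 := H _ (Or43 _ _ _ erefl); have h4 := H _ (Or44 _ _ _ erefl).
  have eqT : T (a, b, c) = T (a, mid a b, mid a c) + T (mid a b, b, mid b c) +
       (T (mid a c, mid b c, c) + T (mid b c, mid a c, mid a b)).
    rewrite /T /= (@cint_mid _ f a b); try by apply: icv => //; exact: mO.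
    rewrite (@cint_mid _ f b c); try by apply: icv => //; exact: mO.
    rewrite (@cint_mid _ f c a); try by apply: icv => //; exact: mO.
    rewrite (midC c a).
    rewrite (@cint_swap _ f (mid a b) (mid a c)); last by apply: icv; exact: mO.
    rewrite (@cint_swap _ f (mid a b) (mid b c)); last by apply: icv; exact: mO.
    rewrite (@cint_swap _ f (mid a c) (mid b c)); last by apply: icv; exact: mO.
    ring.
  have p1 : per (a, mid a b, mid a c) = per (a, b, c) / 2.
    by rewrite /per /= cabs_midl cmid' cmid3; lra.
  have p2 : per (mid a b, b, mid b c) = per (a, b, c) / 2.
    by rewrite /per /= cabs_midr cabs_midl (cabsB (mid a b)) cmid2 (cabsB c a); lra.
  have p3 : per (mid a c, mid b c, c) = per (a, b, c) / 2.
    by rewrite /per /= cabs_midr cmid (cabsB (mid a c)) cabs_midr (cabsB c a); lra.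
  have p4 : per (mid b c, mid a c, mid a b) = per (a, b, c) / 2.
    rewrite /per /= cmid2 (cabsB (mid a c) (mid b c)) cmid (cabsB (mid a b)) cmid'.
    by rewrite (cabsB c a); lra.
  rewrite eqT; apply: le_trans (cabsD _ _) _.
  have := cabsD (T (a, mid a b, mid a c)) (T (mid a b, b, mid b c)).
  have := cabsD (T (mid a c, mid b c, c)) (T (mid b c, mid a c, mid a b)).
  move: h1 h2 h3 h4; rewrite p1 p2 p3 p4 expr_div_n; lra.
- move=> c Hc.
  have [phi cphi Hphi] : cdiff f c.
    by apply/df/lO => e' /Hc[x [Ox _ _] xc]; exists x.1.1.
  move/near_cabs : Hphi => [d d0 Hd].
  (* The whole triangle is within [3 * per] of [c], so the remainder is at most [e / 9 * (3 * per)];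
     integrated along the perimeter this gives [e / 3 * per ^ 2]. *)
  have e30 : 0 < e / 9 by rewrite divr_gt0.
  have /near_cabs[d' d'0 Hd'] := (contP _ _).1 cphi _ e30.
  exists (Num.min d d' / 4) => [|[[a b] u]]; first by rewrite divr_gt0// lt_min d0.
  move=> [/= Oa Ob Ou] perd ac.
  have permin : 3 * per (a, b, u) < Num.min d d'.
    have : 0 <= per (a, b, u) by rewrite !addr_ge0 ?cabs_ge0.
    lra.
  move: permin; rewrite lt_min => /andP[perd1 perd2].
  have s1 := cabs_ge0 (b - a); have s2 := cabs_ge0 (u - b); have s3 := cabs_ge0 (a - u).
  have perE : per (a, b, u) = cabs (b - a) + cabs (u - b) + cabs (a - u) by [].
  pose rem t := f t - (f c - phi c * c + phi c * t).
  pose B := [set z | cabs (z - c) <= 3 * per (a, b, u)].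
  have remB z : B z -> cabs (rem z) <= e / 3 * per (a, b, u).
    move=> /= zc; rewrite /rem.
    have -> : f z - (f c - phi c * c + phi c * z) = (f z - f c) - phi c * (z - c).
      by ring.
    rewrite Hd; last by apply: le_lt_trans zc _.
    rewrite -mulrBl cabsM.
    have h : cabs (phi z - phi c) < e / 9 by apply: Hd'; exact: le_lt_trans zc _.
    apply: (@le_trans _ _ (e / 9 * (3 * per (a, b, u)))); last by lra.
    by apply: ler_pM => //; rewrite ?cabs_ge0// ltW.
  have Ba : B a by rewrite /B /=; lra.
  have Bb : B b by rewrite /B /=; have := cabs_tri b a c; lra.
  have Bu : B u.
    by rewrite /B /=; have := cabs_tri u a c; rewrite (cabsB u a); lra.
  have mB := @mid_closed_ball _ c (3 * per (a, b, u)).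
  have fE m x y : midsum f m x y = midsum rem m x y +
      (y - x) * (f c - phi c * c + phi c * mid x y).
    rewrite -(midsum_affine _ _ m) -midsumD; congr (midsum _ _ _ _).
    by apply/funext => z; rewrite /rem subrK.
  have cv := climD (climD (cintP (icv _ _ Oa Ob)) (cintP (icv _ _ Ob Ou)))
    (cintP (icv _ _ Ou Oa)).
  apply: (clim_bound (M := 0) cv) => m _.
  (* The affine parts cancel exactly at every level [m], since [(y - x) * mid x y] is half of
     [y ^ 2 - x ^ 2]. *)
  have -> : midsum f m a b + midsum f m b u + midsum f m u a =
     midsum rem m a b + midsum rem m b u + midsum rem m u a.
    by rewrite !fE /mid; field.
  have r1 := midsum_bound m mB Ba Bb remB; have r2 := midsum_bound m mB Bb Bu remB.
  have r3 := midsum_bound m mB Bu Ba remB.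
  apply: le_trans (cabsD _ _) _; have := cabsD (midsum rem m a b) (midsum rem m b u).
  have -> : e * per (a, b, u) ^+ 2 = e / 3 * per (a, b, u) * cabs (b - a) +
     e / 3 * per (a, b, u) * cabs (u - b) + e / 3 * per (a, b, u) * cabs (a - u) +
     (e * per (a, b, u)) * (2 / 3 * per (a, b, u)).
    rewrite -!mulrDr -perE; lra.
  have : 0 <= (e * per (a, b, u)) * (2 / 3 * per (a, b, u)).
    have per0 : 0 <= per (a, b, u) by rewrite perE; lra.
    by apply: mulr_ge0; apply: mulr_ge0; rewrite ?(ltW e0)//.
  lra.
Qed.

End ComplexDerivative.

(** * Fubini's theorem *)

Section Fubini.
Context {R : realType}.
Implicit Types (phi : R[i] -> R[i] -> R[i]) (O U : set R[i]).

Lemma cont_pairl phi s t : cont (fun st => phi st.1 st.2) (s, t) -> cont (phi s) t.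
Proof.
move=> c; apply: (@cont_comp _ _ _ (fun t => (s, t)) (fun st => phi st.1 st.2)) => //.
by apply: (@cvg_pair _ _ _ (nbhs t) (nbhs s) (nbhs t)); [exact: cvg_cst|exact: cvg_id].
Qed.

Lemma cont_swap phi s t : cont (fun st => phi st.1 st.2) (s, t) ->
  cont (fun ts => phi ts.2 ts.1) (t, s).
Proof.
move=> c; apply: (@cont_comp _ _ _ (fun ts => (ts.2, ts.1)) (fun st => phi st.1 st.2)) => //.
by apply: (@cvg_pair _ _ _ (nbhs (t, s)) (nbhs s) (nbhs t)); [exact: cvg_snd|exact: cvg_fst].
Qed.

(** The sets [U] and [U'] surround [O] and [O'] because continuity of the inner integral at a
    parameter requires its existence at all nearby parameters, not only at those in [O]. *)
Lemma cint_cint_split O O' U U' phi p q a b :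
  mid_closed O -> lim_closed O -> mid_closed O' -> lim_closed O' ->
  (forall s, O s -> \forall s' \near s, U s') ->
  (forall t, O' t -> \forall t' \near t, U' t') ->
  (forall s t, U s -> U' t -> cont (fun st => phi st.1 st.2) (s, t)) ->
  O p -> O q -> O' a -> O' b ->
  icvg (fun s => cint (phi s) a b) p q /\
  cint (fun s => cint (phi s) a b) p q =
    cint (fun s => cint (phi s) a (mid a b)) p (mid p q) +
    cint (fun s => cint (phi s) (mid a b) b) p (mid p q) +
    (cint (fun s => cint (phi s) a (mid a b)) (mid p q) q +
     cint (fun s => cint (phi s) (mid a b) b) (mid p q) q).
Proof.
move=> mO lO mO' lO' OU OU' cphi Op Oq Oa Ob.
have icv s x y : U s -> O' x -> O' y -> icvg (phi s) x y.
  move=> Us Ox Oy; apply: (icvg_cont mO' lO' _ Ox Oy) => c O'c.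
  by apply: cont_pairl; apply: cphi => //; exact: nbhs_singleton (OU' _ O'c).
have Icv x y z w : O' x -> O' y -> O z -> O w -> icvg (fun s => cint (phi s) x y) z w.
  move=> Ox Oy Oz Ow; apply: (icvg_cont mO lO _ Oz Ow) => c Oc.
  apply: (cint_continuous mO' lO' Ox Oy).
    move=> t Ot; apply: cphi.
      exact: nbhs_singleton (OU _ Oc).
    exact: nbhs_singleton (OU' _ Ot).
  by apply: filterS (OU _ Oc) => s Us; exact: (icv _ _ _ Us Ox Oy).
split; first exact: Icv.
have Om := mO _ _ Op Oq; have Om' := mO' _ _ Oa Ob.
have H x y : O x -> O y -> cint (fun s => cint (phi s) a b) x y =
    cint (fun s => cint (phi s) a (mid a b)) x y +
    cint (fun s => cint (phi s) (mid a b) b) x y.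
  move=> Ox Oy; rewrite -cintD; [|exact: Icv|exact: Icv].
  apply: (cint_ext mO Ox Oy) => s Os; have Us := nbhs_singleton (OU _ Os).
  by apply: cint_mid; exact: icv.
by rewrite cint_mid ?H//; exact: Icv.
Qed.

Lemma mid_closedI O O' : mid_closed O -> mid_closed O' -> mid_closed (O `&` O').
Proof. by move=> m m' p q [? ?] [? ?]; split; [exact: m|exact: m']. Qed.

Lemma lim_closedI O O' : lim_closed O -> lim_closed O' -> lim_closed (O `&` O').
Proof.
move=> m m' c H; split; [apply: m|apply: m'] => e /H[x [? ?] xc]; by exists x.
Qed.

(** The difference [D] of the two iterated integrals is additive over the four products of halves,
    so a bound quadratic in the size is stable. On a small product both integrals are
    [(y - x) * (w - z) * phi c c'] up to such an error. *)
Lemma cint_fubini O O' U U' phi p q a b :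
  mid_closed O -> lim_closed O -> mid_closed O' -> lim_closed O' ->
  (forall s, O s -> \forall s' \near s, U s') ->
  (forall t, O' t -> \forall t' \near t, U' t') ->
  (forall s t, U s -> U' t -> cont (fun st => phi st.1 st.2) (s, t)) ->
  O p -> O q -> O' a -> O' b ->
  cint (fun s => cint (phi s) a b) p q = cint (fun t => cint (phi^~ t) p q) a b.
Proof.
move=> mO lO mO' lO' OU OU' cphi Op Oq Oa Ob.
pose psi t s := phi s t.
have cpsi t s : U' t -> U s -> cont (fun ts => psi ts.1 ts.2) (t, s).
  by move=> U't Us; apply: (@cont_swap phi); exact: cphi.
have S1 := fun x y z w => @cint_cint_split _ _ _ _ phi x y z w mO lO mO' lO' OU OU' cphi.
have S2 := fun x y z w => @cint_cint_split _ _ _ _ psi z w x y mO' lO' mO lO OU' OU cpsi.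
pose D (x : (R[i] * R[i]) * (R[i] * R[i])) :=
  cint (fun s => cint (phi s) x.2.1 x.2.2) x.1.1 x.1.2 -
  cint (fun t => cint (psi t) x.1.1 x.1.2) x.2.1 x.2.2.
pose dm (x : (R[i] * R[i]) * (R[i] * R[i])) := cabs (x.1.2 - x.1.1) + cabs (x.2.2 - x.2.1).
suff H (e : R) : 0 < e -> cabs (D ((p, q), (a, b))) <= e * dm ((p, q), (a, b)) ^+ 2.
  apply/eqP; rewrite -subr_eq0 -cabs_eq0 eq_le cabs_ge0 andbT.
  apply/ler_addgt0Pl => e e0; rewrite addr0.
  have dm0 : 0 < dm ((p, q), (a, b)) ^+ 2 + 1.
    by have := sqr_ge0 (dm ((p, q), (a, b))); lra.
  have := H _ (divr_gt0 e0 dm0) => /le_trans; apply.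
  by rewrite mulrAC ler_pdivrMr// ler_pM2l//; lra.
move=> e0.
have := @bisection_ind2 R ((R[i] * R[i]) * (R[i] * R[i]))%type
  (fun x => [/\ O x.1.1, O x.1.2, O' x.2.1 & O' x.2.2])
  (fun x y => halves x.1 y.1 /\ halves x.2 y.2) (fun x => x.1.1) (fun x => x.2.1) dm
  (fun x => cabs (D x) <= e * dm x ^+ 2) _ _ _ ((p, q), (a, b)); apply=> //=.
- move=> [[x y] [z w]] [y1 y2] /= [Ox Oy Oz Ow] [h1 h2].
  have [oy oy' d1 d1'] : [/\ O y1.1, O y1.2, cabs (y1.2 - y1.1) = cabs (y - x) / 2 &
      cabs (y1.1 - x) <= cabs (y - x) / 2].
    by case: h1 => -> /=; rewrite ?cabs_midl ?cabs_midr ?subrr ?cabs0 ?divr_ge0 ?cabs_ge0//;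
      split=> //; exact: mO.
  have [ow ow' d2 d2'] : [/\ O' y2.1, O' y2.2, cabs (y2.2 - y2.1) = cabs (w - z) / 2 &
      cabs (y2.1 - z) <= cabs (w - z) / 2].
    by case: h2 => -> /=; rewrite ?cabs_midl ?cabs_midr ?subrr ?cabs0 ?divr_ge0 ?cabs_ge0//;
      split=> //; exact: mO'.
  rewrite /dm /= d1 d2.
  have := cabs_ge0 (y - x); have := cabs_ge0 (w - z) => ? ?.
  by split=> //; lra.
- move=> [[x y] [z w]] [/= Ox Oy Oz Ow] H.
  have h1 := H ((x, mid x y), (z, mid z w)) (conj (or_introl erefl) (or_introl erefl)).
  have h2 := H ((x, mid x y), (mid z w, w)) (conj (or_introl erefl) (or_intror erefl)).
  have h3 := H ((mid x y, y), (z, mid z w)) (conj (or_intror erefl) (or_introl erefl)).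
  have h4 := H ((mid x y, y), (mid z w, w)) (conj (or_intror erefl) (or_intror erefl)).
  have eqD : D ((x, y), (z, w)) = D ((x, mid x y), (z, mid z w)) +
      D ((x, mid x y), (mid z w, w)) + (D ((mid x y, y), (z, mid z w)) +
      D ((mid x y, y), (mid z w, w))).
    rewrite /D /= (S1 _ _ _ _ Ox Oy Oz Ow).2 (S2 _ _ _ _ Oz Ow Ox Oy).2; ring.
  rewrite eqD; apply: le_trans (cabsD _ _) _.
  have := cabsD (D ((x, mid x y), (z, mid z w))) (D ((x, mid x y), (mid z w, w))).
  have := cabsD (D ((mid x y, y), (z, mid z w))) (D ((mid x y, y), (mid z w, w))).
  move: h1 h2 h3 h4; rewrite {1 2 3 4}/dm /= !cabs_midl !cabs_midr.
  have -> : cabs (y - x) / 2 + cabs (w - z) / 2 = dm ((x, y), (z, w)) / 2.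
    by rewrite /dm /=; lra.
  rewrite expr_div_n; lra.
- move=> c c' Hc.
  have Oc : O c by apply: lO => e' /Hc[x [[? _ _ _] ? _]]; exists x.1.1.
  have Oc' : O' c' by apply: lO' => e' /Hc[x [[_ _ ? _] _ ?]]; exists x.2.1.
  have Uc := nbhs_singleton (OU _ Oc); have Uc' := nbhs_singleton (OU' _ Oc').
  have [[A B] /= []] := (contP _ _).1 (cphi _ _ Uc Uc') _ e0.
  move=> /near_cabs[d d0 Hd] /near_cabs[d' d'0 Hd'] HAB.
  exists (Num.min d d' / 4) => [|[[x y] [z w]] [/= Ox Oy Oz Ow] dmd xc zc].
    by rewrite divr_gt0// lt_min d0.
  pose del := dm ((x, y), (z, w)).
  have dmE : del = cabs (y - x) + cabs (w - z) by [].
  have s1 := cabs_ge0 (y - x); have s2 := cabs_ge0 (w - z).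
  have : 3 * del < Num.min d d' by rewrite -/del in dmd; lra.
  rewrite lt_min => /andP[dm1 dm2]; rewrite -/del in xc zc *.
  pose B1 := O `&` [set s | cabs (s - c) <= 3 * del].
  pose B2 := O' `&` [set t | cabs (t - c') <= 3 * del].
  have mB1 : mid_closed B1 by apply: mid_closedI => //; exact: mid_closed_ball.
  have mB2 : mid_closed B2 by apply: mid_closedI => //; exact: mid_closed_ball.
  have B1x : B1 x by split=> //=; lra.
  have B1y : B1 y by split=> //=; have := cabs_tri y x c; lra.
  have B2z : B2 z by split=> //=; lra.
  have B2w : B2 w by split=> //=; have := cabs_tri w z c'; lra.
  have near_v s t : B1 s -> B2 t -> cabs (phi s t - phi c c') <= e.
    move=> [_ /= h] [_ /= h']; apply/ltW/(HAB (s, t)); split=> /=.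
      by apply: Hd; exact: le_lt_trans h _.
    by apply: Hd'; exact: le_lt_trans h' _.
  have F1 s : B1 s -> cabs (cint (phi s) z w - (w - z) * phi c c') <= e * cabs (w - z).
    move=> Bs; apply: (cint_near mB2 B2z B2w); last by move=> t; exact: near_v.
    apply: (icvg_cont mO' lO' _ Oz Ow) => t Ot; apply: cont_pairl; apply: cphi.
      exact: nbhs_singleton (OU _ Bs.1).
    exact: nbhs_singleton (OU' _ Ot).
  have F2 t : B2 t -> cabs (cint (psi t) x y - (y - x) * phi c c') <= e * cabs (y - x).
    move=> Bt; apply: (cint_near mB1 B1x B1y); last by move=> s Bs; exact: near_v.
    apply: (icvg_cont mO lO _ Ox Oy) => s Os; apply: cont_pairl; apply: cpsi.
      exact: nbhs_singleton (OU' _ Bt.1).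
    exact: nbhs_singleton (OU _ Os).
  have G1 := cint_near mB1 B1x B1y (S1 _ _ _ _ Ox Oy Oz Ow).1 F1.
  have G2 := cint_near mB2 B2z B2w (S2 _ _ _ _ Oz Ow Ox Oy).1 F2.
  rewrite /D /=.
  have := cabs_tri (cint (fun s => cint (phi s) z w) x y)
    ((y - x) * ((w - z) * phi c c')) (cint (fun t => cint (psi t) x y) z w).
  rewrite (cabsB ((y - x) * ((w - z) * phi c c')) (cint _ _ _)) {2}mulrCA.
  move=> /le_trans; apply; apply: le_trans (lerD G1 G2) _.
  have -> : e * del ^+ 2 = e * cabs (w - z) * cabs (y - x) + e * cabs (y - x) * cabs (w - z)
     + e * (cabs (y - x) ^+ 2 + cabs (w - z) ^+ 2) by rewrite dmE; ring.
  by rewrite lerDl mulr_ge0 ?addr_ge0 ?sqr_ge0 ?(ltW e0).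
Qed.

End Fubini.

(** * Contour integrals over squares *)

Section Contour.
Context {R : realType}.
Implicit Types (f g : R[i] -> R[i]) (r : R) (t a : R[i]).

Definition pint f (v : nat -> R[i]) (n : nat) := \sum_(0 <= k < n) cint f (v k) (v k.+1).

(** The quadrilateral between two corresponding sides lies in the convex set [O k] and is cut by a
    diagonal into two Goursat triangles. The integrals along the segments from [v k] to [w k] then
    telescope around the closed polygons. *)
Lemma pint_homotopy f (v w : nat -> R[i]) n (O : nat -> set R[i]) :
  v n = v 0 -> w n = w 0 ->
  (forall k, mid_closed (O k)) -> (forall k, lim_closed (O k)) ->
  (forall k, (k < n)%N -> [/\ O k (v k), O k (v k.+1), O k (w k) & O k (w k.+1)]) ->
  (forall k c, (k < n)%N -> O k c -> cdiff f c) ->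
  pint f v n = pint f w n.
Proof.
move=> vn wn mO lO Ov df; apply/eqP; rewrite -subr_eq0 -sumrB.
have -> : \sum_(0 <= k < n) (cint f (v k) (v k.+1) - cint f (w k) (w k.+1)) =
  \sum_(0 <= k < n) (- cint f (v k.+1) (w k.+1) - (- cint f (v k) (w k))).
  apply: eq_big_nat => k /andP[_ kn]; have [h1 h2 h3 h4] := Ov _ kn.
  have icv a b : O k a -> O k b -> icvg f a b.
    move=> Oa Ob; apply: (icvg_cont (mO k) (lO k) _ Oa Ob) => c Oc.
    exact/cdiff_continuous/(df k).
  have g1 := goursat (mO k) (lO k) (fun c => df k c kn) h1 h2 h4.
  have g2 := goursat (mO k) (lO k) (fun c => df k c kn) h1 h4 h3.
  rewrite (@cint_swap _ f (v k) (w k.+1)) in g1; last exact: icv.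
  rewrite (@cint_swap _ f (w k) (w k.+1)) in g2; last exact: icv.
  rewrite (@cint_swap _ f (v k) (w k)) in g2; last exact: icv.
  move: g1 g2; set A := cint f (v k) (v k.+1); set B := cint f (v k.+1) (w k.+1).
  set D := cint f (v k) (w k.+1); set W := cint f (w k) (w k.+1); set V := cint f (v k) (w k).
  move=> g1 g2; have -> : A = D - B by rewrite -[LHS]subr0 -g1; ring.
  have -> : D = W + V by rewrite -[LHS]subr0 -g2; ring.
  by ring.
by rewrite telescope_sumr// vn wn subrr.
Qed.

(** The corners 1 - i, 1 + i, -1 + i, -1 - i of a square, counterclockwise. Multiplication by i
    permutes the sides, so every side can be rotated to the one on Re t = 1. *)
Definition vtx (k : nat) : R[i] := 'i%C ^+ k * (1 - 'i%C).

Definition contour f r := pint f (fun k => r%:C%C * vtx k) 4.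

(** The factor [3 / 2] is a rational bound for the square root of 2: this annulus contains the
    boundary of the square of half-side [r]. *)
Definition collar r t := r <= cabs t /\ cabs t <= 3 / 2 * r.

(** A closed convex cap of the disc that contains the [k]-th side and stays inside the collar, which
    is itself not convex. *)
Definition edge (k : nat) r : set R[i] :=
  [set t | r <= Re ((- 'i%C) ^+ k * t)] `&` [set t | cabs t <= 3 / 2 * r].

Lemma cabs_i : cabs ('i%C : R[i]) = 1.
Proof. by rewrite /= expr0n add0r expr1n sqrtr1. Qed.

Lemma ReD (z w : R[i]) : Re (z + w) = Re z + Re w.
Proof. by case: z => ? ?; case: w => ? ?. Qed.
Lemma ReRM (x : R) (z : R[i]) : Re (x%:C%C * z) = x * Re z.
Proof. by case: z => a b /=; rewrite mul0r subr0. Qed.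
Lemma half_realC (z : R[i]) : z / 2 = (2^-1)%:C%C * z.
Proof. by rewrite mulrC fmorphV/= rmorphD rmorph1. Qed.

Lemma mid_closed_halfplane (u : R[i]) (x : R) : mid_closed [set t | x <= Re (u * t)].
Proof.
move=> p q /= hp hq; rewrite /mid half_realC mulrCA ReRM mulrDr ReD; lra.
Qed.

Lemma lim_closed_halfplane (u : R[i]) (x : R) :
  cabs u <= 1 -> lim_closed [set t | x <= Re (u * t)].
Proof.
move=> u1 c H /=; apply/ler_addgt0Pl => e /H[t /= ht tc].
have : Re (u * (t - c)) <= cabs (t - c).
  apply: le_trans (ler_norm _) _; apply: le_trans (Re_le_cabs _) _.
  by rewrite cabsM ler_piMl// cabs_ge0.
rewrite mulrBr ReB; lra.
Qed.

Lemma lim_closed_ball (c : R[i]) (x : R) : lim_closed [set t | cabs (t - c) <= x].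
Proof.
move=> d H /=; apply/ler_addgt0Pl => e /H[t /= ht td].
have := cabs_tri d t c; rewrite (cabsB d t); lra.
Qed.

Lemma cabs_ipow k : cabs ((- 'i%C) ^+ k : R[i]) = 1.
Proof. by rewrite cabsX cabsN cabs_i expr1n. Qed.

Lemma mid_closed_ball0 (x : R) : mid_closed [set t : R[i] | cabs t <= x].
Proof.
by have := @mid_closed_ball R 0 x; congr mid_closed; apply/funext => t /=; rewrite subr0.
Qed.

Lemma lim_closed_ball0 (x : R) : lim_closed [set t : R[i] | cabs t <= x].
Proof.
by have := @lim_closed_ball 0 x; congr lim_closed; apply/funext => t /=; rewrite subr0.
Qed.

Lemma edge_mid k r : mid_closed (edge k r).
Proof.
by apply: mid_closedI; [exact: mid_closed_halfplane|exact: mid_closed_ball0].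
Qed.

Lemma edge_lim k r : lim_closed (edge k r).
Proof.
apply: lim_closedI; last exact: lim_closed_ball0.
by apply: lim_closed_halfplane; rewrite cabs_ipow.
Qed.

Lemma edge_collar k r : edge k r `<=` collar r.
Proof.
move=> t [/= h1 h2]; split=> //; apply: le_trans h1 _.
apply: le_trans (ler_norm _) _; apply: le_trans (Re_le_cabs _) _.
by rewrite cabsM cabs_ipow mul1r.
Qed.

Lemma vtx4 : vtx 4 = vtx 0.
Proof. by rewrite /vtx (exprM _ 2 2) sqr_i sqrrN expr1n expr0. Qed.

Lemma ipowK k : (- 'i%C) ^+ k * 'i%C ^+ k = 1 :> R[i].
Proof. by rewrite -exprMn mulNr -expr2 sqr_i opprK expr1n. Qed.

Lemma Re_vtxl k : Re ((- 'i%C) ^+ k * vtx k) = 1 :> R.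
Proof. by rewrite /vtx mulrA ipowK mul1r ReB /= subr0. Qed.

Lemma Re_vtxr k : Re ((- 'i%C) ^+ k * vtx k.+1) = 1 :> R.
Proof.
rewrite /vtx exprS -mulrA mulrCA mulrA mulrA -(mulrA 'i%C) ipowK mulr1.
by rewrite mulrBr mulr1 -expr2 sqr_i opprK ReD /= add0r.
Qed.

Lemma cabs_vtx k : cabs (vtx k) <= 3 / 2 :> R.
Proof.
rewrite cabsM cabsX cabs_i expr1n mul1r /= subr0 sub0r sqrrN expr1n.
have -> : (1 + 1 : R) = 2 by [].
rewrite -(ger0_norm (_ : 0 <= 3 / 2 :> R)); last by lra.
rewrite -sqrtr_sqr; apply: ler_wsqrtr; lra.
Qed.

Lemma cabs_edge k : cabs (vtx k.+1 - vtx k) = 2 :> R.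
Proof.
have -> : vtx k.+1 - vtx k = 'i%C ^+ k * 'i%C * 2.
  rewrite /vtx exprSr -!mulrA -mulrBr; congr (_ * _).
  by rewrite mulrBr mulr1 -expr2 sqr_i; ring.
by rewrite !cabsM cabsX cabs_i expr1n !mul1r cabs2.
Qed.

Lemma edge_vtxl k r : 0 <= r -> edge k r (r%:C%C * vtx k).
Proof.
move=> r0; split=> /=; first by rewrite mulrCA ReRM Re_vtxl mulr1.
rewrite cabsM cabsR ger0_norm// mulrC ler_wpM2r//; exact: cabs_vtx.
Qed.

Lemma edge_vtxr k r : 0 <= r -> edge k r (r%:C%C * vtx k.+1).
Proof.
move=> r0; split=> /=; first by rewrite mulrCA ReRM Re_vtxr mulr1.
rewrite cabsM cabsR ger0_norm// mulrC ler_wpM2r//; exact: cabs_vtx.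
Qed.

Lemma contourE f r : contour f r =
  \sum_(0 <= k < 4) cint f (r%:C%C * vtx k) (r%:C%C * vtx k.+1).
Proof. by []. Qed.

Lemma contour_icvg f r k : 0 <= r -> (forall t, collar r t -> cont f t) ->
  icvg f (r%:C%C * vtx k) (r%:C%C * vtx k.+1).
Proof.
move=> r0 cf.
apply: (icvg_cont (@edge_mid k r) (@edge_lim k r) _ (edge_vtxl k r0) (edge_vtxr k r0)).
by move=> c /edge_collar/cf.
Qed.

Lemma contour_ext f g r : 0 <= r -> (forall t, collar r t -> f t = g t) ->
  contour f r = contour g r.
Proof.
move=> r0 fg; apply: eq_bigr => k _.
apply: (cint_ext (@edge_mid k r) (edge_vtxl k r0) (edge_vtxr k r0)).
by move=> t /edge_collar/fg.
Qed.

Lemma contourD f g r : 0 <= r -> (forall t, collar r t -> cont f t) ->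
  (forall t, collar r t -> cont g t) ->
  contour (fun t => f t + g t) r = contour f r + contour g r.
Proof.
move=> r0 cf cg; rewrite !contourE -big_split /=; apply: eq_bigr => k _.
by apply: cintD; exact: contour_icvg.
Qed.

Lemma contourZ c f r : 0 <= r -> (forall t, collar r t -> cont f t) ->
  contour (fun t => c * f t) r = c * contour f r.
Proof.
move=> r0 cf; rewrite !contourE mulr_sumr; apply: eq_bigr => k _.
by apply: cintZ; exact: contour_icvg.
Qed.

Lemma contourB f g r : 0 <= r -> (forall t, collar r t -> cont f t) ->
  (forall t, collar r t -> cont g t) ->
  contour (fun t => f t - g t) r = contour f r - contour g r.
Proof.
move=> r0 cf cg; have cg' t : collar r t -> cont (fun t => -1 * g t) t.
  by move=> ct; exact: (contM (@cont_cst R _ (-1) t) (cg t ct)).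
have -> : - contour g r = contour (fun t => -1 * g t) r by rewrite (contourZ _ r0 cg) mulN1r.
rewrite -(contourD r0 cf cg'); apply: (contour_ext r0) => t _.
by rewrite mulN1r.
Qed.

Lemma contour_sum (I : Type) (s : seq I) (F : I -> R[i] -> R[i]) r : 0 <= r ->
  (forall i t, collar r t -> cont (F i) t) ->
  (forall t, collar r t -> cont (fun t => \sum_(i <- s) F i t) t) /\
  contour (fun t => \sum_(i <- s) F i t) r = \sum_(i <- s) contour (F i) r.
Proof.
move=> r0 cF; elim: s => [|i s [IH1 IH2]].
  split=> [t _|].
    by apply: (@cont_ext _ _ (fun=> 0)) => [u|]; rewrite ?big_nil//; exact: cont_cst.
  rewrite big_nil (@contour_ext _ (fun=> 0 * 0) _ r0); last by move=> t _; rewrite big_nil mul0r.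
  by rewrite (@contourZ 0 (fun=> 0) _ r0) ?mul0r// => t _; exact: cont_cst.
split=> [t ct|].
  by apply: cont_ext (contD (cF i t ct) (IH1 t ct)) => u; rewrite big_cons.
rewrite big_cons -IH2 -(contourD r0 (cF i) IH1).
by apply: (contour_ext r0) => t _; rewrite big_cons.
Qed.

Lemma contour_bound f r (B : R) : 0 <= r -> (forall t, collar r t -> cont f t) ->
  (forall t, collar r t -> cabs (f t) <= B) -> cabs (contour f r) <= 8 * r * B.
Proof.
move=> r0 cf fB.
have H k : cabs (cint f (r%:C%C * vtx k) (r%:C%C * vtx k.+1)) <= B * (2 * r).
  have -> : 2 * r = cabs (r%:C%C * vtx k.+1 - r%:C%C * vtx k).
    by rewrite -mulrBr cabsM cabs_edge cabsR ger0_norm// mulrC.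
  apply: (cint_bound (@edge_mid k r) (edge_vtxl k r0) (edge_vtxr k r0)).
    exact: contour_icvg.
  by move=> t /edge_collar/fB.
rewrite contourE !big_nat_recr //= big_geq// add0r.
have := H 0%N; have := H 1%N; have := H 2%N; have := H 3%N.
set a := cint _ _ _; set b := cint _ _ _; set c := cint _ _ _; set d := cint _ _ _.
have := cabsD (d + c + b) a; have := cabsD (d + c) b; have := cabsD d c; lra.
Qed.

Lemma contour_cont (T : topologicalType) (phi : T -> R[i] -> R[i]) s0 r : 0 <= r ->
  (forall c, collar r c -> cont (fun st => phi st.1 st.2) (s0, c)) ->
  (\forall s \near s0, forall t, collar r t -> cont (phi s) t) ->
  cont (fun s => contour (phi s) r) s0.
Proof.
move=> r0 cphi cs.
have H k : cont (fun s => cint (phi s) (r%:C%C * vtx k) (r%:C%C * vtx k.+1)) s0.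
  apply: (cint_continuous (@edge_mid k r) (@edge_lim k r) (edge_vtxl k r0) (edge_vtxr k r0)).
    by move=> c /edge_collar/cphi.
  by apply: filterS cs => s cs; exact: contour_icvg.
apply: cont_ext (contD (contD (contD (H 0%N) (H 1%N)) (H 2%N)) (H 3%N)) => s.
by rewrite contourE !big_nat_recr //= big_geq// add0r.
Qed.

Lemma contour_fubini (phi : R[i] -> R[i] -> R[i]) (U U' : set R[i]) r r' :
  0 <= r -> 0 <= r' ->
  (forall s, collar r s -> \forall s' \near s, U s') ->
  (forall t, collar r' t -> \forall t' \near t, U' t') ->
  (forall s t, U s -> U' t -> cont (fun st => phi st.1 st.2) (s, t)) ->
  contour (fun s => contour (phi s) r') r = contour (fun t => contour (phi^~ t) r) r'.
Proof.
move=> r0 r'0 rU rU' cphi.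
have cphi' s t : U s -> U' t -> cont (fun ts => phi ts.2 ts.1) (t, s).
  by move=> Us Ut; apply: cont_swap; exact: cphi.
have h1 := @contour_sum _ (index_iota 0 4)
  (fun k s => cint (phi s) (r'%:C%C * vtx k) (r'%:C%C * vtx k.+1)) r r0.
have h2 := @contour_sum _ (index_iota 0 4)
  (fun k t => cint (phi^~ t) (r%:C%C * vtx k) (r%:C%C * vtx k.+1)) r' r'0.
rewrite (h1 _).2; last first.
  move=> k s cs.
  apply: (cint_continuous (@edge_mid k r') (@edge_lim k r') (edge_vtxl k r'0) (edge_vtxr k r'0)).
    move=> t /edge_collar ct; apply: cphi.
      exact: nbhs_singleton (rU _ cs).
    exact: nbhs_singleton (rU' _ ct).
  apply: filterS (rU _ cs) => s' Us'; apply: contour_icvg => // t /rU'/nbhs_singleton Ut.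
  exact: cont_pairl (cphi _ _ Us' Ut).
rewrite (h2 _).2; last first.
  move=> k t ct.
  apply: (@cint_continuous _ _ _ (fun t s => phi s t) _ _ _ (@edge_mid k r) (@edge_lim k r) (edge_vtxl k r0) (edge_vtxr k r0)).
    move=> s /edge_collar cs; apply: cphi'.
      exact: nbhs_singleton (rU _ cs).
    exact: nbhs_singleton (rU' _ ct).
  apply: filterS (rU' _ ct) => t' Ut'; apply: contour_icvg => // s /rU/nbhs_singleton Us.
  exact: (@cont_pairl _ (fun t s => phi s t) _ _ (cphi' _ _ Us Ut')).
rewrite (eq_bigr (fun k => \sum_(0 <= l < 4) cint (fun s => cint (phi s)
    (r'%:C%C * vtx k) (r'%:C%C * vtx k.+1)) (r%:C%C * vtx l) (r%:C%C * vtx l.+1))); last first.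
  by move=> k _; rewrite contourE.
rewrite exchange_big /=; apply: eq_bigr => l _; rewrite contourE; apply: eq_bigr => k _.
apply: (cint_fubini (U := U) (U' := U') (@edge_mid l r) (@edge_lim l r) (@edge_mid k r')
  (@edge_lim k r') _ _ cphi); try exact: edge_vtxl; try exact: edge_vtxr.
  by move=> s /edge_collar/rU.
by move=> s /edge_collar/rU'.
Qed.

End Contour.

(** * Cauchy's formula and its consequences *)

Section Cauchy.
Context {R : realType}.
Implicit Types (f g : R[i] -> R[i]) (r : R) (t a x : R[i]).

(** Corresponding sides of two concentric squares are joined inside a convex cap that avoids the
    inner disc, so [pint_homotopy] applies side by side. *)
Lemma contour_scale f r1 r2 : 0 < r1 -> r1 <= r2 ->
  (forall t, r1 <= cabs t -> cabs t < 2 * r2 -> cdiff f t) ->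
  contour f r1 = contour f r2.
Proof.
move=> r10 r12 df.
pose O k := [set t : R[i] | r1 <= Re ((- 'i%C) ^+ k * t)] `&` [set t | cabs t <= 3 / 2 * r2].
apply: (@pint_homotopy R f (fun k => r1%:C%C * vtx k) (fun k => r2%:C%C * vtx k) 4 O).
- by rewrite /= vtx4.
- by rewrite /= vtx4.
- by move=> k; apply: mid_closedI; [exact: mid_closed_halfplane|exact: mid_closed_ball0].
- move=> k; apply: lim_closedI; last exact: lim_closed_ball0.
  by apply: lim_closed_halfplane; rewrite cabs_ipow.
- move=> k _.
  have [a1 b1] := edge_vtxl k (ltW r10); have [a2 b2] := edge_vtxr k (ltW r10).
  have r20 : 0 <= r2 by lra.
  have [a3 b3] := edge_vtxl k r20; have [a4 b4] := edge_vtxr k r20.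
  by move: a1 b1 a2 b2 a3 b3 a4 b4 => /= *; split; split=> //=; lra.
- move=> k c _ [/= h1 h2]; apply: df; last lra.
  apply: le_trans h1 _; apply: le_trans (ler_norm _) _; apply: le_trans (Re_le_cabs _) _.
  by rewrite cabsM cabs_ipow mul1r.
Qed.

(** Contracting the square towards [a] by a factor [l] preserves the integral, while the length of
    the contour becomes proportional to [l] and the integrand stays bounded. *)
Lemma contour_punctured f r a (B d : R) : cabs a < r -> 0 < d ->
  (forall t, cabs t < 2 * r -> t != a -> cdiff f t) ->
  (forall t, cabs (t - a) < d -> t != a -> cabs (f t) <= B) ->
  contour f r = 0.
Proof.
move=> ar d0 df fB.
have r0 : 0 < r by apply: le_lt_trans ar; exact: cabs_ge0.
have B0 : 0 <= `|B| by [].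
have key (l : R) : 0 < l -> l <= 1 -> l * (5 / 2 * r) < d -> cabs (contour f r) <= 8 * r * `|B| * l.
  move=> l0 l1 ld.
  pose w k := a + l%:C%C * (r%:C%C * vtx k - a).
  pose al k := Re ((- 'i%C) ^+ k * a).
  have alr k : al k < r.
    apply: le_lt_trans ar; apply: le_trans (ler_norm _) _; apply: le_trans (Re_le_cabs _) _.
    by rewrite cabsM cabs_ipow mul1r.
  (* The half-plane bounded by the contracted [k]-th side. It misses [a] because [al k < r], so the
     homotopy never crosses the singularity. *)
  pose O k := [set t : R[i] | al k + l * (r - al k) <= Re ((- 'i%C) ^+ k * t)] `&`
     [set t | cabs t <= 3 / 2 * r].
  have mO k : mid_closed (O k).
    by apply: mid_closedI; [exact: mid_closed_halfplane|exact: mid_closed_ball0].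
  have lO k : lim_closed (O k).
    apply: lim_closedI; last exact: lim_closed_ball0.
    by apply: lim_closed_halfplane; rewrite cabs_ipow.
  have Oa k c : O k c -> c != a.
    move=> [/= h _]; apply/eqP => ca; move: h; rewrite ca -/(al k) leNgt => /negP; apply.
    by rewrite ltrDl mulr_gt0// subr_gt0.
  have Od k c : O k c -> cdiff f c.
    by move=> Oc; apply: df; [case: Oc => _ /=; lra|exact: Oa Oc].
  have vb k : cabs (r%:C%C * vtx k) <= 3 / 2 * r by have [] := edge_vtxl k (ltW r0).
  have wO k z : cabs z <= 3 / 2 * r -> Re ((- 'i%C) ^+ k * z) = r -> O k (a + l%:C%C * (z - a)).
    move=> zr zR.
    have e : Re ((- 'i%C) ^+ k * (a + l%:C%C * (z - a))) = al k + l * (r - al k).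
      by rewrite mulrDr ReD mulrCA ReRM mulrBr ReB zR.
    split; first by rewrite /mkset e.
    rewrite /mkset.
    have -> : a + l%:C%C * (z - a) = (1 - l)%:C%C * a + l%:C%C * z.
      by rewrite rmorphB rmorph1; ring.
    apply: le_trans (cabsD _ _) _; rewrite !cabsM !cabsR !ger0_norm ?subr_ge0// ?(ltW l0)//.
    have h1 : (1 - l) * cabs a <= (1 - l) * r by rewrite ler_wpM2l ?subr_ge0// ltW.
    have h2 : l * cabs z <= l * (3 / 2 * r) by rewrite ler_wpM2l ?(ltW l0).
    have : 0 <= (1 - l) * r by rewrite mulr_ge0 ?subr_ge0// ltW.
    lra.
  have Rl k : Re ((- 'i%C) ^+ k * (r%:C%C * vtx k)) = r by rewrite mulrCA ReRM Re_vtxl mulr1.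
  have Rr k : Re ((- 'i%C) ^+ k * (r%:C%C * vtx k.+1)) = r by rewrite mulrCA ReRM Re_vtxr mulr1.
  have -> : contour f r = pint f w 4.
    apply: (@pint_homotopy R f _ w 4 O) => //.
    - by rewrite /= vtx4.
    - by rewrite /w vtx4.
    - move=> k _; split; [| |exact: wO|exact: wO].
        split=> //=; rewrite Rl; have := alr k => ?; have : (1 - l) * (r - al k) >= 0.
          by rewrite mulr_ge0// subr_ge0// ltW.
        by lra.
      split=> //=; rewrite Rr; have := alr k => ?; have : (1 - l) * (r - al k) >= 0.
        by rewrite mulr_ge0// subr_ge0// ltW.
      by lra.
    - by move=> k c _; exact: Od.
  have H k : cabs (cint f (w k) (w k.+1)) <= `|B| * (l * (2 * r)).
    have -> : l * (2 * r) = cabs (w k.+1 - w k).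
      have -> : w k.+1 - w k = l%:C%C * (r%:C%C * (vtx k.+1 - vtx k)) by rewrite /w; ring.
      by rewrite !cabsM cabs_edge !cabsR !ger0_norm ?(ltW l0) ?(ltW r0)//; ring.
    have wa j : cabs (w j - a) <= l * (5 / 2 * r).
      rewrite /w addrC addKr cabsM cabsR ger0_norm ?(ltW l0)// ler_wpM2l ?(ltW l0)//.
      by apply: le_trans (cabsD _ _) _; rewrite cabsN; have := vb j; lra.
    apply: (@cint_bound _ (O k `&` [set t | cabs (t - a) <= l * (5 / 2 * r)])).
    - by apply: mid_closedI => //; exact: mid_closed_ball.
    - by split; [exact: wO|exact: wa].
    - by split; [exact: wO|exact: wa].
    - apply: (icvg_cont (mO k) (lO k)) => [c Oc| |]; [|exact: wO|exact: wO].
      exact/cdiff_continuous/Od/Oc.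
    - move=> z [Oz /= zd]; apply: le_trans (ler_norm _); apply: fB; last exact: Oa Oz.
      exact: le_lt_trans zd ld.
  rewrite /pint !big_nat_recr //= big_geq// add0r.
  have := H 0%N; have := H 1%N; have := H 2%N; have := H 3%N.
  set a' := cint _ _ _; set b' := cint _ _ _; set c' := cint _ _ _; set d' := cint _ _ _.
  have := cabsD (d' + c' + b') a'; have := cabsD (d' + c') b'; have := cabsD d' c'.
  lra.
apply/eqP; rewrite -cabs_eq0 eq_le cabs_ge0 andbT.
apply/ler_addgt0Pl => e e0; rewrite addr0.
have c0 : 0 < 8 * r * `|B| + 1.
  have h : 0 <= 8 * r * `|B| by rewrite !mulr_ge0// ltW.
  by lra.
have r50 : 0 < 5 * r by rewrite mulr_gt0.
pose l := Num.min 1 (Num.min (e / (8 * r * `|B| + 1)) (d / (5 * r))).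
have l0 : 0 < l by rewrite !lt_min ltr01 !divr_gt0.
have l1 : l <= 1 by rewrite /l ge_min lexx.
have le : l <= e / (8 * r * `|B| + 1) by rewrite /l !ge_min lexx orbT.
have ld : l <= d / (5 * r) by rewrite /l !ge_min lexx !orbT.
apply: le_trans (key l l0 l1 _) _.
  have : l * (5 * r) <= d by rewrite -ler_pdivlMr.
  lra.
have : l * (8 * r * `|B| + 1) <= e by rewrite -ler_pdivlMr.
lra.
Qed.

Lemma cabs_sub_gt0 t x : cabs x < cabs t -> t - x != 0.
Proof. by apply: contraTneq => /subr0_eq->; rewrite ltxx. Qed.

Lemma cdiff_subV t x : t - x != 0 -> cdiff (fun t => (t - x)^-1) t.
Proof.
move=> tx; apply: cdiffV => //; apply: cdiffB; [exact: cdiff_id|exact: cdiff_cst].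
Qed.

(** The number 2 pi i. It stays symbolic: formulas divide by it, and [kappa_neq0] justifies the
    division. *)
Definition kappa : R[i] := contour (fun t => t^-1) 1.

Lemma contour_inv r : 0 < r -> contour (fun t => t^-1) r = kappa.
Proof.
move=> r0; have H r1 r2 : 0 < r1 -> r1 <= r2 ->
    contour (fun t => t^-1) r1 = contour (fun t : R[i] => t^-1) r2.
  move=> r10 r12; apply: contour_scale => // t tr _; apply: cdiffV; last exact: cdiff_id.
  by rewrite -cabs_gt0; lra.
by rewrite /kappa; case: (leP r 1) => h; [exact: H|apply/esym/H => //; exact: ltW].
Qed.

Lemma collar_sub r t x : cabs x < r -> collar r t -> t - x != 0.
Proof. by move=> xr [rt _]; apply: cabs_sub_gt0; exact: lt_le_trans rt. Qed.

Lemma contour_invB r x : cabs x < r -> contour (fun t => (t - x)^-1) r = kappa.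
Proof.
move=> xr; have r0 : 0 < r by apply: le_lt_trans xr; exact: cabs_ge0.
have x0 := cabs_ge0 x.
apply/eqP; rewrite -subr_eq0 -cabs_eq0 eq_le cabs_ge0 andbT.
apply/ler_addgt0Pl => e e0; rewrite addr0.
(* On the large square the integrands differ by [x / (t (t - x))]. There [cabs (t - x)] is at least
   [8 * cabs x / e], so the difference is at most [e / (8 * r2)], against a contour of length
   [8 * r2]. *)
pose r2 := r + cabs x + 8 * cabs x / e.
have xe0 : 0 <= 8 * cabs x / e by rewrite divr_ge0 ?mulr_ge0// ltW.
have r20 : 0 < r2 by rewrite /r2; lra.
rewrite (@contour_scale _ r r2)//; [|by rewrite /r2; lra|]; last first.
  move=> t rt _; apply: cdiff_subV; apply: cabs_sub_gt0; exact: lt_le_trans rt.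
have xr2 : cabs x < r2 by rewrite /r2; lra.
rewrite -(contour_inv r20) -contourB ?(ltW r20)//; last 2 first.
- move=> t ct; apply/cdiff_continuous/cdiff_subV; exact: collar_sub ct.
- move=> t ct; apply/cdiff_continuous/cdiffV; last exact: cdiff_id.
  by rewrite -[t]subr0; apply: collar_sub ct; rewrite cabs0.
have -> : e = 8 * r2 * (e / (8 * r2)) by rewrite mulrC divfK// gt_eqF// mulr_gt0.
apply: contour_bound (ltW r20) _ _ => t ct.
  have t0 : t != 0 by rewrite -[t]subr0; apply: collar_sub ct; rewrite cabs0.
  apply: contB; apply/cdiff_continuous; first by apply/cdiff_subV; exact: collar_sub ct.
  by apply: cdiffV => //; exact: cdiff_id.
have tx : t - x != 0 by exact: collar_sub ct.
have t0 : t != 0 by rewrite -[t]subr0; apply: collar_sub ct; rewrite cabs0.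
have -> : (t - x)^-1 - t^-1 = x * t^-1 * (t - x)^-1 by field; rewrite tx t0.
rewrite !cabsM !cabsV.
have [rt _] := ct.
have h1 : 8 * cabs x / e <= cabs (t - x).
  have := cabs_tri t x 0; rewrite !subr0; move: rt; rewrite /r2; lra.
have tx0 : 0 < cabs (t - x) by rewrite cabs_gt0.
have h2 : 8 * cabs x <= e * cabs (t - x) by rewrite [leRHS]mulrC -ler_pdivrMr.
have t00 : 0 < cabs t by rewrite cabs_gt0.
have h3 : 1 <= cabs t / r2 by rewrite ler_pdivlMr// mul1r.
rewrite ler_pdivrMr// ler_pdivrMr//.
have -> : e / (8 * r2) * cabs (t - x) * cabs t = (e * cabs (t - x) / 8) * (cabs t / r2).
  by field; rewrite gt_eqF.
have h4 : cabs x <= e * cabs (t - x) / 8 by lra.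
by apply: le_trans h4 _; rewrite ler_peMr// divr_ge0// mulr_ge0 ?cabs_ge0// ltW.
Qed.

(** The quotient [(f t - f a) / (t - a)] is bounded near [a], so its integral vanishes by
    [contour_punctured]. *)
Lemma cauchy_formula f r a : cabs a < r ->
  (forall t, cabs t < 2 * r -> cdiff f t) ->
  contour (fun t => f t * (t - a)^-1) r = f a * kappa.
Proof.
move=> ar df; have r0 : 0 < r by apply: le_lt_trans ar; exact: cabs_ge0.
have dc t : collar r t -> cdiff f t by move=> [_ tr]; apply: df; lra.
have dV t : collar r t -> cdiff (fun t => (t - a)^-1) t.
  by move=> ct; apply: cdiff_subV; exact: collar_sub ct.
rewrite -(contour_invB ar) -contourZ ?(ltW r0)//; last first.
  by move=> t /dV/cdiff_continuous.
apply/eqP; rewrite -subr_eq0 -contourB ?(ltW r0)//; last 2 first.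
- by move=> t ct; apply/cdiff_continuous/cdiffM; [exact: dc|exact: dV].
- by move=> t ct; apply/cdiff_continuous/cdiffZ; exact: dV.
have [phi cphi Hphi] : cdiff f a by apply: df; lra.
have [d d0 Hd] := (near_cabs _ _).1 Hphi.
have [d' d'0 Hd'] := (near_cabs _ _).1 ((contP _ _).1 cphi _ ltr01).
apply/eqP; apply: (@contour_punctured _ _ a (cabs (phi a) + 1) (Num.min d d')) => //.
- by rewrite lt_min d0.
- move=> t tr ta; have ta0 : t - a != 0 by rewrite subr_eq0.
  by apply: cdiffB; [apply: cdiffM; [exact: df|exact: cdiff_subV]|apply: cdiffZ; exact: cdiff_subV].
- move=> t; rewrite lt_min => /andP[td td'] ta; rewrite -mulrBl Hd// mulfK ?subr_eq0//.
  have := Hd' _ td'; have := cabs_tri (phi t) (phi a) 0; rewrite !subr0; lra.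
Qed.

End Cauchy.

(** * Taylor expansion with remainder and the identity theorem *)

Section Taylor.
Context {R : realType}.
Implicit Types (f g : R[i] -> R[i]) (r : R) (t a x : R[i]).

Lemma midsum_rot f (c : R[i]) m p q :
  midsum f m (c * p) (c * q) = midsum (fun t => c * f (c * t)) m p q.
Proof.
have cm u v : mid (c * u) (c * v) = c * mid u v by rewrite /mid; ring.
elim: m p q => [|m IH] p q /=; rewrite cm ?IH//.
by rewrite -mulrBr; ring.
Qed.

Lemma cint_rot f (c : R[i]) p q :
  cint f (c * p) (c * q) = cint (fun t => c * f (c * t)) p q.
Proof.
rewrite /cint.
suff -> : (fun m => midsum f m (c * p) (c * q)) =
  (fun m => midsum (fun t => c * f (c * t)) m p q) by [].
by apply/funext => m; exact: midsum_rot.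
Qed.

(** Along 1 + i y the imaginary part of dt / t is dy / (1 + y^2), at least dy / 2 for y in [-1, 1];
    midpoint sums already satisfy the bound. *)
Lemma Im_midsum_inv m (u v : R) : u <= v -> -1 <= u -> v <= 1 ->
  (v - u) / 2 <= Im (midsum (fun t => t^-1) m (1 +i* u)%C (1 +i* v)%C).
Proof.
have em (a b : R) : mid (1 +i* a)%C (1 +i* b)%C = (1 +i* ((a + b) / 2))%C.
  by rewrite /mid half_realC; apply/eqP; rewrite eq_complex /=; apply/andP; split; apply/eqP; field.
have s0 p q : midsum (fun t : R[i] => t^-1) 0 p q = (q - p) * (mid p q)^-1 by [].
have sS k p q : midsum (fun t : R[i] => t^-1) k.+1 p q =
  midsum (fun t => t^-1) k p (mid p q) + midsum (fun t => t^-1) k (mid p q) q by [].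
have ImD (z w : R[i]) : Im (z + w) = Im z + Im w by case: z w => ? ? [].
elim: m u v => [|m IH] u v uv u1 v1; rewrite ?s0 ?sS em; last first.
  rewrite ImD.
  by have := IH u ((u + v) / 2); have := IH ((u + v) / 2) v; lra.
set y := (u + v) / 2.
have -> : Im (((1 +i* v)%C - (1 +i* u)%C) * (1 +i* y)%C^-1) = (v - u) / (1 + y ^+ 2).
  rewrite /= subrr mul0r add0r expr1n mul1r. done.
have y2 : y ^+ 2 <= 1 by rewrite expr2 /y; nra.
rewrite ler_wpM2l ?subr_ge0// lef_pV2 ?posrE; have := sqr_ge0 y; lra.
Qed.

(** The form dt / t is invariant under rotation by i, so the four sides contribute equally, and the
    midpoint sums on one side have imaginary part at least 1. *)
Lemma kappa_neq0 : kappa != 0 :> R[i].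
Proof.
have cV (t : R[i]) : collar 1 t -> cont (fun t => t^-1) t.
  move=> [t1 _]; apply/cdiff_continuous/cdiffV; last exact: cdiff_id.
  by rewrite -cabs_gt0; lra.
have rot k : cint (fun t => t^-1) (vtx k) (vtx k.+1) = cint (fun t : R[i] => t^-1) (vtx 0) (vtx 1).
  have -> : vtx k = 'i%C ^+ k * vtx 0 :> R[i] by rewrite /vtx expr0 mul1r.
  have -> : vtx k.+1 = 'i%C ^+ k * vtx 1 :> R[i] by rewrite /vtx exprSr expr1 mulrA.
  rewrite cint_rot; congr cint; apply/funext => t; rewrite invfM mulrA divff ?mul1r//.
  by rewrite expf_neq0// -cabs_eq0 cabs_i oner_eq0.
have -> : kappa = 4 * cint (fun t : R[i] => t^-1) (vtx 0) (vtx 1).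
  rewrite /kappa contourE !big_nat_recr //= big_geq// !mul1r !rot; ring.
rewrite mulf_neq0// ?pnatr_eq0//.
have v0 : vtx 0 = (1 +i* -1)%C :> R[i].
  by rewrite /vtx expr0 mul1r; apply/eqP; rewrite eq_complex /= subr0 sub0r !eqxx.
have v1 : vtx 1 = (1 +i* 1)%C :> R[i].
  rewrite /vtx expr1 mulrBr mulr1 -expr2 sqr_i; apply/eqP.
  by rewrite eq_complex /= !opprK add0r addr0 !eqxx.
have := cintP (contour_icvg 0 (@ler01 R) cV).
have -> : (1 : R)%:C%C = 1 :> R[i] by [].
rewrite !mul1r v0 v1.
set l := cint _ _ _ => ul; apply/eqP => l0.
have h2 : (0 : R) < 2^-1 by rewrite invr_gt0.
have [M HM] := ul _ h2.
have := HM M (leqnn M); rewrite l0 subr0 => h.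
have := @Im_midsum_inv M (-1) 1; have := Im_le_cabs (midsum (fun t => t^-1) M (1 +i* -1)%C (1 +i* 1)%C).
move: h; set z := midsum _ _ _ _ => h1 h3; have := ler_norm (Im z); lra.
Qed.

Lemma cont_abs : continuous (fun z : R[i] => cabs z : R).
Proof.
move=> a P /nbhs_ballP[e /= e0 HP].
apply: (proj2 (near_cabs a (fun t => P (cabs t)))); exists e => // t ta.
apply: HP; rewrite /ball /=.
have := cabs_tri t a 0; have := cabs_tri a t 0; rewrite !subr0 (cabsB a t) => h1 h2.
apply: le_lt_trans ta; rewrite ler_norml; apply/andP; split; lra.
Qed.

Lemma compact_ball (c : R[i]) (r : R) : compact [set z | cabs (z - c) <= r].
Proof.
pose g (x : R * R) : R[i] := c + (x.1 +i* x.2)%C.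
have cg : continuous g.
  move=> [a b]; apply/contP => e e0.
  have e20 : 0 < e / 2 by rewrite divr_gt0.
  exists ([set x | `|a - x| < e / 2], [set x | `|b - x| < e / 2]).
    by split; apply/nbhs_ballP; exists (e / 2).
  move=> [x y] /= [xa yb]; rewrite /g/= opprD addrACA subrr add0r.
  apply: le_lt_trans (cabs_le_ReIm _) _ => /=.
  by rewrite (distrC x) (distrC y); lra.
have cK : compact (g @` (`[- r, r] `*` `[- r, r])).
  apply: continuous_compact; first exact: continuous_subspaceT.
  by apply: compact_setX; exact: segment_compact.
apply: subclosed_compact cK _ => [|z /= zr].
  move=> z cz; rewrite /= leNgt; apply/negP => zr.
  have : \forall w \near z, r < cabs (w - c).
    apply/near_cabs; exists (cabs (z - c) - r) => [|w wz]; first by rewrite subr_gt0.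
    by have := cabs_tri z w c; rewrite (cabsB z w); lra.
  by move=> /cz[w [/= h1 h2]]; move: h1; rewrite leNgt h2.
have h1 := Re_le_cabs (z - c); have h2 := Im_le_cabs (z - c).
exists (Re (z - c), Im (z - c)).
  by split; rewrite /= in_itv /=; rewrite -ler_norml; apply: le_trans zr.
by rewrite /g /=; case: (z) (c) => a b [a' b'] /=; apply/eqP; rewrite eq_complex /=;
  apply/andP; split; apply/eqP; ring.
Qed.

Lemma cont_bounded (T : topologicalType) (f : T -> R[i]) (K : set T) : compact K ->
  (forall z, K z -> cont f z) -> exists2 B : R, 0 < B & forall z, K z -> cabs (f z) <= B.
Proof.
move=> cK cf.
have cc : compact ((fun z => cabs (f z) : R^o) @` K).
  apply: continuous_compact => //; apply: continuous_in_subspaceT => z.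
  rewrite inE => /cf cfz; exact: (continuous_comp cfz (@cont_abs _)).
have [M [Mr HM]] := compact_bounded cc.
exists (`|M| + 1) => [|z Kz]; first by have := normr_ge0 M; lra.
have : M < `|M| + 1 by have := ler_norm M; lra.
move=> /HM H; have := H (cabs (f z)) (ex_intro2 _ _ z Kz erefl).
by rewrite /= ger0_norm ?cabs_ge0.
Qed.

Lemma collar_bounded f r : (forall t, collar r t -> cont f t) -> 0 <= r ->
  exists2 B : R, 0 < B & forall t, collar r t -> cabs (f t) <= B.
Proof.
move=> cf r0; apply: cont_bounded cf.
apply: (@subclosed_compact _ _ [set z | cabs (z - 0) <= 3 / 2 * r]); last 2 first.
- exact: compact_ball.
- by move=> t [] /=; rewrite subr0.
move=> z cz; split; rewrite leNgt; apply/negP => h.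
  have : \forall w \near z, cabs w < r.
    apply/near_cabs; exists (r - cabs z) => [|w wz]; first by rewrite subr_gt0.
    by have := cabs_tri w z 0; rewrite !subr0; lra.
  by move=> /cz[w [[+ _] hw]]; rewrite leNgt hw.
have : \forall w \near z, 3 / 2 * r < cabs w.
  apply/near_cabs; exists (cabs z - 3 / 2 * r) => [|w wz]; first by rewrite subr_gt0.
  by have := cabs_tri z w 0; rewrite !subr0 (cabsB z w); lra.
by move=> /cz[w [[_ +] hw]]; rewrite leNgt hw.
Qed.

(** Cauchy's integral for the [k]-th Taylor coefficient at [0]. The size [r] is kept as an argument
    because the formula is also applied to functions that are holomorphic only far from [0]. *)
Definition coef f k r : R[i] := kappa^-1 * contour (fun t => f t * t^-1 ^+ k.+1) r.

Definition taylor_rem f k r x : R[i] :=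
  kappa^-1 * contour (fun t => f t * t^-1 ^+ k * (t - x)^-1) r.

Lemma collar_neq0 r t : 0 < r -> collar r t -> t != 0.
Proof. by move=> r0 [rt _]; rewrite -cabs_gt0; exact: lt_le_trans rt. Qed.

Lemma cont_powV k t : t != 0 -> cont (fun t => t^-1 ^+ k) t.
Proof. by move=> t0; apply: contX; apply: contV => //; exact: cont_id. Qed.

Lemma cdiff_powV k t : t != 0 -> cdiff (fun t => t^-1 ^+ k) t.
Proof. by move=> t0; apply: cdiffX; apply: cdiffV => //; exact: cdiff_id. Qed.

Lemma coef_scale f k r1 r2 : 0 < r1 -> r1 <= r2 ->
  (forall t, r1 <= cabs t -> cabs t < 2 * r2 -> cdiff f t) ->
  coef f k r1 = coef f k r2.
Proof.
move=> r10 r12 df; rewrite /coef; congr (_ * _); apply: contour_scale => // t h1 h2.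
apply: cdiffM; first exact: df.
by apply: cdiff_powV; rewrite -cabs_gt0; exact: lt_le_trans h1.
Qed.

(** This is 1 / (t - x) = 1 / t + x / (t (t - x)) under the integral sign. *)
Lemma taylor_remS f k r x : cabs x < r -> (forall t, collar r t -> cont f t) ->
  taylor_rem f k r x = coef f k r + x * taylor_rem f k.+1 r x.
Proof.
move=> xr cf; have r0 : 0 < r by apply: le_lt_trans xr; exact: cabs_ge0.
have c1 t : collar r t -> cont (fun t => f t * t^-1 ^+ k.+1) t.
  by move=> ct; exact: (contM (cf t ct) (@cont_powV k.+1 t (collar_neq0 r0 ct))).
have c2 t : collar r t -> cont (fun t => f t * t^-1 ^+ k.+1 * (t - x)^-1) t.
  move=> ct; apply: (contM (c1 t ct)); apply: cdiff_continuous; apply: cdiff_subV.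
  exact: collar_sub ct.
have c3 t : collar r t -> cont (fun t => x * (f t * t^-1 ^+ k.+1 * (t - x)^-1)) t.
  by move=> ct; exact: (contM (@cont_cst R _ x t) (c2 t ct)).
have e : contour (fun t => f t * t^-1 ^+ k * (t - x)^-1) r =
    contour (fun t => f t * t^-1 ^+ k.+1) r +
    x * contour (fun t => f t * t^-1 ^+ k.+1 * (t - x)^-1) r.
  rewrite -(contourZ x (ltW r0) c2) -(contourD (ltW r0) c1 c3).
  apply: (contour_ext (ltW r0)) => t ct.
  have t0 := collar_neq0 r0 ct; have tx := collar_sub xr ct.
  by rewrite exprS; field; rewrite tx t0.
by rewrite /taylor_rem /coef e mulrDr [X in _ + X]mulrCA.
Qed.

Lemma taylor f k r x : cabs x < r -> (forall t, cabs t < 2 * r -> cdiff f t) ->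
  f x = \sum_(i < k) coef f i r * x ^+ i + x ^+ k * taylor_rem f k r x.
Proof.
move=> xr df; have r0 : 0 < r by apply: le_lt_trans xr; exact: cabs_ge0.
have cf t : collar r t -> cont f t.
  by move=> [_ tr]; apply: cdiff_continuous; apply: df; lra.
elim: k => [|k ->].
  rewrite big_ord0 add0r expr0 mul1r /taylor_rem.
  rewrite (@contour_ext _ _ (fun t => f t * (t - x)^-1) _ (ltW r0)); last first.
    by move=> t _; rewrite expr0 mulr1.
  by rewrite (cauchy_formula xr df) mulrC mulfK// kappa_neq0.
by rewrite big_ord_recr /= (taylor_remS k xr cf) exprS; ring.
Qed.

Lemma taylor_rem_bound f k r x (B : R) : cabs x < r -> (forall t, collar r t -> cont f t) ->
  (forall t, collar r t -> cabs (f t) <= B) ->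
  cabs (taylor_rem f k r x) <= cabs (kappa : R[i])^-1 * (8 * r * (B * r^-1 ^+ k * (r - cabs x)^-1)).
Proof.
move=> xr cf fB; have r0 : 0 < r by apply: le_lt_trans xr; exact: cabs_ge0.
rewrite cabsM ler_wpM2l ?cabs_ge0//; apply: (contour_bound (ltW r0)) => t ct.
  apply: contM; first exact: (contM (cf t ct) (@cont_powV k t (collar_neq0 r0 ct))).
  by apply: cdiff_continuous; apply: cdiff_subV; exact: collar_sub ct.
have [rt _] := ct.
rewrite !cabsM cabsX !cabsV; apply: ler_pM; rewrite ?mulr_ge0 ?exprn_ge0 ?invr_ge0 ?cabs_ge0//.
  apply: ler_pM; rewrite ?exprn_ge0 ?invr_ge0 ?cabs_ge0//; first exact: fB.
  by rewrite lerXn2r ?nnegrE ?invr_ge0 ?cabs_ge0 ?(ltW r0)// lef_pV2 ?posrE// (lt_le_trans r0).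
rewrite lef_pV2 ?posrE ?subr_gt0 ?cabs_gt0 ?(collar_sub xr ct)//.
by have := cabs_tri t x 0; rewrite !subr0; lra.
Qed.

(** If the coefficients below [k] vanish, a zero [x != 0] yields
    [coef f k r = - x * taylor_rem f k.+1 r x], which tends to [0] with [x]. Once all coefficients
    vanish, [f x = x ^+ k * taylor_rem f k r x] is bounded by a multiple of [(cabs x / r) ^+ k] for
    every [k]. *)
Lemma identity f r : 0 < r -> (forall t, cabs t < 2 * r -> cdiff f t) ->
  (forall e : R, 0 < e -> exists x, [/\ x != 0, cabs x < e & f x = 0]) ->
  forall x, cabs x < r -> f x = 0.
Proof.
move=> r0 df fz.
have cf t : collar r t -> cont f t.
  by move=> [_ tr]; apply: cdiff_continuous; apply: df; lra.
have [B B0 fB] := collar_bounded cf (ltW r0).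
have rem k x : (forall i, (i < k)%N -> coef f i r = 0) -> cabs x < r ->
    f x = x ^+ k * taylor_rem f k r x.
  move=> c0 xr; rewrite {1}(taylor k xr df) big1 ?add0r// => i _.
  by rewrite c0 ?mul0r.
have c0 k : coef f k r = 0.
  elim/ltn_ind: k => k IH; apply/eqP; rewrite -cabs_eq0 eq_le cabs_ge0 andbT.
  apply/ler_addgt0Pl => e e0; rewrite addr0.
  pose M := cabs (kappa : R[i])^-1 * (8 * r * (B * r^-1 ^+ k.+1 * (r / 2)^-1)).
  have M0 : 0 <= M.
    by rewrite !mulr_ge0 ?cabs_ge0 ?exprn_ge0 ?invr_ge0 ?divr_ge0 ?(ltW r0) ?(ltW B0).
  have [|x [x0 xe fx]] := fz (Num.min (r / 2) (e / (M + 1))).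
    by rewrite lt_min !divr_gt0//; lra.
  move: xe; rewrite lt_min => /andP[xr xe].
  have xr' : cabs x < r by lra.
  move: (rem k x IH xr'); rewrite fx => /esym/eqP; rewrite mulf_eq0 expf_eq0 (negPf x0) andbF /=.
  rewrite (taylor_remS k xr' cf) addr_eq0 => /eqP->.
  rewrite cabsN cabsM; apply: le_trans (_ : cabs x * (M + 1) <= _); last first.
    by rewrite -ler_pdivlMr ?(ltW xe)//; lra.
  rewrite ler_wpM2l ?cabs_ge0//; apply: (@le_trans _ _ M); last lra.
  apply: le_trans (taylor_rem_bound k.+1 xr' cf fB) _.
  rewrite /M !ler_wpM2l ?cabs_ge0 ?exprn_ge0 ?invr_ge0 ?mulr_ge0 ?(ltW r0) ?(ltW B0) ?exprn_ge0 ?invr_ge0 ?(ltW r0)//.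
  by rewrite lef_pV2 ?posrE ?subr_gt0 ?divr_gt0//; lra.
move=> x xr; apply/eqP; rewrite -cabs_eq0 eq_le cabs_ge0 andbT.
pose M := cabs (kappa : R[i])^-1 * (8 * r * (B * (r - cabs x)^-1)).
have rx : 0 < r - cabs x by rewrite subr_gt0.
have M0 : 0 <= M.
  by rewrite !mulr_ge0 ?cabs_ge0 ?invr_ge0 ?(ltW r0) ?(ltW B0) ?(ltW rx).
have key k : cabs (f x) <= (cabs x / r) ^+ k * M.
  rewrite (rem k x (fun i _ => c0 i) xr) cabsM cabsX.
  have := taylor_rem_bound k xr cf fB => h.
  apply: le_trans (ler_wpM2l _ h) _; first by rewrite exprn_ge0 ?cabs_ge0.
  rewrite expr_div_n -exprVn /M le_eqVlt; apply/orP; left; apply/eqP; ring.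
have lim : (fun k => (cabs x / r) ^+ k * M) @ \oo --> (0 : R).
  rewrite -[X in _ --> X](mul0r M); apply: cvgM; last exact: cvg_cst.
  by apply: cvg_expr; rewrite ger0_norm ?divr_ge0 ?cabs_ge0 ?(ltW r0)// ltr_pdivrMr// mul1r.
rewrite -(cvg_lim _ lim)//.
apply: limr_ge; first by apply/cvg_ex; exists 0.
by apply: nearW => k; exact: key.
Qed.

End Taylor.

(** * Liouville's theorem and differentiation under the integral sign *)

Section Entire.
Context {R : realType}.
Implicit Types (f g : R[i] -> R[i]) (r : R) (t a x : R[i]).

Lemma identity_entire f a : (forall t, cdiff f t) ->
  (forall e : R, 0 < e -> exists x, [/\ x != a, cabs (x - a) < e & f x = 0]) ->
  forall x, f x = 0.
Proof.
move=> df fz x; pose g t := f (a + t).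
have -> : f x = g (x - a) by rewrite /g addrC subrK.
have xr : cabs (x - a) < cabs (x - a) + 1 by lra.
apply: (@identity _ g (cabs (x - a) + 1)) => //.
- by have := cabs_ge0 (x - a); lra.
- move=> t _; apply: (@cdiff_comp _ (fun t => a + t) f) => //.
  by apply: cdiffD; [exact: cdiff_cst|exact: cdiff_id].
- move=> e /fz[y [ya ye fy]]; exists (y - a); split => //; first by rewrite subr_eq0.
  by rewrite /g addrC subrK.
Qed.

(** On a contour of size [r] the remainder of order [M.+1] is O(1 / r), while the coefficients do
    not depend on [r]. *)
Lemma liouville f (B : R) (M : nat) (T : R) : (forall t, cdiff f t) ->
  (forall t, T <= cabs t -> cabs (f t) <= B * cabs t ^+ M) ->
  forall x, f x = \sum_(i < M.+1) coef f i 1 * x ^+ i.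
Proof.
move=> df fB x.
apply/eqP; rewrite -subr_eq0 -cabs_eq0 eq_le cabs_ge0 andbT.
apply/ler_addgt0Pl => e e0; rewrite addr0.
pose D := cabs x ^+ M.+1 * cabs (kappa : R[i])^-1 * 16 * (`|B| * (3 / 2) ^+ M).
have D0 : 0 <= D.
  by rewrite /D !mulr_ge0 ?exprn_ge0 ?cabs_ge0// divr_ge0.
pose r := 1 + `|T| + 2 * cabs x + D / e.
have x0 := cabs_ge0 x; have T0 := normr_ge0 T; have T1 := ler_norm T.
have De0 : 0 <= D / e by rewrite divr_ge0// ltW.
have r0 : 0 < r by rewrite /r; lra.
have xr : cabs x < r by rewrite /r; lra.
have cf t : collar r t -> cont f t by move=> _; exact: cdiff_continuous.
rewrite {1}(@taylor _ f M.+1 r x xr (fun t _ => df t)).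
have -> : \sum_(i < M.+1) coef f i 1 * x ^+ i = \sum_(i < M.+1) coef f i r * x ^+ i.
  apply: eq_bigr => i _; congr (_ * _); apply: coef_scale => //.
  by rewrite /r; lra.
rewrite addrAC subrr add0r cabsM cabsX.
have fB' t : collar r t -> cabs (f t) <= `|B| * (3 / 2 * r) ^+ M.
  move=> [h1 h2]; have := fB t; have -> : T <= cabs t by move: h1; rewrite /r; lra.
  move=> /(_ isT) /le_trans; apply; apply: le_trans (ler_wpM2r _ (ler_norm B)) _.
    by rewrite exprn_ge0 ?cabs_ge0.
  by rewrite ler_wpM2l// lerXn2r// nnegrE ?cabs_ge0// mulr_ge0 ?divr_ge0// ltW.
have := taylor_rem_bound M.+1 xr cf fB' => h.
apply: le_trans (ler_wpM2l (exprn_ge0 _ (cabs_ge0 _)) h) _.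
have rx : 0 < r - cabs x by rewrite subr_gt0.
have rn : r != 0 by rewrite gt_eqF.
have -> : cabs x ^+ M.+1 * (cabs (kappa : R[i])^-1 *
   (8 * r * (`|B| * (3 / 2 * r) ^+ M * r^-1 ^+ M.+1 * (r - cabs x)^-1))) =
   D / 2 * (r - cabs x)^-1.
  rewrite /D exprMn (exprS r^-1) exprVn; field.
  by rewrite rn expf_neq0// gt_eqF.
rewrite ler_pdivrMr//.
have h2 : D / e <= r - cabs x by rewrite /r; lra.
have h3 : D <= e * (r - cabs x) by rewrite mulrC -ler_pdivrMr.
lra.
Qed.

Lemma liouville_poly f (B : R) (M : nat) (T : R) : (forall t, cdiff f t) ->
  (forall t, T <= cabs t -> cabs (f t) <= B * cabs t ^+ M) ->
  exists2 P : {poly R[i]}, (size P <= M.+1)%N & forall x, f x = P.[x].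
Proof.
move=> df fB; exists (\poly_(i < M.+1) coef f i 1); first exact: size_poly.
by move=> x; rewrite (liouville df fB) horner_poly.
Qed.

(** The difference quotient of Cauchy's integral is again an integral, of
    [f t / ((t - s) (t - s'))]. It is continuous in [s'] and serves as the [phi] of [cdiff]. *)
Lemma cdiff_of_cauchy f r : 0 < r -> (forall t, collar r t -> cont f t) ->
  (forall s, cabs s < r -> contour (fun t => f t * (t - s)^-1) r = f s * kappa) ->
  forall s, cabs s < r -> cdiff f s.
Proof.
move=> r0 cf H s sr.
have nb : \forall s' \near s, cabs s' < r.
  apply/near_cabs; exists (r - cabs s) => [|w ws]; first by rewrite subr_gt0.
  by have := cabs_tri w s 0; rewrite !subr0; lra.
have c1 s' : cabs s' < r -> forall t, collar r t -> cont (fun t => f t * (t - s')^-1) t.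
  move=> s'r t ct; apply: (contM (cf t ct)); apply: cdiff_continuous.
  by apply: cdiff_subV; exact: collar_sub ct.
have c2 s' : cabs s' < r -> forall t, collar r t ->
    cont (fun t => f t * (t - s)^-1 * (t - s')^-1) t.
  move=> s'r t ct; apply: (contM (c1 s sr t ct)); apply: cdiff_continuous.
  by apply: cdiff_subV; exact: collar_sub ct.
exists (fun s' => kappa^-1 * contour (fun t => f t * (t - s)^-1 * (t - s')^-1) r).
  apply: (contM (@cont_cst _ _ _ _)).
  apply: (@contour_cont _ _ (fun s' t => f t * (t - s)^-1 * (t - s')^-1) _ _ (ltW r0)).
    move=> c cc; have h : cont (fun st : R[i] * R[i] => f st.2 * (st.2 - s)^-1) (s, c).
      apply: (@cont_comp _ _ _ (fun st : R[i] * R[i] => st.2) (fun t => f t * (t - s)^-1)).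
        exact: cvg_snd.
      exact: c1.
    apply: (contM h); apply: contV; first exact: collar_sub cc.
    have h1 : cont (fun st : R[i] * R[i] => st.2) (s, c) by exact: cvg_snd.
    have h2 : cont (fun st : R[i] * R[i] => st.1) (s, c) by exact: cvg_fst.
    exact: (contB h1 h2).
  by apply: filterS nb => s' s'r; exact: c2.
near=> s'; have s'r : cabs s' < r by near: s'.
have k0 := @kappa_neq0 R.
apply: (mulIf k0); rewrite mulrBl -(H _ s'r) -(H _ sr).
rewrite -(contourB (ltW r0) (c1 _ s'r) (c1 _ sr)).
rewrite mulrAC -mulrA mulrACA mulVf// mul1r mulrC.
rewrite -(contourZ _ (ltW r0) (c2 _ s'r)); apply: (contour_ext (ltW r0)) => t ct.
have := collar_sub sr ct; have := collar_sub s'r ct => h1 h2.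
by field; rewrite h1 h2.
Unshelve. all: by end_near. Qed.

(** No derivative of [phi] is integrated: Cauchy's formula for each [phi^~ t] passes to the
    parameter integral by Fubini, and [cdiff_of_cauchy] concludes. *)
Lemma contour_cdiff (phi : R[i] -> R[i] -> R[i]) (U' : set R[i]) s0 (d r : R) :
  0 < d -> 0 <= r ->
  (forall t, collar r t -> \forall t' \near t, U' t') ->
  (forall s t, cabs (s - s0) < d -> U' t -> cont (fun st => phi st.1 st.2) (s, t)) ->
  (forall s t, cabs (s - s0) < d -> U' t -> cdiff (phi^~ t) s) ->
  cdiff (fun s => contour (phi s) r) s0.
Proof.
move=> d0 r0 rU cphi dphi.
pose psi s t := phi (s0 + s) t.
have sE s : s0 + s - s0 = s by rewrite addrC addKr.
have ds s : cdiff (fun s => s0 + s) s.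
  by apply: cdiffD; [exact: cdiff_cst|exact: cdiff_id].
have cpsi s t : cabs s < d -> U' t -> cont (fun st => psi st.1 st.2) (s, t).
  move=> sd Ut.
  apply: (@cont_comp _ _ _ (fun st : R[i] * R[i] => (s0 + st.1, st.2)) (fun st => phi st.1 st.2)).
    have h1 : cont (fun st : R[i] * R[i] => st.1) (s, t) by exact: cvg_fst.
    apply: (@cvg_pair _ _ _ (nbhs (s, t)) (nbhs (s0 + s)) (nbhs t)); last exact: cvg_snd.
    exact: (contD (@cont_cst _ _ s0 _) h1).
  by apply: cphi => //; rewrite sE.
have dpsi s t : cabs s < d -> U' t -> cdiff (psi^~ t) s.
  move=> sd Ut; apply: (@cdiff_comp _ (fun s => s0 + s) (phi^~ t) s (ds s)).
  by apply: dphi => //; rewrite sE.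
(* The collar of size [d / 2] reaches radius [3 / 4 * d], and Cauchy's formula asks for holomorphy
   up to [2 * rho = d]. *)
pose rho := d / 2; have rho0 : 0 < rho by rewrite divr_gt0.
have cA s : cabs s < d -> cont (fun s => contour (psi s) r) s.
  move=> sd; apply: (contour_cont r0) => [c /rU/nbhs_singleton Uc|]; first exact: cpsi.
  apply/near_cabs; exists (d - cabs s) => [|w ws t /rU/nbhs_singleton Ut]; first by rewrite subr_gt0.
  apply: cont_pairl; apply: cpsi => //.
  by have := cabs_tri w s 0; rewrite !subr0; lra.
suff H : cdiff (fun s => contour (psi s) r) 0.
  have <- : (fun s => contour (psi (s - s0)) r) = (fun s => contour (phi s) r).
    by apply/funext => s; congr contour; apply/funext => t; rewrite /psi addrC subrK.
  apply: (@cdiff_comp _ (fun s => s - s0) (fun s => contour (psi s) r)).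
    by apply: cdiffB; [exact: cdiff_id|exact: cdiff_cst].
  by rewrite subrr.
apply: (@cdiff_of_cauchy _ rho) => //; last by rewrite cabs0.
  by move=> t [_ tr]; apply: cA; move: tr; rewrite /rho; lra.
move=> s sr.
pose U := [set s' : R[i] | cabs s < cabs s' /\ cabs s' < d].
have rhoU s' : collar rho s' -> \forall s'' \near s', U s''.
  move=> [h1 h2]; apply/near_cabs; exists (Num.min (cabs s' - cabs s) (d - cabs s')).
    by rewrite lt_min !subr_gt0 (lt_le_trans sr h1)/=; move: h2; rewrite /rho; lra.
  move=> w; rewrite lt_min => /andP[w1 w2]; split.
    by have := cabs_tri s' w 0; rewrite !subr0 (cabsB s' w); lra.
  by have := cabs_tri w s' 0; rewrite !subr0; lra.
have cq s' t : U s' -> U' t -> cont (fun st => psi st.1 st.2 * (st.1 - s)^-1) (s', t).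
  move=> [h1 h2] Ut; apply: (contM (cpsi _ _ h2 Ut)); apply: contV.
    exact: cabs_sub_gt0.
  have h3 : cont (fun st : R[i] * R[i] => st.1) (s', t) by exact: cvg_fst.
  exact: (contB h3 (@cont_cst _ _ s _)).
have F := @contour_fubini _ (fun s' t => psi s' t * (s' - s)^-1) U U' rho r (ltW rho0) r0 rhoU rU cq.
have -> : contour (fun t => contour (psi t) r * (t - s)^-1) rho =
    contour (fun s' => contour (fun t => psi s' t * (s' - s)^-1) r) rho.
  apply: (contour_ext (ltW rho0)) => s' cs'; rewrite mulrC -(contourZ _ r0); last first.
    move=> t /rU/nbhs_singleton Ut; apply: cont_pairl; apply: cpsi => //.
    exact: (nbhs_singleton (rhoU _ cs')).2.
  by apply: (contour_ext r0) => t _; rewrite mulrC.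
rewrite F mulrC -(contourZ _ r0); last first.
  move=> t /rU/nbhs_singleton Ut; apply: cont_pairl; apply: cpsi => //.
  by move: sr; rewrite /rho; lra.
apply: (contour_ext r0) => t /rU/nbhs_singleton Ut.
rewrite (@cauchy_formula _ (psi^~ t) rho s sr) 1?mulrC// => s' s'r.
by apply: dpsi => //; move: s'r; rewrite /rho; lra.
Qed.

End Entire.

(** * Hermitian space *)

Section EuclideanSpace.
Context {R : realType}.

Definition ip n (z w : 'rV[R[i]]_n) : R[i] := \sum_j z 0 j * (w 0 j)^*%C.

Section Fixed.
Context {n : nat}.
Implicit Types z w u : 'rV[R[i]]_n.

Lemma cabs_sqr (x : R[i]) : cabs x ^+ 2 = Re x ^+ 2 + Im x ^+ 2.
Proof. by case: x => a b /=; rewrite sqr_sqrtr// addr_ge0 ?sqr_ge0. Qed.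

Lemma mulcJ (x : R[i]) : x * x^*%C = (cabs x ^+ 2)%:C%C.
Proof. by rewrite -sqr_normc normE -rmorphXn. Qed.

Lemma enorm_ge0 z : 0 <= enorm z. Proof. exact: sqrtr_ge0. Qed.

Lemma enormE z : enorm z = Num.sqrt (\sum_j cabs (z 0 j) ^+ 2).
Proof. by rewrite /enorm; congr Num.sqrt; apply: eq_bigr => j _; rewrite cabs_sqr. Qed.

Lemma enorm_sqr z : enorm z ^+ 2 = \sum_j cabs (z 0 j) ^+ 2.
Proof. by rewrite enormE sqr_sqrtr// sumr_ge0// => j _; exact: sqr_ge0. Qed.

Lemma ipzz z : ip z z = (enorm z ^+ 2)%:C%C.
Proof. by rewrite enorm_sqr rmorph_sum; apply: eq_bigr => j _; rewrite mulcJ. Qed.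

Lemma ipDl z w u : ip (z + w) u = ip z u + ip w u.
Proof. by rewrite -big_split; apply: eq_bigr => j _; rewrite mxE mulrDl. Qed.
Lemma ipZl c z w : ip (c *: z) w = c * ip z w.
Proof. by rewrite mulr_sumr; apply: eq_bigr => j _; rewrite mxE mulrA. Qed.
Lemma ip_conj z w : (ip z w)^*%C = ip w z.
Proof. by rewrite rmorph_sum; apply: eq_bigr => j _; rewrite rmorphM /= conjcK mulrC. Qed.
Lemma ipDr z w u : ip z (w + u) = ip z w + ip z u.
Proof. by rewrite -ip_conj ipDl rmorphD /= !ip_conj. Qed.
Lemma ipZr c z w : ip z (c *: w) = c^*%C * ip z w.
Proof. by rewrite -ip_conj ipZl rmorphM /= ip_conj. Qed.
Lemma ipNl z w : ip (- z) w = - ip z w. Proof. by rewrite -scaleN1r ipZl mulN1r. Qed.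
Lemma ipNr z w : ip z (- w) = - ip z w.
Proof. by rewrite -ip_conj ipNl rmorphN /= ip_conj. Qed.
Lemma ip0l w : ip 0 w = 0. Proof. by rewrite -(scale0r 0) ipZl mul0r. Qed.
Lemma ip0r w : ip w 0 = 0. Proof. by rewrite -ip_conj ip0l rmorph0. Qed.

Lemma enorm0 : enorm (0 : 'rV[R[i]]_n) = 0.
Proof.
rewrite enormE big1 ?sqrtr0// => j _.
by rewrite mxE cabs0 expr0n.
Qed.

Lemma cabs_le_enorm z j : cabs (z 0 j) <= enorm z.
Proof.
rewrite -(@ler_pXn2r _ 2) ?nnegrE ?cabs_ge0 ?enorm_ge0// enorm_sqr (bigD1 j)//= lerDl.
by rewrite sumr_ge0// => i _; exact: sqr_ge0.
Qed.

Lemma enorm_eq0 z : (enorm z == 0) = (z == 0).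
Proof.
apply/eqP/eqP => [h|->]; last exact: enorm0.
apply/rowP => j; rewrite mxE; apply/eqP; rewrite -cabs_eq0 eq_le cabs_ge0 andbT -h.
exact: cabs_le_enorm.
Qed.

Lemma enormZ c z : enorm (c *: z) = cabs c * enorm z.
Proof.
apply/eqP; rewrite -(@eqrXn2 _ 2) ?mulr_ge0 ?enorm_ge0 ?cabs_ge0// exprMn !enorm_sqr mulr_sumr.
by apply/eqP; apply: eq_bigr => j _; rewrite mxE cabsM exprMn.
Qed.

Lemma enormN z : enorm (- z) = enorm z.
Proof. by rewrite -scaleN1r enormZ cabsN cabs1 mul1r. Qed.

Lemma enormB z w : enorm (z - w) = enorm (w - z).
Proof. by rewrite -enormN opprB. Qed.

Lemma pythagoras z w : ip z w = 0 -> enorm (z + w) ^+ 2 = enorm z ^+ 2 + enorm w ^+ 2.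
Proof.
move=> h; apply: complexI; rewrite rmorphD /= -!ipzz ipDl !ipDr h -(ip_conj z w) h rmorph0.
by rewrite addr0 add0r.
Qed.

Lemma cauchy_schwarz z w : cabs (ip z w) <= enorm z * enorm w.
Proof.
have [->|w0] := eqVneq w 0; first by rewrite ip0r cabs0 enorm0 mulr0.
have nw : 0 < enorm w by rewrite lt_def enorm_ge0 enorm_eq0 w0.
pose c := ip z w / (enorm w ^+ 2)%:C%C.
have orth : ip (z - c *: w) (c *: w) = 0.
  rewrite ipZr ipDl ipNl ipZl ipzz /c divfK ?subrr ?mulr0//.
  by rewrite fmorph_eq0 expf_neq0// gt_eqF.
have := pythagoras orth; rewrite subrK enormZ => e.
have : (cabs c * enorm w) ^+ 2 <= enorm z ^+ 2 by rewrite e lerDr sqr_ge0.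
rewrite ler_pXn2r ?nnegrE ?mulr_ge0 ?enorm_ge0 ?cabs_ge0//.
rewrite /c cabsM cabsV cabsR ger0_norm ?sqr_ge0// => h.
rewrite -ler_pdivrMr//; apply: le_trans h; rewrite expr2 le_eqVlt; apply/orP; left.
by apply/eqP; field; rewrite gt_eqF.
Qed.

Lemma enormD z w : enorm (z + w) <= enorm z + enorm w.
Proof.
rewrite -(@ler_pXn2r _ 2) ?nnegrE ?addr_ge0 ?enorm_ge0//.
have -> : enorm (z + w) ^+ 2 = enorm z ^+ 2 + enorm w ^+ 2 + 2 * Re (ip z w).
  apply: complexI; rewrite 2!rmorphD /= -!ipzz ipDl !ipDr -(ip_conj z w).
  have -> : (2 * Re (ip z w))%:C%C = ip z w + (ip z w)^*%C.
    by rewrite addcJ rmorphM rmorphD rmorph1.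
  ring.
have := cauchy_schwarz z w; have := Re_le_cabs (ip z w); have := ler_norm (Re (ip z w)).
rewrite sqrrD; lra.
Qed.

Lemma enorm_tri z w u : enorm (z - u) <= enorm (z - w) + enorm (w - u).
Proof. by apply: le_trans (enormD _ _); rewrite addrA subrK. Qed.

Lemma enorm_lt z (e : R) : 0 < e -> (forall j, cabs (z 0 j) < e) -> enorm z <= n%:R * e.
Proof.
move=> e0 H; rewrite -(@ler_pXn2r _ 2) ?nnegrE ?mulr_ge0 ?enorm_ge0 ?(ltW e0)//.
rewrite enorm_sqr; apply: (@le_trans _ _ (\sum_(j < n) e ^+ 2)).
  by apply: ler_sum => j _; rewrite lerXn2r ?nnegrE ?cabs_ge0 ?(ltW e0)// ltW.
rewrite sumr_const card_ord exprMn -[leLHS]mulr_natl ler_wpM2r ?sqr_ge0//.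
by rewrite -natrX ler_nat; case: (n) => // m; rewrite -mulnn leq_pmulr.
Qed.

Lemma near_enorm z (P : set 'rV[R[i]]_n) :
  (\forall w \near z, P w) <->
  exists2 d : R, 0 < d & forall w, enorm (w - z) < d -> P w.
Proof.
split=> [/nbhs_ballP[e /= e0 H]|[d d0 H]].
  have [ee e'0] : (Re e)%:C%C = e /\ 0 < Re e.
    move: e0; rewrite ltcE => /andP[/eqP Ie]; split=> //.
    by rewrite [e in RHS]complexE Ie; rewrite /= mulr0 addr0.
  exists (Re e) => // w wz; apply: H; rewrite /ball/= /mx_ball; split=> // i j.
  rewrite ord1 -ee -ball_normE /ball_ /= normE ltcR.
  have := cabs_le_enorm (z - w) j; rewrite enormB !mxE => /le_lt_trans; exact.
have n1 : 0 < n%:R + 1 :> R by have : 0 <= n%:R :> R by []; lra.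
have e0 : 0 < d / (n%:R + 1) by rewrite divr_gt0.
apply/nbhs_ballP; exists (d / (n%:R + 1))%:C%C; rewrite /= ?ltcR//.
move=> w [_ wz]; apply: H; apply: le_lt_trans (enorm_lt e0 _) _.
  move=> j; have := wz 0 j; rewrite -ball_normE /ball_ /= normE ltcR.
  by rewrite cabsB !mxE.
by rewrite mulrA ltr_pdivrMr// (mulrC _ d) ltr_pM2l//; lra.
Qed.

Lemma ball_exteriorE z : ball_exterior R n z <-> 1 < enorm z.
Proof.
split=> [h|h cl].
  rewrite ltNge; apply/negP => z1; apply: h => P /near_enorm[d d0 H].
  have z0 := enorm_ge0 z.
  (* A point of the closed ball is approached by [t *: z] with [t] slightly below 1, which lies in
     the open ball even if [z] is on the sphere. *)
  pose t : R := 1 - Num.min (d / 2) (1 / 2).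
  have [t0 t1 td] : [/\ 0 <= t, t < 1 & 1 - t < d].
    have h1 : Num.min (d / 2) (1 / 2) <= 1 / 2 :> R by rewrite ge_min lexx orbT.
    have h2 : Num.min (d / 2) (1 / 2) <= d / 2 by rewrite ge_min lexx.
    have h3 : 0 < Num.min (d / 2) (1 / 2) :> R by rewrite lt_min !divr_gt0.
    by rewrite /t; split; lra.
  move: t t0 t1 td => t t0 t1 td.
  exists (t%:C%C *: z); split.
    rewrite /unit_ball /= enormZ cabsR ger0_norm//.
    by apply: le_lt_trans t1; rewrite ler_piMr.
  apply: H; have -> : t%:C%C *: z - z = (t - 1)%:C%C *: z.
    rewrite -[X in _ - X]scale1r -scalerBl.
    by congr (_ *: _); rewrite rmorphB rmorph1.
  rewrite enormZ cabsR distrC ger0_norm ?subr_ge0 ?(ltW t1)//.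
  by apply: le_lt_trans td; rewrite ler_piMr// subr_ge0 ltW.
have /cl[w [/= w1 w2]] : \forall w \near z, 1 < enorm w.
  apply/near_enorm; exists (enorm z - 1) => [|w wz]; first by rewrite subr_gt0.
  by have := enorm_tri z w 0; rewrite !subr0 (enormB z); lra.
by move: w1; rewrite /unit_ball /= ltNge (ltW w2).
Qed.

Lemma compact_enorm_ball (r : R) : compact [set z : 'rV[R[i]]_n | enorm z <= r].
Proof.
have := @rV_compact (R[i] : ptopologicalType) n (fun=> [set x | cabs (x - 0) <= r]) (fun=> @compact_ball R 0 r).
move=> c; apply: (subclosed_compact _ c) => [z cz|z /= zr i].
  rewrite /= leNgt; apply/negP => zr.
  have /cz[w [/= h1 h2]] : \forall w \near z, r < enorm w.
    apply/near_enorm; exists (enorm z - r) => [|w wz]; first by rewrite subr_gt0.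
    by have := enorm_tri z w 0; rewrite !subr0 (enormB z); lra.
  by move: h1; rewrite leNgt h2.
by rewrite subr0; apply: le_trans zr; exact: cabs_le_enorm.
Qed.

End Fixed.

Lemma cont_coord m N (f : 'rV[R[i]]_m -> 'rV[R[i]]_N) z l :
  {for z, continuous f} -> cont (fun z => f z 0 l) z.
Proof.
move=> cf; apply/contP => e e0.
have : \forall w \near f z, cabs ((w : 'rV[R[i]]_N) 0 l - f z 0 l) < e.
  apply/near_enorm; exists e => // w wz; apply: le_lt_trans wz.
  by have := cabs_le_enorm (w - f z) l; rewrite !mxE.
exact: cf.
Qed.

Lemma cdiffI (f : R[i] -> R[i]) (a d : R[i]) :
  (forall e : R, 0 < e -> exists2 r : R, 0 < r &
    forall t, t != a -> cabs (t - a) < r -> cabs ((f t - f a) / (t - a) - d) < e) ->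
  cdiff f a.
Proof.
move=> H; exists (fun t => if t == a then d else (f t - f a) / (t - a)).
  apply/contP => e e0; have [r r0 Hr] := H _ e0; apply/near_cabs; exists r => // t tr.
  by rewrite eqxx; case: eqVneq => [_|ta]; rewrite ?subrr ?cabs0//; exact: Hr.
apply/near_cabs; exists 1 => // t _; case: eqVneq => [->|ta]; first by rewrite !subrr mulr0.
by rewrite divfK// subr_eq0.
Qed.

Lemma differentiable_line n N (f : 'rV[R[i]]_n -> 'rV[R[i]]_N) z u l t0 :
  differentiable f (z + t0 *: u) -> cdiff (fun t => f (z + t *: u) 0 l) t0.
Proof.
move=> /(@diff_derivable _ _ _ f _ u)/cvg_ex[L HL].
apply: (@cdiffI _ t0 (L 0 l)) => e e0.
have /HL : \forall w \near L, cabs ((w : 'rV[R[i]]_N) 0 l - L 0 l) < e.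
  apply/near_enorm; exists e => // w wz; apply: le_lt_trans wz.
  by have := cabs_le_enorm (w - L) l; rewrite !mxE.
rewrite nbhs_simpl /= /dnbhs withinE => -[V V0 VE].
have /near_cabs[r r0 Hr] : \forall h \near (0 : R[i]), V h by [].
exists r => // t tt0 tr.
have : (V `&` [set h | h != 0]) (t - t0).
  by split; [apply: Hr; rewrite subr0|rewrite /= subr_eq0].
rewrite -VE => -[+ _] /=; rewrite /shift /= !mxE.
by rewrite addrCA -scalerDl subrK mulrC.
Qed.

End EuclideanSpace.

(** * Hartogs extension *)

Section Hartogs.
Context {R : realType} {n : nat}.
Implicit Types (z u v : 'rV[R[i]]_n) (phi : 'rV[R[i]]_n -> R[i]).

Definition line_holo phi := forall z u t, cdiff (fun t => phi (z + t *: u)) t.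

Definition ext_holo phi :=
  (forall z, 1 < enorm z -> cont phi z) /\
  (forall z u t, 1 < enorm (z + t *: u) -> cdiff (fun t => phi (z + t *: u)) t).

Lemma continuous_affine2 z u v (st : R[i] * R[i]) :
  {for st, continuous (fun st : R[i] * R[i] => z + st.1 *: u + st.2 *: v)}.
Proof.
case: st => s t P /near_enorm[d d0 HP].
pose M := enorm u + enorm v + 1.
have u0 := enorm_ge0 u; have v0 := enorm_ge0 v.
have M0 : 0 < M by rewrite /M; lra.
exists ([set s' | cabs (s' - s) < d / M], [set t' | cabs (t' - t) < d / M]).
  by split; apply/near_cabs; exists (d / M) => //; rewrite divr_gt0.
move=> [s' t'] /= [hs ht]; apply: HP => /=.
have -> : z + s' *: u + t' *: v - (z + s *: u + t *: v) = (s' - s) *: u + (t' - t) *: v.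
  by apply/rowP => j; rewrite !mxE; ring.
apply: le_lt_trans (enormD _ _) _; rewrite !enormZ.
have h1 : cabs (s' - s) * enorm u <= d / M * enorm u by rewrite ler_wpM2r// ltW.
have h2 : cabs (t' - t) * enorm v <= d / M * enorm v by rewrite ler_wpM2r// ltW.
have h3 : d / M * M = d by rewrite divfK// gt_eqF.
have h4 : 0 < d / M by rewrite divr_gt0.
have : d / M * M = d / M * enorm u + d / M * enorm v + d / M by rewrite /M; ring.
lra.
Qed.

Lemma continuous_line v (zt : 'rV[R[i]]_n * R[i]) :
  {for zt, continuous (fun zt : 'rV[R[i]]_n * R[i] => zt.1 + zt.2 *: v)}.
Proof.
case: zt => z t P /near_enorm[d d0 HP].
pose M := enorm v + 1.
have v0 := enorm_ge0 v.
have M0 : 0 < M by rewrite /M; lra.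
exists ([set z' | enorm (z' - z) < d / M], [set t' | cabs (t' - t) < d / M]).
  by split; [apply/near_enorm|apply/near_cabs]; exists (d / M) => //; rewrite divr_gt0.
move=> [z' t'] /= [hs ht]; apply: HP => /=.
have -> : z' + t' *: v - (z + t *: v) = (z' - z) + (t' - t) *: v.
  by apply/rowP => j; rewrite !mxE; ring.
apply: le_lt_trans (enormD _ _) _; rewrite !enormZ.
have h2 : cabs (t' - t) * enorm v <= d / M * enorm v by rewrite ler_wpM2r// ltW.
have h3 : d / M * M = d by rewrite divfK// gt_eqF.
have : d / M * M = d / M * enorm v + d / M by rewrite /M; ring.
lra.
Qed.

(** For [k = 0] this is the Hartogs extension: the Cauchy mean of [phi] over a contour in the line
    through [z] that goes around the ball. In general it will be the [k]-th Taylor coefficient of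
    the extension in direction [v]. The size [enorm z + 2] keeps the contour in the exterior, and
    [dircoefE] allows freezing it while [z] moves. *)
Definition dircoef v (k : nat) phi z := coef (fun t => phi (z + t *: v)) k (enorm z + 2).

Context (v : 'rV[R[i]]_n) (v1 : enorm v = 1).

Lemma far_exterior z t : enorm z + 1 < cabs t -> 1 < enorm (z + t *: v).
Proof.
have := enorm_tri (z + t *: v) z 0; have := enormD (z + t *: v) (- z).
by rewrite enormN addrC addKr enormZ v1 mulr1; lra.
Qed.

Lemma dircoefE k phi z (r : R) : ext_holo phi -> enorm z + 2 <= r ->
  dircoef v k phi z = coef (fun t => phi (z + t *: v)) k r.
Proof.
move=> [_ dphi] zr; apply: coef_scale => //.
  by have := enorm_ge0 z; lra.
by move=> t t1 _; apply: dphi; apply: far_exterior; lra.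
Qed.

Lemma dircoef_cont k phi z : ext_holo phi -> cont (dircoef v k phi) z.
Proof.
move=> hphi; pose r := enorm z + 3.
have z0 := enorm_ge0 z; have r0 : 0 < r by rewrite /r; lra.
have near_r : \forall z' \near z, enorm z' + 2 <= r.
  apply/near_enorm; exists 1 => // w wz; rewrite /r.
  by have := enorm_tri w z 0; rewrite !subr0; lra.
have c1 z' t : enorm z' + 2 <= r -> collar r t ->
    cont (fun zt : 'rV[R[i]]_n * R[i] => phi (zt.1 + zt.2 *: v) * zt.2^-1 ^+ k.+1) (z', t).
  move=> z'r ct; have ext : 1 < enorm (z' + t *: v).
    by apply: far_exterior; case: ct => + _; lra.
  have h := @cont_comp _ _ _ _ phi (z', t) (@continuous_line v (z', t)) (hphi.1 _ ext).
  apply: (contM h); apply: (@cont_comp _ _ _ (fun zt : 'rV[R[i]]_n * R[i] => zt.2) (fun t => t^-1 ^+ k.+1)).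
    exact: cvg_snd.
  exact: (@cont_powV R k.+1 t (collar_neq0 r0 ct)).
have c : cont (fun z' => coef (fun t => phi (z' + t *: v)) k r) z.
  apply: (contM (@cont_cst _ _ _ _)).
  apply: (@contour_cont _ _ (fun z' t => phi (z' + t *: v) * t^-1 ^+ k.+1) _ _ (ltW r0)).
    by move=> t ct; apply: c1 => //; exact: nbhs_singleton near_r.
  apply: filterS near_r => z' z'r t ct.
  apply: (@cont_comp _ _ _ (fun t => (z', t)) (fun zt : 'rV[R[i]]_n * R[i] => phi (zt.1 + zt.2 *: v) * zt.2^-1 ^+ k.+1)).
    by apply: (@cvg_pair _ _ _ (nbhs t) (nbhs z') (nbhs t)); [exact: cvg_cst|exact: cvg_id].
  exact: c1.
apply/contP => e e0; move/contP : c => /(_ _ e0) h.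
near=> z'; have z'r : enorm z' + 2 <= r by near: z'.
rewrite (dircoefE k hphi z'r) (dircoefE k hphi (nbhs_singleton near_r)).
by near: z'.
Unshelve. all: by end_near. Qed.

Lemma dircoef_line_holo k phi : ext_holo phi -> line_holo (dircoef v k phi).
Proof.
move=> hphi z u s0; pose r := enorm (z + s0 *: u) + 3 + enorm u.
have z0 := enorm_ge0 (z + s0 *: u); have u0 := enorm_ge0 u.
have r0 : 0 < r by rewrite /r; lra.
have near_r s : cabs (s - s0) < 1 -> enorm (z + s *: u) + 2 <= r - 1.
  move=> ss0; have := enorm_tri (z + s *: u) (z + s0 *: u) 0; rewrite !subr0.
  have -> : z + s *: u - (z + s0 *: u) = (s - s0) *: u.
    by apply/rowP => j; rewrite !mxE; ring.
  rewrite enormZ; have : cabs (s - s0) * enorm u <= 1 * enorm u.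
    by rewrite ler_wpM2r// ltW.
  by move: u0; rewrite /r; clear; lra.
have H : cdiff (fun s => coef (fun t => phi (z + s *: u + t *: v)) k r) s0.
  apply: cdiffZ.
  apply: (@contour_cdiff _ (fun s t => phi (z + s *: u + t *: v) * t^-1 ^+ k.+1)
    [set t | r - 1 < cabs t] s0 1) => //; first exact: ltW.
  - move=> t [rt _]; apply/near_cabs; exists 1 => // w wt.
    by rewrite /mkset; have := cabs_tri t w 0; rewrite !subr0 (cabsB t w); lra.
  - move=> s t ss0 /= rt; have ext : 1 < enorm (z + s *: u + t *: v).
      apply: far_exterior; apply: lt_trans (le_lt_trans (near_r s ss0) rt).
      by rewrite ltrD2l ltr1n.
    have t0 : t != 0.
      by rewrite -cabs_gt0; apply: le_lt_trans rt; rewrite /r; lra.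
    have h := @cont_comp _ _ _ _ phi (s, t) (@continuous_affine2 z u v (s, t)) (hphi.1 _ ext).
    apply: (contM h); apply: (@cont_comp _ _ _ (fun st : R[i] * R[i] => st.2) (fun t => t^-1 ^+ k.+1)).
      exact: cvg_snd.
    exact: (@cont_powV R k.+1 t t0).
  - move=> s t ss0 /= rt; apply: cdiffM; last exact: cdiff_cst.
    have ext : 1 < enorm (z + s *: u + t *: v).
      apply: far_exterior; apply: lt_trans (le_lt_trans (near_r s ss0) rt).
      by rewrite ltrD2l ltr1n.
    have e s' : z + s' *: u + t *: v = (z + t *: v) + s' *: u by rewrite addrAC.
    under eq_fun do rewrite e.
    by apply: hphi.2; rewrite -e.
apply: cdiff_near H; apply/near_cabs; exists 1 => // s ss0.
rewrite -(dircoefE k hphi)//; apply: le_trans (near_r s ss0) _.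
by rewrite gerBl.
Qed.

Definition hartogs_ext phi z := dircoef v 0 phi z.

(** On a line that misses the closed ball [phi] is entire, and Cauchy's formula returns its
    value. *)
Lemma hartogs_ext_free phi z : ext_holo phi -> (forall t, 1 < enorm (z + t *: v)) ->
  hartogs_ext phi z = phi z.
Proof.
move=> hphi H; rewrite /hartogs_ext /dircoef /coef.
have r0 : 0 < enorm z + 2 by have := enorm_ge0 z; lra.
rewrite (@contour_ext _ _ (fun t => phi (z + t *: v) * (t - 0)^-1) _ (ltW r0)); last first.
  by move=> t _; rewrite subr0 expr1.
rewrite (@cauchy_formula _ (fun t => phi (z + t *: v))) ?cabs0//; last first.
  by move=> t _; exact: hphi.2.
by rewrite scale0r addr0 mulrC mulfK// kappa_neq0.
Qed.

Definition perp z := z - ip z v *: v.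

Lemma perp_ip z : ip (perp z) v = 0.
Proof. by rewrite /perp ipDl ipNl ipZl ipzz v1 expr1n mulr1 subrr. Qed.

Lemma perp_le z t : enorm (perp z) <= enorm (z + t *: v).
Proof.
have o : ip (perp z) ((ip z v + t) *: v) = 0 by rewrite ipZr perp_ip mulr0.
rewrite -(@ler_pXn2r _ 2) ?nnegrE ?enorm_ge0//.
have -> : z + t *: v = perp z + (ip z v + t) *: v.
  by rewrite /perp scalerDl addrA subrK.
by rewrite (pythagoras o) lerDl sqr_ge0.
Qed.

Lemma perp_line z u s : perp (z + s *: u) = perp z + s *: perp u.
Proof.
rewrite /perp ipDl ipZl; apply/rowP => j; rewrite !mxE; ring.
Qed.

Lemma exists_orthogonal z : (2 <= n)%N -> exists2 u, u != 0 & ip u z = 0.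
Proof.
move=> n2.
pose i0 : 'I_n := Ordinal (leq_trans (isT : 0 < 2)%N n2); pose j0 : 'I_n := Ordinal n2.
have ij : i0 != j0 by [].
have ipE (a b : R[i]) : ip (\row_k (if k == i0 then a else if k == j0 then b else 0)) z =
    a * (z 0 i0)^*%C + b * (z 0 j0)^*%C.
  rewrite /ip (bigD1 i0)//= (bigD1 j0) 1?eq_sym//= !mxE eqxx eq_sym (negPf ij) eqxx big1 ?addr0//.
  by move=> k /andP[k1 k2]; rewrite mxE (negPf k1) (negPf k2) mul0r.
have [zi|zi] := eqVneq (z 0 i0) 0.
  exists (\row_k (if k == i0 then 1 else if k == j0 then 0 else 0)).
    by apply/eqP => /rowP/(_ i0); rewrite !mxE eqxx => /eqP; rewrite oner_eq0.
  by rewrite ipE zi rmorph0 mulr0 mul0r addr0.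
exists (\row_k (if k == i0 then - (z 0 j0)^*%C else if k == j0 then (z 0 i0)^*%C else 0)).
  apply/eqP => /rowP/(_ j0); rewrite !mxE eqxx eq_sym (negPf ij) => /eqP.
  by rewrite conjc_eq0 (negPf zi).
by rewrite ipE; ring.
Qed.

(** For [u] orthogonal to [z] the line [z + s *: u] stays in the exterior. For large [s] the line in
    direction [v] through [z + s *: u] misses the ball and [hartogs_ext_free] applies; the identity
    theorem in [s] brings the equality back to [s = 0]. *)
Lemma hartogs_extE phi z : (2 <= n)%N -> ext_holo phi -> 1 < enorm z ->
  hartogs_ext phi z = phi z.
Proof.
move=> n2 hphi z1.
have sqr_lt (w : 'rV[R[i]]_n) (a : R) : enorm w ^+ 2 = enorm z ^+ 2 + a ^+ 2 -> 1 < enorm w.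
  move=> e; apply: lt_le_trans z1 _.
  by rewrite -(@ler_pXn2r _ 2) ?nnegrE ?enorm_ge0// e lerDl sqr_ge0.
(* If [z] is orthogonal to [v], its own line in direction [v] misses the ball. Otherwise [u] is not
   a multiple of [v], so [perp u] is nonzero and [perp (z + s *: u)] grows with [s]. *)
have [zv|zv] := eqVneq (ip z v) 0.
  apply: hartogs_ext_free => // t.  apply: (sqr_lt _ (enorm (t *: v))).
  by rewrite pythagoras// ipZr zv mulr0.
have [u u0 uz] := exists_orthogonal z n2.
have zu : ip z u = 0 by rewrite -ip_conj uz rmorph0.
have pu : 0 < enorm (perp u).
  rewrite lt_def enorm_ge0 andbT enorm_eq0; apply/eqP => /subr0_eq e.
  move: uz; rewrite e ipZl => /eqP; rewrite mulf_eq0 => /orP[/eqP h|/eqP h].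
    by move: u0; rewrite e h scale0r eqxx.
  by move: zv; rewrite -ip_conj h rmorph0 eqxx.
have ext s : 1 < enorm (z + s *: u).
  by apply: (sqr_lt _ (enorm (s *: u))); rewrite pythagoras// ipZr zu mulr0.
pose g s := hartogs_ext phi (z + s *: u) - phi (z + s *: u).
have dg s : cdiff g s.
  by apply: cdiffB; [exact: dircoef_line_holo|exact: hphi.2].
pose S := (2 + enorm (perp z)) / enorm (perp u).
have S0 : 0 <= S by rewrite divr_ge0 ?addr_ge0 ?enorm_ge0.
have g0 s : S < cabs s -> g s = 0.
  move=> sS; rewrite /g hartogs_ext_free ?subrr// => t.
  apply: lt_le_trans (perp_le _ _); rewrite perp_line.
  have : S * enorm (perp u) < cabs s * enorm (perp u) by rewrite ltr_pM2r.
  rewrite /S divfK ?gt_eqF// -enormZ.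
  have := enorm_tri (s *: perp u) (- perp z) 0; rewrite !subr0 enormN opprK.
  rewrite [s *: _ + _]addrC; have := enorm_ge0 (perp z).
  move: (enorm (perp z)) (enorm (perp z + _)) (enorm (s *: _)) => a b c.
  by clear; lra.
have := @identity_entire _ g (S + 1)%:C%C dg.
have h e : 0 < e -> exists x : R[i], [/\ x != (S + 1)%:C%C, cabs (x - (S + 1)%:C%C) < e & g x = 0].
  move=> e0; exists (S + 1 + e / 2)%:C%C.
  have d : (S + 1 + e / 2)%:C%C - (S + 1)%:C%C = (e / 2)%:C%C :> R[i].
    by rewrite [X in X - _]rmorphD /= addrC addKr.
  split.
  - by rewrite -subr_eq0 d fmorph_eq0 gt_eqF// divr_gt0.
  - by rewrite d cabsR ger0_norm ?divr_ge0 ?(ltW e0)//; lra.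
  - by apply: g0; rewrite cabsR ger0_norm; lra.
by move=> /(_ h 0) /eqP; rewrite /g scale0r addr0 subr_eq0 => /eqP.
Qed.

End Hartogs.

(** * Reflection across the sphere *)

Section Reflection.
Context {R : realType}.

(** The function [h] is holomorphic off [0], since two conjugations cancel, and vanishes on the unit
    circle, where [t] equals the conjugate of its inverse. Vanishing is then carried from [1] down
    to [c] along a chain of discs. *)
Lemma reflection N (g : R[i] -> 'rV[R[i]]_N) (c : R) :
  (forall l t, cdiff (fun t => g t 0 l) t) ->
  (forall t, cabs t = 1 -> enorm (g t) = 1) ->
  0 < c -> c <= 1 -> ip (g c%:C%C) (g c^-1%:C%C) = 1.
Proof.
move=> dg g1 c0 c1.
pose h t := ip (g t) (g (t^-1)^*%C) - 1.
have dh t : t != 0 -> cdiff h t.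
  move=> t0; apply: cdiffB; last exact: cdiff_cst.
  apply: cdiff_sum => l _; apply: cdiffM; first exact: dg.
  apply: (@cdiff_comp _ (fun t => t^-1) (fun s => (g s^*%C 0 l)^*%C)).
    by apply: cdiffV => //; exact: cdiff_id.
  exact: (@cdiff_conj _ (fun s => g s 0 l)).
have h1 t : cabs t = 1 -> h t = 0.
  move=> t1; rewrite /h.
  have -> : (t^-1)^*%C = t.
    have t0 : t != 0 by rewrite -cabs_eq0 t1 oner_eq0.
    apply: (mulfI (_ : t^*%C != 0)); first by rewrite conjc_eq0.
    by rewrite -rmorphM mulfV// rmorph1 mulrC mulcJ t1 expr1n.
  by rewrite ipzz g1// expr1n subrr.
(* With radius [b / 2], [identity] asks for holomorphy on the disc of radius [b] about [b], the
   largest one avoiding [0]. *)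
pose Z (b : R) := forall x, cabs (x - b%:C%C) < b / 2 -> h x = 0.
have Zid (b : R) : 0 < b -> (forall e : R, 0 < e ->
    exists x, [/\ x != b%:C%C, cabs (x - b%:C%C) < e & h x = 0]) -> Z b.
  move=> b0 H x xb; pose k t := h (b%:C%C + t).
  have -> : h x = k (x - b%:C%C) by rewrite /k addrC subrK.
  apply: (@identity _ k (b / 2)) => //; first by rewrite divr_gt0.
    move=> t tb; apply: (@cdiff_comp _ (fun t => b%:C%C + t) h).
      by apply: cdiffD; [exact: cdiff_cst|exact: cdiff_id].
    apply: dh; apply/eqP => /eqP; rewrite addr_eq0 => /eqP e.
    by move: tb; rewrite -cabsN -e cabsR ger0_norm ?ltW//; lra.
  move=> e /H[y [yb ye hy]]; exists (y - b%:C%C); split => //.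
    by rewrite subr_eq0.
  by rewrite /k addrC subrK.
have Z1 : Z 1.
  apply: Zid => // e e0; pose d := Num.min 1 (e / 4).
  have d0 : 0 < d by rewrite lt_min ltr01 divr_gt0.
  have de : d <= e / 4 by rewrite ge_min lexx orbT.
  (* A quotient of conjugate numbers lies on the unit circle; this one is within [2 * d] of [1]. *)
  pose a : R[i] := (1 +i* d)%C; pose b : R[i] := (1 +i* - d)%C.
  have ab : cabs a = cabs b by rewrite /= sqrrN.
  have b1 : 1 <= cabs b.
    by have := Re_le_cabs b; rewrite /= normr1.
  have b0 : b != 0 by rewrite -cabs_gt0; lra.
  have e1 : a / b - 1 = (a - b) / b by rewrite mulrBl divff.
  have abE : a - b = (2 * d)%:C%C * 'i%C.
    by apply/eqP; rewrite eq_complex /=; apply/andP; split; apply/eqP; ring.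
  exists (a / b); split.
  - rewrite -subr_eq0 rmorph1 e1 mulf_neq0 ?invr_eq0// abE mulf_neq0//.
      by rewrite fmorph_eq0 mulf_neq0// gt_eqF.
    by rewrite -cabs_eq0 cabs_i oner_eq0.
  - rewrite rmorph1 e1 abE !cabsM cabsV cabsR cabs_i mulr1 ger0_norm; last by lra.
    rewrite ltr_pdivrMr ?(lt_le_trans ltr01)//; apply: (@lt_le_trans _ _ e); first lra.
    by rewrite ler_peMr// ltW.
  - by apply: h1; rewrite cabsM cabsV ab divff// gt_eqF// (lt_le_trans ltr01).
have Zstep (b b' : R) : 0 < b -> 3 / 4 * b <= b' -> b' <= b -> Z b -> Z b'.
  move=> b0 bb' b'b Zb; apply: Zid; first lra.
  move=> e e0; pose d := Num.min (b / 8) (e / 2).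
  have d0 : 0 < d by rewrite lt_min !divr_gt0.
  have d1 : d <= b / 8 by rewrite ge_min lexx.
  have d2 : d <= e / 2 by rewrite ge_min lexx orbT.
  exists (b' + d)%:C%C.
  have E1 (x y : R) : (x%:C%C - y%:C%C : R[i]) = (x - y)%:C%C by rewrite rmorphB.
  split.
  - by rewrite -subr_eq0 E1 fmorph_eq0; apply/eqP; lra.
  - by rewrite E1 cabsR ger0_norm; lra.
  - by apply: Zb; rewrite E1 cabsR ltr_norml; apply/andP; split; lra.
have Zall k (b : R) : (3 / 4) ^+ k <= b -> b <= 1 -> Z b.
  elim: k b => [|k IH] b.
    by rewrite expr0 => b1 b2; have -> : b = 1 by lra.
  move=> h2 h3; have [h4|h4] := leP ((3 / 4) ^+ k) b; first exact: IH.
  have p0 : 0 < (3 / 4 : R) ^+ k by rewrite exprn_gt0// divr_gt0.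
  have p1 : (3 / 4 : R) ^+ k <= 1 by rewrite exprn_ile1//; lra.
  move: h2; rewrite exprS => h2.
  have [h5|h5] := leP (4 / 3 * b) 1; last by apply: (Zstep 1) => //; lra.
  by apply: (Zstep (4 / 3 * b)); [lra|lra|lra|apply: IH; lra].
have [k kc] : exists k, (3 / 4) ^+ k <= c.
  (* The exponent is tripled because (3/4)^3 = 27/64 is below 1/2. *)
  have [k hk] := half_pow_lt 1 c0; exists (3 * k)%N.
  apply: le_trans (ltW hk); rewrite exprM mul1r -exprVn lerXn2r ?nnegrE ?exprn_ge0 ?invr_ge0//.
  by rewrite !exprS expr0; lra.
have := Zall k c kc c1 c%:C%C; rewrite subrr cabs0 divr_gt0// => /(_ isT)/eqP.
rewrite /h subr_eq0 => /eqP; congr (ip _ (g _) = 1).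
by rewrite -fmorphV conjc_real.
Qed.

(** The point [b] of the complex line through [z] and [w] is the one nearest to the origin, so the
    line meets the sphere in a circle about [b]. There [z = b - p d] and [w = b - q d] are inverse
    points: [p * q * D] is the squared radius. The parametrization [g] takes the unit circle to this
    circle, [c] to [z] and [c^-1] to [w], and [reflection] applies. *)
Lemma polarization n N (F : 'rV[R[i]]_n -> 'rV[R[i]]_N) z w :
  (forall l, line_holo (fun z => F z 0 l)) ->
  (forall z, enorm z = 1 -> enorm (F z) = 1) ->
  enorm z < 1 -> ip z w = 1 -> ip (F z) (F w) = 1.
Proof.
move=> dF F1 z1 zw; have z0 := enorm_ge0 z.
pose ka := 1 - enorm z ^+ 2.
have ka0 : 0 < ka by rewrite subr_gt0 expr_lt1.
pose d := z - w.
have zd : ip z d = - ka%:C%C.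
  by rewrite /d ipDr ipNr zw ipzz /ka rmorphB rmorph1 opprB.
have d0 : 0 < enorm d.
  rewrite lt_def enorm_ge0 enorm_eq0 andbT; apply/eqP => d0; move/eqP: zd.
  by rewrite d0 ip0r eq_sym oppr_eq0 fmorph_eq0 gt_eqF.
pose D := enorm d ^+ 2; have D0 : 0 < D by rewrite exprn_gt0.
pose p := ka / D; have p0 : 0 < p by rewrite divr_gt0.
have pD : p * D = ka by rewrite divfK// gt_eqF.
pose b := z + p%:C%C *: d.
have bd : ip b d = 0.
  by rewrite /b ipDl ipZl zd ipzz -/D -rmorphM pD addrC subrr.
pose q := p + 1; have q0 : 0 < q by rewrite /q; lra.
pose c := Num.sqrt (p / q); pose be := - Num.sqrt (p * q).
have c0 : 0 < c by rewrite sqrtr_gt0 divr_gt0.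
have pqE : Num.sqrt (p * q) = c * q.
  have -> : p * q = p / q * q ^+ 2 by rewrite expr2 mulrA divfK// gt_eqF.
  by rewrite sqrtrM ?divr_ge0 ?ltW// sqrtr_sqr ger0_norm// ltW.
have c2 : c ^+ 2 = p / q by rewrite sqr_sqrtr// divr_ge0 ?ltW.
have c1 : c <= 1.
  rewrite -(@ler_pXn2r _ 2) ?nnegrE ?(ltW c0)// expr1n c2 ler_pdivrMr// /q; lra.
have cbe : c * be = - p by rewrite /be pqE mulrN mulrA -expr2 c2 divfK// gt_eqF.
have bec : c^-1 * be = - q by rewrite /be pqE mulrN mulKf// gt_eqF.
pose g t := F (b + t *: (be%:C%C *: d)).
have := @reflection N g c _ _ c0 c1.
have -> : g c%:C%C = F z.
  by rewrite /g scalerA -rmorphM cbe rmorphN scaleNr /b addrK.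
have -> : g c^-1%:C%C = F w.
  rewrite /g scalerA -rmorphM bec rmorphN scaleNr /b /q rmorphD rmorph1 scalerDl scale1r.
  by rewrite opprD addrA addrK /d opprB addrC subrK.
apply; first by move=> l t; exact: dF.
move=> t t1; apply: F1; apply/eqP; rewrite -(@eqrXn2 _ 2) ?enorm_ge0// expr1n.
have o : ip b (t *: (be%:C%C *: d)) = 0 by rewrite !ipZr bd !mulr0.
rewrite (pythagoras o) !enormZ t1 mul1r cabsR exprMn real_normK ?num_real// sqrrN.
have pq0 : 0 <= p * q by rewrite mulr_ge0 ?ltW.
rewrite (sqr_sqrtr pq0) -/D.
have zb : z = b + (- p%:C%C) *: d by rewrite /b scaleNr addrK.
have o2 : ip b ((- p%:C%C) *: d) = 0 by rewrite ipZr bd mulr0.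
have := pythagoras o2; rewrite -zb enormZ cabsN cabsR exprMn real_normK ?num_real// -/D => e.
have -> : enorm b ^+ 2 = 1 - ka - p ^+ 2 * D by rewrite /ka e; ring.
have -> : p * q * D = p ^+ 2 * D + ka by rewrite -pD /q; ring.
by apply/eqP; ring.
Qed.

End Reflection.

(** * Polynomiality on complex lines *)

Section CircleRationality.
Context {R : realType}.

Lemma circle_near (s e : R) : 0 < s -> 0 < e ->
  exists t : R[i], [/\ cabs t = s, t != s%:C%C & cabs (t - s%:C%C) < e].
Proof.
move=> s0 e0; pose d := e / (4 * s); have d0 : 0 < d by rewrite divr_gt0 ?mulr_gt0.
pose a : R[i] := (1 +i* d)%C; pose b : R[i] := (1 +i* - d)%C.
have ab : cabs a = cabs b by rewrite /= sqrrN.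
have b1 : 1 <= cabs b by have := Re_le_cabs b; rewrite /= normr1.
have b0 : b != 0 by rewrite -cabs_gt0; lra.
have abE : a - b = (2 * d)%:C%C * 'i%C.
  by apply/eqP; rewrite eq_complex /=; apply/andP; split; apply/eqP; ring.
have e1 : s%:C%C * (a / b) - s%:C%C = s%:C%C * (a - b) / b by field.
have b00 : 0 < cabs b by rewrite cabs_gt0.
exists (s%:C%C * (a / b)); split.
- by rewrite !cabsM cabsV ab divff ?gt_eqF// mulr1 cabsR ger0_norm ?ltW.
- rewrite -subr_eq0 e1 abE !mulf_neq0 ?invr_eq0//.
  + by rewrite fmorph_eq0 gt_eqF.
  + by rewrite fmorph_eq0 mulf_neq0// gt_eqF.
  + by rewrite -cabs_eq0 cabs_i oner_eq0.
- rewrite e1 abE !cabsM cabsV !cabsR cabs_i mulr1 !ger0_norm; [|lra|lra].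
  rewrite ltr_pdivrMr//; apply: (@lt_le_trans _ _ e); last by rewrite ler_peMr// ltW.
  have -> : s * (2 * d) = e / 2 by rewrite /d; field; rewrite gt_eqF.
  lra.
Qed.

(** Linear factors of [P] are removed one at a time: a root [a] of [P] is a root of [Q], and after
    cancelling [t - a] the equation at [a] itself follows by continuity. *)
Lemma poly_quotient (y : R[i] -> R[i]) (P Q : {poly R[i]}) : P != 0 ->
  (forall t, cont y t) -> (forall t, P.[t] * y t = Q.[t]) ->
  exists Q' : {poly R[i]}, forall t, y t = Q'.[t].
Proof.
move=> P0 cy; have [m] := ubnP (size P); elim: m P Q P0 => // m IH P Q P0 Pm PQ.
have [|/closed_rootP[a Pa]] := eqVneq (size P) 1.
  move=> /eqP/size_poly1P[c c0 PE]; exists (c^-1 *: Q) => t.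
  by rewrite hornerZ -PQ PE hornerC mulKf.
have Qa : root Q a by rewrite /root -PQ (eqP Pa) mul0r.
have [P1 P1E] := factor_theorem P a Pa; have [Q1 Q1E] := factor_theorem Q a Qa.
have P10 : P1 != 0 by apply: contraNneq P0 => h; rewrite P1E h mul0r.
apply: (IH P1 Q1) => //.
  by move: Pm; rewrite P1E size_Mmonic ?monicXsubC// size_XsubC addn2.
have off t : t != a -> P1.[t] * y t = Q1.[t].
  move=> ta; have ta0 : t - a != 0 by rewrite subr_eq0.
  apply: (mulfI ta0); have := PQ t; rewrite P1E Q1E !hornerM !hornerXsubC => h.
  by rewrite mulrA ![(t - a) * _]mulrC h.
move=> t; have [->|] := eqVneq t a; last exact: off.
pose k t := P1.[t] * y t - Q1.[t].
have ck : cont k a.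
  apply: contB; first apply: contM.
  - by apply: cdiff_continuous; exact: cdiff_horner.
  - exact: cy.
  - by apply: cdiff_continuous; exact: cdiff_horner.
apply/eqP; rewrite -subr_eq0 -cabs_eq0 eq_le cabs_ge0 andbT.
apply/ler_addgt0Pl => e e0; rewrite addr0.
have /near_cabs[d d0 Hd] := (contP _ _).1 ck _ e0.
have bE : a + (d / 2)%:C%C - a = (d / 2)%:C%C by rewrite addrC addKr.
have ba : a + (d / 2)%:C%C != a.
  by rewrite -subr_eq0 bE fmorph_eq0 gt_eqF// divr_gt0.
have /Hd : cabs (a + (d / 2)%:C%C - a) < d by rewrite bE cabsR ger0_norm; lra.
by rewrite {1}/k (off _ ba) subrr sub0r cabsN => /ltW.
Qed.

Section Fixed.
Context (N : nat) (s : R) (s0 : 0 < s).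
Context (y : R[i] -> 'rV[R[i]]_N) (v : nat -> 'I_N -> {poly R[i]}).

(** Quotients of polynomials by powers of [t], restricted to the circle. They form a ring containing
    the conjugate of [t], which is [s ^ 2 / t] there. *)
Definition on_circle (h : R[i] -> R[i]) := exists (m : nat) (P : {poly R[i]}),
  forall t, cabs t = s -> t ^+ m * h t = P.[t].

Lemma on_circle_poly P : on_circle (fun t => P.[t]).
Proof. by exists 0, P => t _; rewrite expr0 mul1r. Qed.

Lemma on_circle_cst c : on_circle (fun=> c).
Proof. by exists 0, c%:P => t _; rewrite expr0 mul1r hornerC. Qed.

Lemma on_circleD h k : on_circle h -> on_circle k -> on_circle (fun t => h t + k t).
Proof.
move=> [m [P HP]] [m' [P' HP']]; exists (m + m')%N, ('X^m' * P + 'X^m * P') => t ts.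
by rewrite hornerD !hornerM !hornerXn -HP// -HP'// exprD; ring.
Qed.

Lemma on_circleM h k : on_circle h -> on_circle k -> on_circle (fun t => h t * k t).
Proof.
move=> [m [P HP]] [m' [P' HP']]; exists (m + m')%N, (P * P') => t ts.
by rewrite hornerM -HP// -HP'// exprD; ring.
Qed.

Lemma on_circle_ext h k : (forall t, h t = k t) -> on_circle h -> on_circle k.
Proof. by move=> e [m [P HP]]; exists m, P => t /HP; rewrite e. Qed.

Lemma on_circle_sum (I : Type) (r : seq I) (p : pred I) (h : I -> R[i] -> R[i]) :
  (forall i, on_circle (h i)) -> on_circle (fun t => \sum_(i <- r | p i) h i t).
Proof.
move=> H; elim: r => [|i r IH].
  by apply: on_circle_ext (on_circle_cst 0) => t; rewrite big_nil.
have [pi|pi] := boolP (p i); last by apply: on_circle_ext IH => t; rewrite big_cons (negPf pi).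
by apply: on_circle_ext (on_circleD (H i) IH) => t; rewrite big_cons pi.
Qed.

Lemma on_circle_prod (I : Type) (r : seq I) (h : I -> R[i] -> R[i]) :
  (forall i, on_circle (h i)) -> on_circle (fun t => \prod_(i <- r) h i t).
Proof.
move=> H; elim: r => [|i r IH].
  by apply: on_circle_ext (on_circle_cst 1) => t; rewrite big_nil.
by apply: on_circle_ext (on_circleM (H i) IH) => t; rewrite big_cons.
Qed.

Lemma on_circle_conj (P : {poly R[i]}) : on_circle (fun t => P.[t^*%C]).
Proof.
have cj : on_circle (fun t => t^*%C).
  exists 1%N, ((s ^+ 2)%:C%C)%:P => t ts.
  by rewrite expr1 mulcJ ts hornerC.
have : on_circle (fun t => \sum_(i < size P) P`_i * \prod_(j <- iota 0 i) t^*%C).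
  apply: on_circle_sum => i; apply: on_circleM; first exact: on_circle_cst.
  exact: on_circle_prod.
apply: on_circle_ext => t; rewrite horner_coef; apply: eq_bigr => i _.
by rewrite big_const_seq count_predT size_iota iter_mulr_1.
Qed.

Lemma on_circle_conj_conj (P : {poly R[i]}) : on_circle (fun t => (P.[t^*%C])^*%C).
Proof.
apply: on_circle_ext (on_circle_poly (map_poly conjc P)) => t.
by rewrite -{1}[t]conjcK horner_map.
Qed.

Lemma on_circle_det r (M : R[i] -> 'M[R[i]]_r) :
  (forall i j, on_circle (fun t => M t i j)) -> on_circle (fun t => \det (M t)).
Proof.
move=> H; apply: on_circle_sum => p; apply: on_circleM; first exact: on_circle_cst.
by apply: on_circle_prod => i; exact: H.
Qed.

Definition jet k (t : R[i]) : 'rV[R[i]]_N := \row_l (v k l).[t^*%C].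

Definition jets r (ks : 'I_r -> nat) t : 'M[R[i]]_(r, N) := \matrix_(i, l) jet (ks i) t 0 l.

Definition gram r (ks : 'I_r -> nat) t : 'M[R[i]]_r :=
  \matrix_(i, j) ip (jet (ks i) t) (jet (ks j) t).

Lemma gramE r (ks : 'I_r -> nat) t : gram ks t = jets ks t *m (map_mx conjc (jets ks t))^T.
Proof.
by apply/matrixP => i j; rewrite !mxE; apply: eq_bigr => l _; rewrite !mxE.
Qed.

Lemma ip_mulmx (x w : 'rV[R[i]]_N) : x *m (map_mx conjc w)^T = (ip x w)%:M.
Proof.
apply/matrixP => i j; rewrite !ord1 !mxE mulr1n.
by apply: eq_bigr => l _; rewrite !mxE.
Qed.

(** A vector [x] that kills the Gram matrix makes [x *m jets ks t] a vector of norm zero. *)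
Lemma det_gram_neq0 r (ks : 'I_r -> nat) t :
  (\det (gram ks t) != 0) = row_free (jets ks t).
Proof.
rewrite -unitfE -/(\det _ \is a GRing.unit) -unitmxE -row_free_unit.
apply/idP/idP => h; apply/inj_row_free => x hx.
  apply: (row_free_inj h); rewrite mul0mx gramE mulmxA hx mul0mx //.
apply: (row_free_inj h); rewrite mul0mx.
have : x *m gram ks t *m (map_mx conjc x)^T = 0 by rewrite hx mul0mx.
rewrite gramE -!mulmxA -trmx_mul -map_mxM mulmxA ip_mulmx ipzz.
move=> /matrixP/(_ 0 0); rewrite !mxE mulr1n => /eqP.
by rewrite fmorph_eq0 sqrf_eq0 enorm_eq0 => /eqP.
Qed.

Context (dy : forall l t, cdiff (fun t => y t 0 l) t).
Context (ortho : forall k t, cabs t = s -> ip (y t) (jet k t) = (k == 0)%:R).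
Context (expansion : forall t l, cabs t = s ->
  clim (fun m => \sum_(k < m) jet k t 0 l * t ^+ k) (y t 0 l)).

(** The size is maximized over all families and all points of the circle at once. So wherever the
    chosen family is independent, a jet outside its span would produce a larger independent
    family. *)
Lemma max_rank : exists (r : nat) (ks : 'I_r -> nat) (t : R[i]),
  [/\ cabs t = s, \det (gram ks t) != 0 &
      forall t' k, cabs t' = s -> \det (gram ks t') != 0 -> (jet k t' <= jets ks t')%MS].
Proof.
pose Q r := exists (ks : 'I_r -> nat) (t : R[i]), cabs t = s /\ \det (gram ks t) != 0.
have Q0 : exists r, `[< Q r >].
  exists 0; apply/asboolP; exists (fun=> 0), s%:C%C; rewrite cabsR ger0_norm ?ltW//.
  by rewrite det_mx00 oner_neq0.
have Qb r : `[< Q r >] -> (r <= N)%N.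
  move=> /asboolP[ks [t [_]]]; rewrite det_gram_neq0 /row_free => /eqP <-.
  exact: rank_leq_col.
case: (ex_maxnP Q0 Qb) => r /asboolP[ks [t [ts dt]]] rmax.
exists r, ks, t; split => // t' k t's dt'; apply: contraT => nsub.
have : `[< Q r.+1 >].
  apply/asboolP.
  exists (fun i => if unlift ord_max i is Some j then ks j else k), t'; split => //.
  rewrite det_gram_neq0; apply/inj_row_free => x hx.
  have hx' : \sum_(j < r) x 0 (widen_ord (leqnSn r) j) *: jet (ks j) t' +
      x 0 ord_max *: jet k t' = 0.
    apply/rowP => l; rewrite [LHS]mxE summxE [RHS]mxE.
    have := congr1 (fun M : 'rV[R[i]]_N => M 0 l) hx; rewrite /= [LHS]mxE big_ord_recr /= [RHS]mxE => e.
    rewrite -[RHS]e.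
    congr (_ + _); last by rewrite [LHS]mxE [X in _ = _ * X]mxE unlift_none.
    apply: eq_bigr => j _; rewrite [LHS]mxE [X in _ = _ * X]mxE.
    have -> : widen_ord (leqnSn r) j = lift ord_max j.
      by apply: val_inj; rewrite /= /bump leqNgt ltn_ord.
    by rewrite liftK.
  have sumE : \sum_(j < r) x 0 (widen_ord (leqnSn r) j) *: jet (ks j) t' =
      (\row_j x 0 (widen_ord (leqnSn r) j)) *m jets ks t'.
    apply/rowP => l; rewrite !mxE summxE; apply: eq_bigr => j _; by rewrite !mxE.
  have xm : x 0 ord_max = 0.
    apply/eqP; apply: contraNT nsub => xm.
    have : jet k t' = (- (x 0 ord_max)^-1) *: ((\row_j x 0 (widen_ord (leqnSn r) j)) *m jets ks t').
      rewrite -sumE; have /eqP := hx'; rewrite addr_eq0 => /eqP->.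
      by rewrite scalerN scaleNr opprK scalerA mulVf// scale1r.
    by move=> ->; rewrite scalemx_sub// submxMl.
  have x0 : \row_j x 0 (widen_ord (leqnSn r) j) = 0.
    rewrite det_gram_neq0 in dt'; apply: (row_free_inj dt'); rewrite mul0mx -sumE.
    by move: hx'; rewrite xm scale0r addr0.
  apply/rowP => i; rewrite [RHS]mxE; case: (unliftP ord_max i) => [j ->|->]; last exact: xm.
  move/rowP/(_ j): x0; rewrite !mxE => <-; congr (x 0 _).
  by apply: val_inj; rewrite /= /bump leqNgt ltn_ord.
by move=> /rmax; rewrite ltnn.
Qed.

(** The vector [y'] is the element of the span with the prescribed inner products. The difference
    [x] is orthogonal to the span, hence to [y'] and, as [y t] is a limit of combinations of jets,
    to [y t]; thus [ip x x = 0]. The adjugate form keeps the solution polynomial in the Gram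
    entries. *)
Lemma solve_gram r (ks : 'I_r -> nat) t : cabs t = s -> \det (gram ks t) != 0 ->
  (forall k, (jet k t <= jets ks t)%MS) ->
  \det (gram ks t) *: y t =
    (\row_j (ks j == 0)%:R) *m \adj (gram ks t) *m jets ks t.
Proof.
move=> ts dt span.
set G := gram ks t; set e := \row_j _; set A := jets ks t.
have GU : G \in unitmx by rewrite unitmxE unitfE.
pose y' := e *m invmx G *m A.
suff -> : y t = y'.
  by rewrite /y' /invmx GU -scalemxAr -scalemxAl scalerA mulfV// scale1r.
pose x := y t - y'.
have xA : x *m (map_mx conjc A)^T = 0.
  rewrite mulmxBl /y' -!mulmxA -gramE -/G mulVmx// mulmx1.
  apply/rowP => j; rewrite !mxE; apply/eqP; rewrite subr_eq0; apply/eqP.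
  by rewrite -(ortho _ ts) /ip; apply: eq_bigr => l _; rewrite !mxE.
have xsub (w : 'rV[R[i]]_N) : (w <= A)%MS -> ip x w = 0.
  move=> /submxP[c ->]; have : x *m (map_mx conjc (c *m A))^T = 0.
    by rewrite map_mxM trmx_mul mulmxA xA mul0mx.
  by rewrite ip_mulmx => /matrixP/(_ 0 0); rewrite !mxE mulr1n.
have xy' : ip x y' = 0 by apply: xsub; exact: submxMl.
have xy : ip x (y t) = 0.
  have lims : clim (fun m => ip x (\sum_(k < m) t ^+ k *: jet k t)) (ip x (y t)).
    have L l : clim (fun m => (\sum_(k < m) jet k t 0 l * t ^+ k)^*%C) (y t 0 l)^*%C.
      by move=> d /(expansion l ts)[M HM]; exists M => m /HM; rewrite -rmorphB cabs_conj.
    have LS (I : seq 'I_N) : clim (fun m => \sum_(l <- I) x 0 l * (\sum_(k < m) jet k t 0 l * t ^+ k)^*%C)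
        (\sum_(l <- I) x 0 l * (y t 0 l)^*%C).
      elim: I => [|l I IH].
        by apply: clim_ext (clim_cst _) => m; rewrite !big_nil.
      rewrite big_cons; apply: clim_ext (climD (climM (x 0 l) (L l)) IH) => m.
      by rewrite big_cons.
    apply: clim_ext (LS _) => m; apply: eq_bigr => l _; congr (_ * (_)^*%C).
    by rewrite summxE; apply: eq_bigr => k _; rewrite !mxE mulrC.
  apply: (clim_uniq lims); apply: clim_ext (clim_cst 0) => m.
  apply/esym/xsub; apply: summx_sub => k _; apply: scalemx_sub; exact: span.
apply/eqP; rewrite -subr_eq0 -/x -enorm_eq0.
have : ip x x = 0 by rewrite {2}/x ipDr ipNr xy xy' subr0.
by rewrite ipzz => /eqP; rewrite fmorph_eq0 sqrf_eq0.
Qed.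

Lemma polynomial_of_jets : exists P : 'I_N -> {poly R[i]}, forall t l, y t 0 l = (P l).[t].
Proof.
have [r [ks [t0 [t0s d0 span]]]] := max_rank.
pose D t := \det (gram ks t).
pose num l t := ((\row_j (ks j == 0)%:R) *m \adj (gram ks t) *m jets ks t) 0 l.
have og i j : on_circle (fun t => gram ks t i j).
  have : on_circle (fun t => \sum_l (v (ks i) l).[t^*%C] * ((v (ks j) l).[t^*%C])^*%C).
    apply: on_circle_sum => l; apply: on_circleM; first exact: on_circle_conj.
    exact: on_circle_conj_conj.
  by apply: on_circle_ext => t; rewrite !mxE; apply: eq_bigr => l _; rewrite !mxE.
have oD : on_circle D by exact: on_circle_det.
have oadj i j : on_circle (fun t => (\adj (gram ks t)) i j).
  have : on_circle (fun t => (-1) ^+ (j + i) * \det (row' j (col' i (gram ks t)))).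
    apply: on_circleM; first exact: on_circle_cst.
    apply: on_circle_det => a b; apply: on_circle_ext (og _ _) => t; rewrite !mxE; reflexivity.
  by apply: on_circle_ext => t; rewrite [RHS]mxE.
have onum l : on_circle (num l).
  have : on_circle (fun t => \sum_j (\sum_i (ks i == 0)%:R * (\adj (gram ks t)) i j) *
      (v (ks j) l).[t^*%C]).
    apply: on_circle_sum => j; apply: on_circleM; last exact: on_circle_conj.
    by apply: on_circle_sum => i; apply: on_circleM; [exact: on_circle_cst|exact: oadj].
  apply: on_circle_ext => t; rewrite /num mxE; apply: eq_bigr => j _; rewrite !mxE.
  by congr (_ * _); apply: eq_bigr => i _; rewrite [X in _ = X * _]mxE.
(* The extra factor [D t] makes the equation hold on the whole circle, including points where the
   family degenerates and [solve_gram] gives nothing. *)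
have eqD l t : cabs t = s -> D t * D t * y t 0 l = D t * num l t.
  move=> ts; have [->|dt] := eqVneq (D t) 0; first by rewrite !mul0r.
  rewrite -mulrA; congr (_ * _).
  by rewrite /num -(solve_gram ts dt (fun k => span t k ts dt)) mxE.
suff H l : exists P : {poly R[i]}, forall t, y t 0 l = P.[t].
  have [P HP] := choice H; exists P => t l; exact: HP.
have [m [P HP]] := on_circleM oD oD; have [m' [Q HQ]] := on_circleM oD (onum l).
(* Multiplying crosswise by the two powers of [t] turns the equation on the circle into one between
   entire functions, and the identity theorem extends it to all [t]. *)
apply: (@poly_quotient _ ('X^m' * P) ('X^m * Q)).
- apply: contra d0 => /eqP h; have := HP t0 t0s => e.
  have t00 : t0 != 0 by rewrite -cabs_gt0 t0s.
  have : ('X^m' * P).[t0] = 0 by rewrite h horner0.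
  rewrite hornerM hornerXn -e => /eqP; rewrite !mulf_eq0 !expf_eq0 (negPf t00) !andbF /=.
  by rewrite orbb.
- by move=> t; exact: cdiff_continuous.
move=> t; apply/eqP; rewrite -subr_eq0; apply/eqP.
apply: (@identity_entire _ (fun t => ('X^m' * P).[t] * y t 0 l - ('X^m * Q).[t]) s%:C%C).
  move=> u; apply: cdiffB; last exact: cdiff_horner.
  by apply: cdiffM; [exact: cdiff_horner|exact: dy].
move=> e e0; have [u [us u1 ue]] := circle_near s0 e0; exists u; split => //.
rewrite !hornerM !hornerXn -HP// -HQ// -(eqD l u us); ring.
Qed.

End Fixed.
End CircleRationality.

(** * Cauchy estimates and power series of entire functions *)

Section Coefficients.
Context {R : realType}.
Implicit Types (f g : R[i] -> R[i]) (r : R).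

Lemma coef_bound f k r (B : R) : 0 < r -> (forall t, collar r t -> cont f t) ->
  (forall t, collar r t -> cabs (f t) <= B) ->
  cabs (coef f k r) <= cabs (kappa : R[i])^-1 * (8 * (B * r^-1 ^+ k)).
Proof.
move=> r0 cf fB; rewrite cabsM ler_wpM2l ?cabs_ge0//.
have -> : 8 * (B * r^-1 ^+ k) = 8 * r * (B * r^-1 ^+ k.+1).
  by rewrite exprS; field; rewrite gt_eqF.
apply: (contour_bound (ltW r0)) => t ct.
  exact: (contM (cf t ct) (@cont_powV R k.+1 t (collar_neq0 r0 ct))).
have [rt _] := ct.
rewrite cabsM cabsX cabsV ler_pM ?cabs_ge0 ?exprn_ge0 ?invr_ge0 ?cabs_ge0//; first exact: fB.
by rewrite lerXn2r ?nnegrE ?invr_ge0 ?cabs_ge0 ?(ltW r0)// lef_pV2 ?posrE// (lt_le_trans r0).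
Qed.

Lemma coef_entire f k r : 0 < r -> (forall t, cdiff f t) -> coef f k r = coef f k 1.
Proof.
by move=> r0 df; case: (leP r 1) => h; [|apply/esym]; apply: coef_scale => //; exact: ltW.
Qed.

Lemma taylor_coef1 k : coef (fun=> 1) k 1 = (k == 0)%:R :> R[i].
Proof.
have d1 t : cdiff (fun=> 1 : R[i]) t by exact: cdiff_cst.
case: k => [|k].
  rewrite /coef (@contour_ext _ _ (fun t => t^-1) _ ler01) ?mulVf ?kappa_neq0//.
  by move=> t _; rewrite mul1r expr1.
apply/eqP; rewrite -cabs_eq0 eq_le cabs_ge0 andbT; apply/ler_addgt0Pl => e e0; rewrite addr0.
pose c := cabs (kappa : R[i])^-1 * 8; have c0 : 0 <= c by rewrite mulr_ge0 ?cabs_ge0.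
pose r := 1 + c / e; have ce0 : 0 <= c / e by rewrite divr_ge0 // ltW.
have r0 : 0 < r by rewrite /r; lra.
rewrite -(coef_entire k.+1 r0 d1).
have := @coef_bound (fun=> 1) k.+1 r 1 r0 => H.
apply: le_trans (H _ _) _; [by move=> t _; exact: cont_cst|by move=> t _; rewrite cabs1|].
rewrite mul1r mulrA -/c exprS.
have r1 : r^-1 ^+ k <= 1.
  by rewrite exprn_ile1 ?invr_ge0 ?(ltW r0)// invf_le1// /r; lra.
apply: (@le_trans _ _ (c * r^-1)).
  by rewrite ler_wpM2l// ler_piMr ?invr_ge0 ?(ltW r0).
rewrite ler_pdivrMr// /r mulrDr mulr1 mulrC divfK ?gt_eqF//; lra.
Qed.

Lemma taylor_coefZ c f k r : 0 < r -> (forall t, collar r t -> cont f t) ->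
  coef (fun t => c * f t) k r = c * coef f k r.
Proof.
move=> r0 cf; rewrite /coef [RHS]mulrCA; congr (_ * _).
rewrite -(@contourZ _ c (fun t => f t * t^-1 ^+ k.+1) _ (ltW r0)).
  by apply: (contour_ext (ltW r0)) => t _; rewrite mulrA.
move=> t ct; exact: (contM (cf t ct) (@cont_powV R k.+1 t (collar_neq0 r0 ct))).
Qed.

Lemma taylor_coef_sum (I : Type) (s : seq I) (F : I -> R[i] -> R[i]) k r : 0 < r ->
  (forall i t, collar r t -> cont (F i) t) ->
  coef (fun t => \sum_(i <- s) F i t) k r = \sum_(i <- s) coef (F i) k r.
Proof.
move=> r0 cF; rewrite /coef -mulr_sumr; congr (_ * _).
have c i t : collar r t -> cont (fun t => F i t * t^-1 ^+ k.+1) t.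
  by move=> ct; exact: (contM (cF i t ct) (@cont_powV R k.+1 t (collar_neq0 r0 ct))).
rewrite -(contour_sum s (ltW r0) c).2.
by apply: (contour_ext (ltW r0)) => t _; rewrite mulr_suml.
Qed.

Lemma entire_series f x : (forall t, cdiff f t) ->
  clim (fun m => \sum_(i < m) coef f i 1 * x ^+ i) (f x).
Proof.
move=> df e e0; have x0 := cabs_ge0 x.
pose r := 1 + 2 * cabs x.
have r0 : 0 < r by rewrite /r; lra.
have xr : cabs x < r by rewrite /r; lra.
have cf t : collar r t -> cont f t by move=> _; exact: cdiff_continuous.
have [B B0 fB] := collar_bounded cf (ltW r0).
pose c := cabs (kappa : R[i])^-1 * (8 * r * (B * (r - cabs x)^-1)).
have [M HM] := half_pow_lt c e0; exists M => m Mm.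
have -> : \sum_(i < m) coef f i 1 * x ^+ i = \sum_(i < m) coef f i r * x ^+ i.
  by apply: eq_bigr => i _; rewrite (coef_entire _ r0 df).
rewrite (@taylor _ f m r x xr (fun t _ => df t)) opprD addrA subrr sub0r cabsN cabsM cabsX.
apply: le_trans (ler_wpM2l (exprn_ge0 _ x0) (taylor_rem_bound m xr cf fB)) _.
have c0 : 0 <= c.
  by rewrite /c !mulr_ge0 ?cabs_ge0 ?invr_ge0 ?subr_ge0 ?(ltW r0) ?(ltW B0) ?(ltW xr).
have -> : cabs x ^+ m * (cabs (kappa : R[i])^-1 * (8 * r * (B * r^-1 ^+ m * (r - cabs x)^-1))) =
   c * (cabs x / r) ^+ m by rewrite /c exprMn; ring.
apply: le_trans (ltW HM); rewrite -exprVn ler_wpM2l//.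
have h : cabs x / r <= 2^-1 by rewrite ler_pdivrMr// /r; lra.
apply: (@le_trans _ _ (2^-1 ^+ m)).
  by rewrite lerXn2r ?nnegrE ?divr_ge0 ?invr_ge0 ?(ltW r0).
by apply: ler_wiXn2l; rewrite ?invr_ge0// invf_le1// ler1n.
Qed.

End Coefficients.

(** * The Gram argument on a line orthogonal to [z0] *)

Section Lines.
Context {R : realType} {n N : nat}.
Context (f F : 'rV[R[i]]_n -> 'rV[R[i]]_N).
Context (hf : forall l, ext_holo (fun z => f z 0 l)).
Context (hF : forall l, line_holo (fun z => F z 0 l)).
Context (fF : forall z, 1 < enorm z -> F z = f z).
Context (F1 : forall z, enorm z = 1 -> enorm (F z) = 1).
Context (e z0 : 'rV[R[i]]_n).
Context (e1 : enorm e = 1) (z0e : ip z0 e = 0) (z0_gt0 : 0 < enorm z0) (z0_lt1 : enorm z0 < 1).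

Let om : 'rV[R[i]]_n := (enorm z0 ^- 2)%:C%C *: z0.
(** Here [la] stands for the conjugate of [t]. Making it an independent variable lets the Taylor
    coefficients in [ta] be studied as holomorphic functions of [la]. *)
Let w (la ta : R[i]) : 'rV[R[i]]_n := om + ta *: (e - la *: om).

Lemma om_gt1 : 1 < enorm om.
Proof.
rewrite /om enormZ cabsR ger0_norm ?invr_ge0 ?sqr_ge0//.
rewrite expr2 invfM -mulrA mulVf ?gt_eqF// mulr1 invf_gt1//.
Qed.

Lemma ext_cont_F l z : 1 < enorm z -> cont (fun z => F z 0 l) z.
Proof.
move=> z1; have c := (hf l).1 z z1; apply/contP => d d0.
have /near_enorm[r r0 Hr] := (contP _ _).1 c d d0.
apply/near_enorm; exists (Num.min r (enorm z - 1)) => [|x]; first by rewrite lt_min r0 subr_gt0.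
rewrite lt_min => /andP[xr xz]; rewrite !fF//; first exact: Hr.
by have := enorm_tri z x 0; rewrite !subr0 (enormB z x); lra.
Qed.

Lemma w_near la ta : enorm (w la ta - om) <= cabs ta * (1 + cabs la * enorm om).
Proof.
rewrite /w addrC addKr enormZ ler_wpM2l ?cabs_ge0//.
by apply: le_trans (enormD _ _) _; rewrite e1 enormN enormZ.
Qed.

Lemma w_line2E la ta : w la ta = (om + ta *: e) + la *: (- ta *: om).
Proof. by apply/rowP => j; rewrite !mxE; ring. Qed.

Lemma cont_w l la ta : 1 < enorm (w la ta) ->
  cont (fun lt : R[i] * R[i] => F (w lt.1 lt.2) 0 l) (la, ta).
Proof.
move=> w1.
have wE (lt : R[i] * R[i]) : w lt.1 lt.2 = om + lt.2 *: e + (- (lt.1 * lt.2)) *: om.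
  by apply/rowP => j; rewrite !mxE; ring.
have c : {for (la, ta), continuous (fun lt : R[i] * R[i] => w lt.1 lt.2)}.
  have -> : (fun lt : R[i] * R[i] => w lt.1 lt.2) =
      (fun st : R[i] * R[i] => om + st.1 *: e + st.2 *: om) \o
      (fun lt => (lt.2, - (lt.1 * lt.2))) by apply/funext => lt /=; rewrite wE.
  apply: continuous_comp; last exact: continuous_affine2.
  have c1 : cont (fun lt : R[i] * R[i] => lt.1) (la, ta) by exact: cvg_fst.
  have c2 : cont (fun lt : R[i] * R[i] => lt.2) (la, ta) by exact: cvg_snd.
  apply: (@cvg_pair _ _ _ (nbhs (la, ta)) (nbhs ta) (nbhs (- (la * ta)))); first exact: cvg_snd.
  exact: (contN (contM c1 c2)).
exact: (@cont_comp _ _ _ (fun lt : R[i] * R[i] => w lt.1 lt.2) (fun z => F z 0 l) (la, ta) c (@ext_cont_F l _ w1)).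
Qed.

Let c k l la := coef (fun ta => F (w la ta) 0 l) k 1.

Lemma dF_ta l la ta : cdiff (fun ta => F (w la ta) 0 l) ta.
Proof. exact: hF. Qed.

(** The coefficient is computed on a contour so small that [w la ta] stays near [om], in the
    exterior. There [F] agrees with [f] and is continuous, as differentiation under the integral
    requires. *)
Lemma jet_entire k l la0 : cdiff (c k l) la0.
Proof.
have om1 := om_gt1; have la00 := cabs_ge0 la0.
pose M := 1 + (cabs la0 + 1) * enorm om.
have M0 : 0 < M by rewrite /M ltr_wpDr// mulr_ge0 ?enorm_ge0 ?addr_ge0.
pose rho := (enorm om - 1) / (2 * M).
have rho0 : 0 < rho by rewrite divr_gt0 ?subr_gt0// mulr_gt0.
have near1 la ta : cabs (la - la0) < 1 -> cabs ta < 2 * rho -> 1 < enorm (w la ta).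
  move=> h1 h2.
  have h3 : 1 + cabs la * enorm om <= M.
    rewrite /M lerD2l ler_wpM2r ?enorm_ge0//.
    by have := cabs_tri la la0 0; rewrite !subr0; lra.
  have h4 : cabs ta * (1 + cabs la * enorm om) < enorm om - 1.
    have -> : enorm om - 1 = 2 * rho * M by rewrite /rho; field; rewrite gt_eqF.
    apply: (@le_lt_trans _ _ (cabs ta * M)); first by rewrite ler_wpM2l ?cabs_ge0.
    by rewrite ltr_pM2r.
  have := enorm_tri om (w la ta) 0; rewrite !subr0 (enormB om).
  have := w_near la ta; lra.
have H : cdiff (fun la => coef (fun ta => F (w la ta) 0 l) k rho) la0.
  apply: cdiffZ.
  apply: (@contour_cdiff _ (fun la ta => F (w la ta) 0 l * ta^-1 ^+ k.+1)
    [set ta | ta != 0 /\ cabs ta < 2 * rho] la0 1) => //; first exact: ltW.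
  - move=> t ct; have t0 := collar_neq0 rho0 ct; have [h1 h2] := ct.
    apply/near_cabs; exists (rho / 2) => [|x xt]; first by rewrite divr_gt0.
    split; last by have := cabs_tri x t 0; rewrite !subr0; lra.
    by rewrite -cabs_gt0; have := cabs_tri t x 0; rewrite !subr0 (cabsB t x); lra.
  - move=> la ta h1 [t0 h2]; apply: (contM (@cont_w l _ _ (near1 _ _ h1 h2))).
    apply: (@cont_comp _ _ _ (fun st : R[i] * R[i] => st.2) (fun t => t^-1 ^+ k.+1)).
      exact: cvg_snd.
    exact: (@cont_powV R k.+1 ta t0).
  - move=> la ta _ _; apply: cdiffM; last exact: cdiff_cst.
    by under eq_fun do rewrite w_line2E; exact: hF.
apply: cdiff_near H; apply/near_cabs; exists 1 => // la _.
by rewrite /c (coef_entire _ rho0)// => t; exact: dF_ta.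
Qed.

(** On a contour of size [q / cabs la] the point [w la ta] stays within [d] of [om] whatever [la]
    is. Cauchy's estimate there costs the [k]-th power of the inverse size, that is of [cabs la]. *)
Lemma jet_growth k l : exists B : R, forall la, 1 <= cabs la -> cabs (c k l la) <= B * cabs la ^+ k.
Proof.
have om1 := om_gt1.
have /near_enorm[d d0 Hd] := (contP _ _).1 (@ext_cont_F l _ om1) 1 ltr01.
pose M := 1 + enorm om; have M0 : 0 < M by rewrite /M; lra.
pose q := d / (2 * M); have q0 : 0 < q by rewrite divr_gt0// mulr_gt0.
pose B := cabs (F om 0 l) + 1.
exists (cabs (kappa : R[i])^-1 * (8 * (B * q^-1 ^+ k))) => la la1.
have la0 : 0 < cabs la by lra.
pose r := q / cabs la; have r0 : 0 < r by rewrite divr_gt0.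
rewrite /c -(coef_entire k r0 (fun t => dF_ta l la t)).
apply: le_trans (@coef_bound _ _ k r B r0 _ _) _.
- by move=> t _; apply: cdiff_continuous; exact: dF_ta.
- move=> t [_ tr]; have h1 : enorm (w la t - om) < d.
    apply: le_lt_trans (w_near la t) _.
    have h2 : 1 + cabs la * enorm om <= cabs la * M by rewrite /M; lra.
    apply: (@le_lt_trans _ _ (3 / 2 * r * (cabs la * M))).
      apply: ler_pM => //; first exact: cabs_ge0.
      by rewrite addr_ge0// mulr_ge0 ?enorm_ge0// ltW.
    have -> : 3 / 2 * r * (cabs la * M) = 3 / 4 * d.
      by rewrite /r /q; field; rewrite !gt_eqF.
    lra.
  have := Hd _ h1; have := cabs_tri (F (w la t) 0 l) (F om 0 l) 0; rewrite !subr0 /B; lra.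
- have -> : r^-1 ^+ k = q^-1 ^+ k * cabs la ^+ k by rewrite /r invf_div mulrC exprMn.
  by rewrite le_eqVlt; apply/orP; left; apply/eqP; ring.
Qed.

Lemma jet_poly k l : exists P : {poly R[i]}, forall la, c k l la = P.[la].
Proof.
have [B HB] := jet_growth k l.
by have [P _ HP] := liouville_poly (jet_entire k l) HB; exists P.
Qed.

Lemma ip_w t ta : ip (z0 + t *: e) (w t^*%C ta) = 1.
Proof.
have ez : ip e z0 = 0 by rewrite -ip_conj z0e rmorph0.
have z2 : enorm z0 ^+ 2 != 0 by rewrite expf_neq0// gt_eqF.
have zom : ip z0 om = 1.
  by rewrite /om ipZr conjc_real ipzz -rmorphM mulVf.
have eom : ip e om = 0 by rewrite /om ipZr ez mulr0.
rewrite /w; move: (om) zom eom => o zo eo.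
rewrite ipDl ipZl !ipDr !ipZr !ipDr !ipNr !ipZr z0e zo eo ipzz e1 expr1n conjcK.
by rewrite rmorph1; ring.
Qed.

(** For [cabs t < s], polarization along [ta |-> w t^*%C ta] is a constant function of [ta];
    comparing its Taylor coefficients gives the inner products with the jets. *)
Lemma polynomial_on_line : exists P : 'I_N -> {poly R[i]},
  forall t l, F (z0 + t *: e) 0 l = (P l).[t].
Proof.
have /choice[v Hv] : forall k, exists Pk : 'I_N -> {poly R[i]}, forall l la, c k l la = (Pk l).[la].
  by move=> k; have /choice[P HP] := jet_poly k; exists P.
pose s := Num.sqrt (1 - enorm z0 ^+ 2).
have s2 : 0 < 1 - enorm z0 ^+ 2 by rewrite subr_gt0 expr_lt1// ltW.
have s0 : 0 < s by rewrite sqrtr_gt0.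
have sE : s ^+ 2 = 1 - enorm z0 ^+ 2 by rewrite sqr_sqrtr// ltW.
have jE k t l : jet v k t 0 l = c k l t^*%C by rewrite mxE Hv.
have zte t : ip z0 (t *: e) = 0 by rewrite ipZr z0e mulr0.
have inner k t : cabs t < s -> ip (F (z0 + t *: e)) (jet v k t) = (k == 0)%:R.
  move=> ts; have zt1 : enorm (z0 + t *: e) < 1.
    rewrite -(@ltr_pXn2r _ 2) ?nnegrE ?enorm_ge0// expr1n (pythagoras (zte t)) enormZ e1 mulr1.
    have : cabs t ^+ 2 < s ^+ 2 by rewrite ltr_pXn2r ?nnegrE ?cabs_ge0 ?(ltW s0).
    by rewrite sE; lra.
  have H ta : \sum_l (F (z0 + t *: e) 0 l)^*%C * F (w t^*%C ta) 0 l = 1.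
    have := polarization hF F1 zt1 (ip_w t ta) => /(congr1 conjc).
    rewrite ip_conj rmorph1 => <-; apply: eq_bigr => l _; exact: mulrC.
  have E : \sum_l (F (z0 + t *: e) 0 l)^*%C * c k l t^*%C = (k == 0)%:R.
    rewrite -taylor_coef1 -(_ : (fun ta => \sum_l (F (z0 + t *: e) 0 l)^*%C * F (w t^*%C ta) 0 l) = fun=> 1);
      last by apply/funext.
    have cl l t' : cont (fun ta => F (w t^*%C ta) 0 l) t'.
      by apply: cdiff_continuous; exact: dF_ta.
    rewrite taylor_coef_sum//; last by move=> l t' _; exact: (contM (@cont_cst R _ _ t') (cl l t')).
    by apply: eq_bigr => l _; rewrite taylor_coefZ.
  rewrite -ip_conj -[RHS]conjc_nat -E; congr conjc; apply: eq_bigr => l _.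
  by rewrite jE mulrC.
apply: (@polynomial_of_jets _ _ s s0 (fun t => F (z0 + t *: e)) v).
- by move=> l t; exact: hF.
(* [polarization] requires a point strictly inside the ball, so the circle is reached as a radial
   limit. *)
- move=> k t ts; pose h t := ip (F (z0 + t *: e)) (jet v k t) - (k == 0)%:R.
  suff : h t = 0 by move=> /eqP; rewrite subr_eq0 => /eqP.
  have ch : cont h t.
    apply: contB; last exact: cont_cst.
    have cl l : cont (fun t : R[i] => F (z0 + t *: e) 0 l * (jet v k t 0 l)^*%C) t.
      apply: contM; first by apply: cdiff_continuous; exact: hF.
      apply: (@cont_comp _ _ _ (fun t => jet v k t 0 l) conjc); last exact: cont_conj.
      have : cont (fun t : R[i] => (v k l).[t^*%C]) t.
        apply: (@cont_comp _ _ _ conjc (fun t => (v k l).[t])); first exact: cont_conj.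
        by apply: cdiff_continuous; exact: cdiff_horner.
      by apply: cont_ext => t'; rewrite mxE.
    have : forall I : seq 'I_N, cont (fun t : R[i] => \sum_(l <- I) F (z0 + t *: e) 0 l * (jet v k t 0 l)^*%C) t.
      elim=> [|l I IH].
        by apply: (@cont_ext _ _ (fun=> 0)) (@cont_cst _ _ _ _) => t'; rewrite big_nil.
      by apply: cont_ext (contD (cl l) IH) => t'; rewrite big_cons.
    exact.
  apply/eqP; rewrite -cabs_eq0 eq_le cabs_ge0 andbT; apply/ler_addgt0Pl => d d0; rewrite addr0.
  have /near_cabs[r r0 Hr] := (contP _ _).1 ch _ d0.
  pose q := Num.min (1 / 2) (r / (2 * s)).
  have q0 : 0 < q by rewrite lt_min !divr_gt0// mulr_gt0.
  have q1 : q <= 1 / 2 by rewrite ge_min lexx.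
  have q2 : q * s <= r / 2.
    have : q <= r / (2 * s) by rewrite ge_min lexx orbT.
    rewrite -(ler_pM2r s0); have -> : r / (2 * s) * s = r / 2 by field; rewrite gt_eqF.
    exact.
  have : h ((1 - q)%:C%C * t) = 0.
    have tq : cabs ((1 - q)%:C%C * t) < s.
      rewrite cabsM ts cabsR ger0_norm; last by lra.
      by rewrite gtr_pMl//; lra.
    by rewrite /h (inner _ _ tq) subrr.
  have /Hr : cabs ((1 - q)%:C%C * t - t) < r.
    have -> : (1 - q)%:C%C * t - t = - (q%:C%C * t) by rewrite rmorphB rmorph1; ring.
    by rewrite cabsN cabsM cabsR ger0_norm ?(ltW q0)// ts; lra.
  by move=> + h0; rewrite h0 sub0r cabsN => /ltW.
- move=> t l ts.
  (* At [ta = t] the line from [om] comes back to the point itself: on the circle |t|^2 = 1 -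
     ||z0||^2, and subtracting that multiple of [om] from [om] leaves [z0]. *)
  have -> : z0 + t *: e = w t^*%C t.
    have z2 : enorm z0 ^+ 2 != 0 by rewrite expf_neq0// gt_eqF.
    have : om - (t * t^*%C) *: om = z0.
      rewrite mulcJ ts sE -[X in X - _]scale1r -scalerBl /om scalerA.
      have -> : 1 - (1 - enorm z0 ^+ 2)%:C%C = (enorm z0 ^+ 2)%:C%C :> R[i].
        by rewrite rmorphB rmorph1 opprB addrC subrK.
      by rewrite -rmorphM divff// scale1r.
    by move=> {1}<-; apply/rowP => j; rewrite !mxE; ring.
  apply: clim_ext (@entire_series _ (fun ta => F (w t^*%C ta) 0 l) t (fun x => dF_ta l _ x)) => m.
  by apply: eq_bigr => k _; rewrite jE.
Qed.

End Lines.

(** * From lines to the whole space *)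

(** Baire's theorem is applied in a complete real row space, to which [of_real] and [to_real]
    transport C^n. *)
HB.instance Definition _ (R : realType) (n : nat) := Complete.on 'rV[R]_n.

Section Degree.
Context {R : realType}.

Lemma horner_bound (Q : {poly R[i]}) : exists2 B : R, 0 <= B &
  forall t, 1 <= cabs t -> cabs Q.[t] <= B * cabs t ^+ size Q.
Proof.
exists (\sum_(i < size Q) cabs Q`_i) => [|t t1].
  by apply: sumr_ge0 => i _; exact: cabs_ge0.
have norm_sum (I : Type) (r : seq I) (h : I -> R[i]) : cabs (\sum_(i <- r) h i) <= \sum_(i <- r) cabs (h i).
  elim: r => [|i r IH]; first by rewrite !big_nil cabs0.
  by rewrite !big_cons; apply: le_trans (cabsD _ _) _; rewrite lerD2l.
rewrite horner_coef; apply: le_trans (norm_sum _ _ _) _.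
rewrite mulr_suml; apply: ler_sum => i _; rewrite cabsM cabsX ler_wpM2l ?cabs_ge0//.
by apply: ler_weXn2l => //; exact: ltnW.
Qed.

Lemma coef_horner_eq0 (Q : {poly R[i]}) k : (size Q < k)%N -> coef (fun t => Q.[t]) k 1 = 0.
Proof.
move=> Qk; have [B B0 HB] := horner_bound Q.
have dQ t : cdiff (fun t => Q.[t]) t by exact: cdiff_horner.
apply/eqP; rewrite -cabs_eq0 eq_le cabs_ge0 andbT; apply/ler_addgt0Pl => e e0; rewrite addr0.
pose m := size Q.
pose c := cabs (kappa : R[i])^-1 * 8 * (B * (3 / 2) ^+ m).
have c0 : 0 <= c.
  by rewrite /c !mulr_ge0 ?cabs_ge0 ?exprn_ge0// divr_ge0.
pose r := 1 + c / e; have ce0 : 0 <= c / e by rewrite divr_ge0// ltW.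
have r0 : 0 < r by rewrite /r; lra.
rewrite -(coef_entire k r0 dQ).
apply: le_trans (@coef_bound _ _ k r (B * (3 / 2 * r) ^+ m) r0 _ _) _.
- by move=> t _; exact: cdiff_continuous.
- move=> t [t1 t2]; apply: le_trans (HB t _) _; first by move: t1; rewrite /r; lra.
  by rewrite ler_wpM2l// lerXn2r// nnegrE ?cabs_ge0// mulr_ge0 ?divr_ge0// ltW.
have -> : cabs (kappa : R[i])^-1 * (8 * (B * (3 / 2 * r) ^+ m * r^-1 ^+ k)) = c * (r ^+ m * r^-1 ^+ k).
  by rewrite /c exprMn; ring.
have -> : r ^+ m * r^-1 ^+ k = r^-1 ^+ (k - m).
  by rewrite -(subnKC (ltnW Qk)) exprD mulrA -exprMn divff ?gt_eqF// expr1n mul1r -/m addKn.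
have : (0 < k - m)%N by rewrite subn_gt0.
case: (k - m)%N => // j _; rewrite exprS.
have r1 : r^-1 ^+ j <= 1.
  by rewrite exprn_ile1 ?invr_ge0 ?(ltW r0)// invf_le1// /r; lra.
apply: (@le_trans _ _ (c * r^-1)).
  by rewrite ler_wpM2l// ler_piMr ?invr_ge0 ?(ltW r0).
rewrite ler_pdivrMr// /r mulrDr mulr1 mulrC divfK ?gt_eqF//; lra.
Qed.

Lemma horner_of_coef (g : R[i] -> R[i]) d : (forall t, cdiff g t) ->
  (forall k, (d < k)%N -> coef g k 1 = 0) ->
  exists2 Q : {poly R[i]}, (size Q <= d.+1)%N & forall t, g t = Q.[t].
Proof.
move=> dg c0; exists (\poly_(i < d.+1) coef g i 1) => [|t]; first exact: size_poly.
rewrite horner_poly; apply: (clim_uniq (entire_series t dg)) => e e0.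
exists d.+1 => m dm; rewrite (_ : \sum_(i < m) _ = \sum_(i < d.+1) coef g i 1 * t ^+ i).
  by rewrite subrr cabs0 ltW.
rewrite -(big_mkord xpredT (fun i => coef g i 1 * t ^+ i)) (big_cat_nat (n := d.+1))//=.
have -> : \sum_(d.+1 <= i < m) coef g i 1 * t ^+ i = 0.
  by rewrite big_nat_cond big1// => i /andP[/andP[di _] _]; rewrite c0 ?mul0r.
by rewrite addr0 big_mkord.
Qed.

Definition of_real n (x : 'rV[R]_(n + n)) : 'rV[R[i]]_n :=
  \row_j (x 0 (lshift n j) +i* x 0 (rshift n j))%C.

Definition to_real n (z : 'rV[R[i]]_n) : 'rV[R]_(n + n) :=
  row_mx (\row_j Re (z 0 j)) (\row_j Im (z 0 j)).

Lemma to_realK n (z : 'rV[R[i]]_n) : of_real (to_real z) = z.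
Proof.
apply/rowP => j; rewrite mxE row_mxEl row_mxEr !mxE.
by case: (z 0 j).
Qed.

Lemma of_real_continuous n : continuous (@of_real n).
Proof.
move=> x P /near_enorm[d d0 HP].
have n0 : 0 < n%:R + 1 :> R by have : 0 <= n%:R :> R by []; lra.
pose e := d / (2 * (n%:R + 1)); have e0 : 0 < e by rewrite divr_gt0 ?mulr_gt0.
apply/nbhs_ballP; exists e => //= y [_ xy]; apply: HP.
have e20 : 0 < 2 * e by rewrite mulr_gt0.
apply: le_lt_trans (enorm_lt e20 _) _ => [j|].
  rewrite !mxE; apply: le_lt_trans (cabs_le_ReIm _) _ => /=.
  have := xy 0 (lshift n j); have := xy 0 (rshift n j).
  by rewrite /ball /= (distrC (y 0 (lshift n j))) (distrC (y 0 (rshift n j))); lra.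
have -> : d = (n%:R + 1) * (2 * e) by rewrite /e; field; rewrite gt_eqF.
by rewrite ltr_pM2r//; lra.
Qed.

Lemma to_real_near n (z : 'rV[R[i]]_n) (P : set 'rV[R]_(n + n)) :
  (\forall x \near to_real z, P x) -> \forall w \near z, P (to_real w).
Proof.
move=> /nbhs_ballP[e /= e0 HP]; apply/near_enorm; exists e => // w wz; apply: HP.
split=> // i j; rewrite ord1 /ball /=.
have H l : cabs (z 0 l - w 0 l) < e.
  by have := cabs_le_enorm (z - w) l; rewrite enormB !mxE; lra.
case: (split_ordP j) => l ->; rewrite ?row_mxEl ?row_mxEr !mxE.
  by apply: le_lt_trans (H l); rewrite -ReB Re_le_cabs.
by apply: le_lt_trans (H l); rewrite -ImB Im_le_cabs.
Qed.

(* Baire's theorem turns the pointwise vanishing order into a uniform one. *)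
Lemma uniform_vanishing n (A : nat -> 'rV[R[i]]_n -> R[i]) (O : set 'rV[R[i]]_n) :
  (forall k z, cont (A k) z) -> (forall k, line_holo (A k)) ->
  open O -> O !=set0 ->
  (forall z, O z -> exists d, forall k, (d < k)%N -> A k z = 0) ->
  exists d, forall k z, (d < k)%N -> A k z = 0.
Proof.
move=> cA hA oO [z0 Oz0] HO.
(* If every open set [G d] were dense, Baire would give a point of [O] with nonzero values [A k] for
   arbitrarily large [k], against [HO]. So some [G d] misses an open set [W]. *)
pose G d := [set x | exists2 k, (d < k)%N & A k (@of_real n x) != 0].
have oG d : open (G d).
  rewrite openE => x [k dk Ak]; rewrite /interior.
  have H := @of_real_continuous n x _ (near_neq0 (cA k _) Ak).
  by near=> y; exists k => //; near: y; exact: H.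
have [d nd] : exists d, ~ dense (G d).
  apply: contrapT => /forallNP H.
  have := @Baire R 'rV[R]_(n + n) G (fun d => conj (oG d) (contrapT (H d))).
  move=> /(_ (@of_real n @^-1` O)) [||x [Ox /= Gx]].
  - by exists (to_real z0); rewrite /= to_realK.
  - by move/continuousP: (@of_real_continuous n); exact.
  - have [d Hd] := HO _ Ox; have [k dk] := Gx d Logic.I.
    by rewrite Hd// eqxx.
exists d => k z dk.
have [W [[x Wx] oW WG]] : exists W : set 'rV[R]_(n + n), [/\ W !=set0, open W & forall x, W x -> ~ G d x].
  apply: contrapT => H; apply: nd => W W0 oW; apply: contrapT => nWG; apply: H.
  by exists W; split=> // x Wx Gx; apply: nWG; exists x.
have xE : x = to_real (of_real x).
  apply/rowP => j; case: (split_ordP j) => l ->; by rewrite ?row_mxEl ?row_mxEr !mxE.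
pose z1 := of_real x.
have near0 : \forall w \near z1, A k w = 0.
  have : \forall y \near to_real z1, W y by rewrite -xE; exact: open_nbhs_nbhs.
  move=> /to_real_near; apply: filterS => w /WG nG; apply/eqP; apply: contrapT => /negP Aw.
  by apply: nG; exists k => //; rewrite to_realK.
have /near_enorm[r r0 Hr] := near0.
pose u := z - z1.
(* Vanishing near [z1] spreads to the arbitrary point [z] along the complex line joining them. *)
have : forall s, A k (z1 + s *: u) = 0.
  apply: (@identity_entire _ (fun s => A k (z1 + s *: u)) 0); first by move=> t; exact: hA.
  move=> e e0; pose q := Num.min (e / 2) (r / (2 * (enorm u + 1))).
  have u0 := enorm_ge0 u; have u1 : 0 < 2 * (enorm u + 1) by lra.
  have q0 : 0 < q by rewrite lt_min !divr_gt0.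
  exists q%:C%C; rewrite subr0 cabsR ger0_norm ?(ltW q0)//; split.
  - by rewrite fmorph_eq0 gt_eqF.
  - have : q <= e / 2 by rewrite ge_min lexx.
    lra.
  - apply: Hr; rewrite addrC addKr enormZ cabsR ger0_norm ?(ltW q0)//.
    have h : q <= r / (2 * (enorm u + 1)) by rewrite ge_min lexx orbT.
    apply: le_lt_trans (ler_wpM2r u0 h) _.
    by rewrite mulrAC ltr_pdivrMr// ltr_pM2l//; lra.
by move/(_ 1); rewrite scale1r /u addrC subrK.
Unshelve. all: by end_near. Qed.

Lemma lagrange (Q : {poly R[i]}) D t : (size Q <= D.+1)%N ->
  Q.[t] = \sum_(a < D.+1) Q.[a%:R] *
    \prod_(b < D.+1 | b != a) ((a%:R - b%:R)^-1 * (t - b%:R)).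
Proof.
move=> QD.
pose L (a : 'I_D.+1) : {poly R[i]} := \prod_(b < D.+1 | b != a) ((a%:R - b%:R)^-1 *: ('X - (b%:R)%:P)).
have ne (a b : 'I_D.+1) : b != a -> a%:R - b%:R != 0 :> R[i].
  by move=> ba; rewrite subr_eq0 eqr_nat eq_sym.
have LE a x : (L a).[x] = \prod_(b < D.+1 | b != a) ((a%:R - b%:R)^-1 * (x - b%:R)).
  by rewrite horner_prod; apply: eq_bigr => b _; rewrite hornerZ hornerXsubC.
have Ls a : (size (L a) <= D.+1)%N.
  apply: leq_trans (size_prod_leq _ _) _.
  rewrite (eq_bigr (fun=> 2)) => [|b ba]; last first.
    by rewrite size_scale ?invr_eq0 ?ne// size_XsubC.
  by rewrite sum_nat_const cardC1 card_ord /= muln2 -addnn -addSn addnK.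
have La a (c : 'I_D.+1) : (L a).[c%:R] = (c == a)%:R.
  rewrite LE; have [->|ca] := eqVneq c a.
    by rewrite big1// => b ba; rewrite mulVf// ne.
  by rewrite (bigD1 c)//= subrr mulr0 mul0r.
have Q0 : Q - \sum_(a < D.+1) Q.[a%:R] *: L a = 0.
  apply: (@roots_geq_poly_eq0 _ _ [seq (val i)%:R | i : 'I_D.+1]).
  - apply/allP => x /mapP[c _ ->]; rewrite /root !hornerE horner_sum (bigD1 c)//= big1 => [|a ac].
      by rewrite hornerZ La eqxx mulr1 addr0 subrr.
    by rewrite hornerZ La eq_sym (negPf ac) mulr0.
  - rewrite map_inj_uniq ?enum_uniq//.
    by move=> a b /eqP; rewrite eqr_nat => /eqP/val_inj.
  - rewrite size_map size_enum_ord; apply: leq_trans (size_polyD _ _) _.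
    rewrite size_polyN geq_max QD /=; apply: leq_trans (size_sum _ _ _) _.
    by apply/bigmax_leqP => a _; apply: leq_trans (size_scale_leq _ _) _; exact: Ls.
move/eqP: Q0; rewrite subr_eq0 => /eqP QE.
by rewrite [in LHS]QE horner_sum; apply: eq_bigr => a _; rewrite hornerZ LE.
Qed.

(** Induction on the number [m] of free variables, the others being frozen at [b]. The next variable
    is freed by interpolation at 0, ..., [D], where the values at the nodes are polynomials by
    induction. A common [D] for all [z] makes one set of nodes serve everywhere. *)
Lemma separately_polynomial n (G : 'rV[R[i]]_n -> R[i]) D :
  (forall (j : 'I_n) z, exists2 Q : {poly R[i]}, (size Q <= D.+1)%N &
    forall t, G (z + t *: delta_mx 0 j) = Q.[t]) ->
  exists P : mpoly n R[i], forall z, G z = meval (fun k => z 0 k) P.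
Proof.
move=> H.
pose mix m (z b : 'rV[R[i]]_n) : 'rV[R[i]]_n := \row_i (if (i < m)%N then z 0 i else b 0 i).
suff key m : (m <= n)%N -> forall b, exists P : mpoly n R[i],
    forall z, G (mix m z b) = meval (fun k => z 0 k) P.
  have [P HP] := key n (leqnn n) 0; exists P => z; rewrite -HP; congr G.
  by apply/rowP => i; rewrite mxE ltn_ord.
elim: m => [_ b|m IH mn b].
  exists (mpolyC n (G b)) => z; rewrite mevalC; congr G.
  by apply/rowP => i; rewrite mxE ltn0.
pose j : 'I_n := Ordinal mn.
pose ba (x : R[i]) : 'rV[R[i]]_n := \row_i (if i == j then x else b 0 i).
have mixE z x : mix m z (ba 0) + x *: delta_mx 0 j = mix m z (ba x).
  apply/rowP => i; rewrite !mxE eqxx /=; have [->|ij] := eqVneq i j.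
    by rewrite ltnn add0r mulr1.
  by rewrite mulr0 addr0.
have mixS z : mix m.+1 z b = mix m z (ba (z 0 j)).
  apply/rowP => i; rewrite !mxE ltnS leq_eqVlt; have [->|ij] := eqVneq i j.
    by rewrite eqxx ltnn.
  have -> : (val i == m) = false by apply/negbTE; apply: contra ij => /eqP h; apply/eqP/val_inj.
  by [].
have /choice[P HP] : forall a : 'I_D.+1, exists P : mpoly n R[i],
    forall z, G (mix m z (ba a%:R)) = meval (fun k => z 0 k) P.
  by move=> a; exact: (IH (ltnW mn)).
exists (\sum_(a < D.+1) P a * \prod_(c < D.+1 | c != a)
  (mpolyC n (a%:R - c%:R)^-1 * (mpolyX R[i] (mnm1 j) - mpolyC n c%:R))) => z.
have [Q QD HQ] := H j (mix m z (ba 0)).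
rewrite mixS -mixE HQ (lagrange _ QD) rmorph_sum /=; apply: eq_bigr => a _.
rewrite rmorphM rmorph_prod /= -HP -HQ mixE; congr (_ * _).
apply: eq_bigr => c _; rewrite rmorphM rmorphB /= !mevalC mevalXU.
by [].
Qed.

End Degree.

(** * Proper polynomial maps *)

Section Main.
Context {R : realType}.

Lemma continuous_of_coords (T : topologicalType) N (p : T -> 'rV[R[i]]_N) (z : T) :
  (forall l, cont (fun z => p z 0 l) z) -> {for z, continuous p}.
Proof.
move=> cp P /near_enorm[d d0 HP].
have n0 : 0 < N%:R + 1 :> R by have : 0 <= N%:R :> R by []; lra.
pose e := d / (N%:R + 1); have e0 : 0 < e by rewrite divr_gt0.
have H (I : seq 'I_N) : \forall w \near z, forall l, l \in I -> cabs (p w 0 l - p z 0 l) < e.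
  elim: I => [|l I IH]; first by near=> w.
  have h := (contP _ _).1 (cp l) e e0.
  near=> w => l'; rewrite inE => /orP[/eqP->|]; first by near: w.
  by move: l'; near: w.
have Ha := H (enum 'I_N).
suff : \forall w \near z, P (p w) by [].
near=> w; apply: HP.
have Hw : forall l, l \in enum 'I_N -> cabs (p w 0 l - p z 0 l) < e by near: w.
apply: le_lt_trans (enorm_lt e0 _) _ => [l|].
  by have := Hw l (mem_enum _ _); rewrite !mxE.
have -> : d = (N%:R + 1) * e by rewrite /e; field; rewrite gt_eqF.
by rewrite ltr_pM2r//; lra.
Unshelve. all: by end_near. Qed.

Lemma meval_line n (P : mpoly n R[i]) (z u : 'rV[R[i]]_n) :
  exists Q : {poly R[i]}, forall t, meval (fun k => (z + t *: u) 0 k) P = Q.[t].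
Proof.
exists (\sum_(m <- msupp P) (mcoeff m P)%:P * \prod_i ((z 0 i)%:P + u 0 i *: 'X) ^+ m i) => t.
rewrite mevalE horner_sum; apply: eq_bigr => m _.
rewrite hornerM hornerC horner_prod; congr (_ * _); apply: eq_bigr => i _.
by rewrite horner_exp hornerD hornerC hornerZ hornerX !mxE [t * _]mulrC.
Qed.

Lemma meval_cont n (P : mpoly n R[i]) (z : 'rV[R[i]]_n) : 
  cont (fun z : 'rV[R[i]]_n => meval (fun k => z 0 k) P) z.
Proof.
have ci i : cont (fun z : 'rV[R[i]]_n => z 0 i) z.
  by apply: (@cont_coord _ _ _ id); exact: cvg_id.
have cprod (m : multinom n) (I : seq 'I_n) : cont (fun z : 'rV[R[i]]_n => \prod_(i <- I) z 0 i ^+ m i) z.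
  elim: I => [|i I IH].
    by apply: (@cont_ext _ _ (fun=> 1)) (@cont_cst _ _ _ _) => w; rewrite big_nil.
  by apply: cont_ext (contM (contX (n := m i) (ci i)) IH) => w; rewrite big_cons.
have csum (I : seq (multinom n)) :
    cont (fun z : 'rV[R[i]]_n => \sum_(m <- I) mcoeff m P * \prod_i z 0 i ^+ m i) z.
  elim: I => [|m I IH].
    by apply: (@cont_ext _ _ (fun=> 0)) (@cont_cst _ _ _ _) => w; rewrite big_nil.
  apply: cont_ext (contD (contM (@cont_cst _ _ (mcoeff m P) z) (cprod m (index_enum 'I_n))) IH) => w.
  by rewrite big_cons.
by apply: cont_ext (csum (msupp P)) => w; rewrite mevalE.
Qed.

Lemma polynomial_map_continuous n N (p : 'rV[R[i]]_n -> 'rV[R[i]]_N) :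
  polynomial_map p -> continuous p.
Proof.
move=> [P HP] z; apply: continuous_of_coords => l.
by apply: cont_ext (@meval_cont _ (P l) z) => w; rewrite HP mxE.
Qed.

Lemma polynomial_map_line n N (p : 'rV[R[i]]_n -> 'rV[R[i]]_N) z u :
  polynomial_map p -> exists Q : 'I_N -> {poly R[i]}, forall t l, p (z + t *: u) 0 l = (Q l).[t].
Proof.
move=> [P HP]; have /choice[Q HQ] : forall l, exists Q : {poly R[i]},
    forall t, meval (fun k => (z + t *: u) 0 k) (P l) = Q.[t] by move=> l; exact: meval_line.
by exists Q => t l; rewrite HP mxE HQ.
Qed.

Lemma polynomial_map_holo n N (p : 'rV[R[i]]_n -> 'rV[R[i]]_N) l :
  polynomial_map p -> line_holo (fun z => p z 0 l).
Proof.
move=> pp z u t; have [Q HQ] := polynomial_map_line z u pp.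
by under eq_fun do rewrite HQ; exact: cdiff_horner.
Qed.

Lemma enorm_cont n (z : 'rV[R[i]]_n) (e : R) : 0 < e ->
  \forall w \near z, `|enorm w - enorm z| < e.
Proof.
move=> e0; apply/near_enorm; exists e => // w wz; apply: le_lt_trans wz.
have := enorm_tri w z 0; have := enorm_tri z w 0; rewrite !subr0 (enormB z w) => h1 h2.
by rewrite ler_norml; apply/andP; split; lra.
Qed.

Lemma closed_shell n (a b : R) : closed [set w : 'rV[R[i]]_n | a <= enorm w /\ enorm w <= b].
Proof.
move=> w cw; split; rewrite leNgt; apply/negP => h.
  have /(enorm_cont w)/cw[x [/= [h1 _] h2]] : 0 < a - enorm w by rewrite subr_gt0.
  by have := ler_norm (enorm x - enorm w); lra.
have /(enorm_cont w)/cw[x [/= [_ h1] h2]] : 0 < enorm w - b by rewrite subr_gt0.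
have := ler_norm (- (enorm x - enorm w)); rewrite normrN; lra.
Qed.

Lemma compact_shell n (a b : R) : compact [set w : 'rV[R[i]]_n | a <= enorm w /\ enorm w <= b].
Proof.
apply: (subclosed_compact (@closed_shell n a b) (@compact_enorm_ball R n b)).
by move=> w [].
Qed.

Lemma compact_closed_rV n (K : set 'rV[R[i]]_n) : compact K -> closed K.
Proof. by apply: compact_closed; exact: norm_hausdorff. Qed.

Lemma compact_bounded_rV n (K : set 'rV[R[i]]_n) : compact K ->
  exists M : R, forall w, K w -> enorm w <= M.
Proof.
move=> cK; have [|B B0 HB] := @cont_bounded R _ (fun w : 'rV[R[i]]_n => (enorm w)%:C%C) K cK.
  move=> w _; apply/contP => e e0; apply: filterS (enorm_cont w e0) => x.
  by rewrite -rmorphB cabsR.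
by exists B => w /HB; rewrite cabsR ger0_norm ?enorm_ge0.
Qed.

(** The preimage of a compact shell is compact, hence closed in the whole space and not only in [U].
    For a boundary point of an open [U] the conclusion is absurd, so boundary points must be sent to
    the boundary. *)
Lemma proper_escape n N (f : 'rV[R[i]]_n -> 'rV[R[i]]_N) U V z (a b : R) :
  proper_map U V f -> [set w | a <= enorm w /\ enorm w <= b] `<=` V ->
  (forall e : R, 0 < e -> exists x, [/\ U x, enorm (x - z) < e, a <= enorm (f x) & enorm (f x) <= b]) ->
  U z.
Proof.
move=> [_ _ pf] KV H; have cS := pf _ KV (@compact_shell N a b).
suff [] : (U `&` f @^-1` [set w | a <= enorm w /\ enorm w <= b]) z by [].
apply: (compact_closed_rV cS) => P /near_enorm[d d0 HP].
by have [x [Ux xz ax bx]] := H d d0; exists x; split; [split|exact: HP].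
Qed.

(** Points of the closed set [C] mapped into [K] already lie in [U], so the preimage can be computed
    in [C], where it is visibly closed. *)
Lemma compact_preimage n N (p : 'rV[R[i]]_n -> 'rV[R[i]]_N) (U C : set 'rV[R[i]]_n) K (r : R) :
  continuous p -> closed C -> U `<=` C -> (forall z, C z -> K (p z) -> U z) -> compact K ->
  (forall z, U z -> K (p z) -> enorm z <= r) -> compact (U `&` p @^-1` K).
Proof.
move=> cp cC UC CU cK Ur.
apply: (subclosed_compact _ (@compact_enorm_ball R n r)); last by move=> z [Uz Kz]; exact: Ur.
have -> : U `&` p @^-1` K = C `&` p @^-1` K.
  by apply/seteqP; split=> z [h Kz]; split=> //; [exact: UC|exact: CU].
apply: closedI => //; apply: closed_comp => [z _|]; first exact: cp.
exact: compact_closed_rV.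
Qed.

Lemma ball_sphere n N (p : 'rV[R[i]]_n -> 'rV[R[i]]_N) : continuous p ->
  proper_map (unit_ball R n) (unit_ball R N) p -> forall z, enorm z = 1 -> enorm (p z) = 1.
Proof.
move=> cp pp z z1.
have near_z (e : R) : 0 < e -> exists x, [/\ unit_ball R n x, enorm (x - z) < e & `|enorm (p x) - enorm (p z)| < e].
  move=> e0; have /cp/near_enorm[d d0 Hd] := enorm_cont (p z) e0.
  pose q := Num.min (1 / 2) (Num.min (d / 2) (e / 2)).
  have q0 : 0 < q by rewrite !lt_min !divr_gt0.
  have q1 : q <= 1 / 2 by rewrite ge_min lexx.
  have q2 : q <= d / 2 by rewrite !ge_min lexx orbT.
  have q3 : q <= e / 2 by rewrite !ge_min lexx !orbT.
  have xz : enorm ((1 - q)%:C%C *: z - z) = q.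
    rewrite -[X in _ - X]scale1r -scalerBl.
    have -> : (1 - q)%:C%C - 1 = - q%:C%C :> R[i] by rewrite rmorphB rmorph1 addrAC subrr sub0r.
    by rewrite enormZ cabsN cabsR z1 mulr1 ger0_norm// ltW.
  exists ((1 - q)%:C%C *: z); split.
  - rewrite /unit_ball /= enormZ z1 mulr1 cabsR ger0_norm; lra.
  - by rewrite xz; lra.
  - by apply: Hd; rewrite xz; lra.
have p1 : enorm (p z) <= 1.
  rewrite leNgt; apply/negP => h; have h0 : 0 < enorm (p z) - 1 by rewrite subr_gt0.
  have [x [Ux _ hx]] := near_z _ h0; have [pU _ _] := pp.
  have := pU _ Ux; rewrite /unit_ball /= => px.
  have := ler_norm (- (enorm (p x) - enorm (p z))); rewrite normrN; lra.
apply/eqP; rewrite eq_le p1 leNgt; apply/negP => h.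
have : unit_ball R n z.
  apply: (@proper_escape _ _ p _ _ z 0 ((1 + enorm (p z)) / 2) pp).
    by move=> w [_ hw]; rewrite /unit_ball /=; lra.
  move=> e e0; pose e' := Num.min e ((1 - enorm (p z)) / 2).
  have e'0 : 0 < e' by rewrite lt_min e0 divr_gt0// subr_gt0.
  have [x [Ux xz px]] := near_z _ e'0.
  have e1 : e' <= e by rewrite ge_min lexx.
  have e2 : e' <= (1 - enorm (p z)) / 2 by rewrite ge_min lexx orbT.
  exists x; split => //; first exact: lt_le_trans xz e1.
    exact: enorm_ge0.
  by have := ler_norm (enorm (p x) - enorm (p z)); lra.
by rewrite /unit_ball /= z1 ltxx.
Qed.

Lemma proper_ball n N (p : 'rV[R[i]]_n -> 'rV[R[i]]_N) : continuous p ->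
  (forall z, enorm z < 1 -> enorm (p z) < 1) -> (forall z, enorm z = 1 -> enorm (p z) = 1) ->
  proper_map (unit_ball R n) (unit_ball R N) p.
Proof.
move=> cp p1 ps; split=> //; first exact: continuous_subspaceT.
move=> K Kb cK; apply: (@compact_preimage _ _ p _ [set z | 0 <= enorm z /\ enorm z <= 1] K 1) => //.
- exact: closed_shell.
- by move=> z zb; split; [exact: enorm_ge0|exact: ltW].
- move=> z [_ z1] Kz; rewrite /unit_ball /= lt_neqAle z1 andbT; apply/eqP => /ps e.
  by have := Kb _ Kz; rewrite /unit_ball /= e ltxx.
- by move=> z /ltW.
Qed.

Lemma ball_to_exterior n N (p : 'rV[R[i]]_n -> 'rV[R[i]]_N) : polynomial_map p ->
  proper_map (unit_ball R n) (unit_ball R N) p -> forall z, 1 < enorm z -> 1 < enorm (p z).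
Proof.
move=> pp pb z z1; have cp := polynomial_map_continuous pp.
have z0 : 0 < enorm z by lra.
pose c := (enorm z)^-1; have c0 : 0 < c by rewrite invr_gt0.
have c1 : c < 1 by rewrite invf_lt1.
(* The radial line, with the sphere at [cabs t = 1]: the parameter [c] gives z / ||z||^2 and [c^-1]
   gives z. *)
pose g (t : R[i]) := p (0 + t *: (c%:C%C *: z)).
have e : ip (g c%:C%C) (g c^-1%:C%C) = 1.
  apply: (reflection _ _ c0 (ltW c1)) => [l t|t t1]; first exact: polynomial_map_holo.
  apply: (ball_sphere cp pb).
  by rewrite add0r !enormZ t1 mul1r cabsR ger0_norm ?(ltW c0)// /c mulVf// gt_eqF.
have gz : g c^-1%:C%C = p z.
  by rewrite /g add0r scalerA -rmorphM mulVf ?gt_eqF// rmorph1 scale1r.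
rewrite gz in e; have [pU _ _] := pb.
have gc : enorm (g c%:C%C) < 1.
  apply: pU; rewrite /unit_ball /= add0r !enormZ !cabsR !ger0_norm ?(ltW c0)//.
  by rewrite /c mulVf ?gt_eqF// mulr1.
have := cauchy_schwarz (g c%:C%C) (p z); rewrite e cabs1 => h.
have g0 := enorm_ge0 (g c%:C%C); have p0 := enorm_ge0 (p z).
rewrite ltNge; apply/negP => p1.
have : enorm (g c%:C%C) * enorm (p z) <= enorm (g c%:C%C) * 1 by rewrite ler_wpM2l.
lra.
Qed.

Lemma parseval_circle N (Q : 'I_N -> {poly R[i]}) (M : nat) : (forall l, (size (Q l) <= M.+1)%N) ->
  (forall t, cabs t = 1 -> \sum_l cabs (Q l).[t] ^+ 2 = 1) ->
  \sum_l \sum_(k < M.+1) cabs (Q l)`_k ^+ 2 = 1.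
Proof.
move=> QM Q1.
pose Qr l : {poly R[i]} := \poly_(k < M.+1) ((Q l)`_(M - k))^*%C.
pose T := \sum_l Q l * Qr l - 'X^M.
have Qr1 l t : cabs t = 1 -> (Qr l).[t] = t ^+ M * ((Q l).[t])^*%C.
  move=> t1; have tt : t * t^*%C = 1 by rewrite mulcJ t1 expr1n.
  rewrite horner_poly (horner_coef_wide _ (QM l)) rmorph_sum mulr_sumr /=.
  rewrite (reindex_inj rev_ord_inj) /=; apply: eq_bigr => k _.
  have kM : (k <= M)%N by rewrite -ltnS ltn_ord.
  rewrite subSS subKn// rmorphM rmorphXn /= mulrCA; congr (_ * _).
  have -> : t ^+ M = t ^+ (M - k) * t ^+ k by rewrite -exprD subnK.
  by rewrite -mulrA -exprMn tt expr1n mulr1.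
have T0 t : T.[t] = 0.
  apply: (@identity_entire _ (fun t => T.[t]) (1 : R)%:C%C); first by move=> u; exact: cdiff_horner.
  move=> e e0; have [u [u1 une ue]] := circle_near (@ltr01 R) e0; exists u; split=> //.
  rewrite hornerD hornerN hornerXn horner_sum.
  rewrite (eq_bigr (fun l => u ^+ M * (cabs (Q l).[u] ^+ 2)%:C%C)) => [|l _]; last first.
    by rewrite hornerM (Qr1 l u u1) mulrCA mulcJ.
  by rewrite -mulr_sumr -rmorph_sum Q1// rmorph1 mulr1 subrr.
have TE : T = 0.
  apply: (@roots_geq_poly_eq0 _ _ [seq (val i)%:R | i : 'I_(size T)]).
  - by apply/allP => x _; rewrite /root T0.
  - rewrite map_inj_uniq ?enum_uniq// => a b /eqP; rewrite eqr_nat => /eqP/val_inj.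
    exact.
  - by rewrite size_map size_enum_ord.
have := congr1 (fun P : {poly R[i]} => P`_M) TE; rewrite /= coef0 coefB coefXn eqxx => /eqP.
rewrite subr_eq0 coef_sum => /eqP e; apply: complexI; rewrite rmorph1 -[RHS]e rmorph_sum.
apply: eq_bigr => l _; rewrite coefM rmorph_sum; apply: eq_bigr => k _ /=.
have kM : (k <= M)%N by rewrite -ltnS ltn_ord.
by rewrite coef_poly ltnS leq_subr subKn// mulcJ.
Qed.

End Main.

(** * Proper maps between ball exteriors *)

Section Exterior.
Context {R : realType} {n N : nat}.
Implicit Types (f F : 'rV[R[i]]_n -> 'rV[R[i]]_N).

Lemma enorm_delta (j : 'I_n) : enorm (delta_mx 0 j : 'rV[R[i]]_n) = 1.
Proof.
rewrite enormE (bigD1 j)//= mxE !eqxx cabs1 expr1n big1 ?addr0 ?sqrtr1// => i ij.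
by rewrite mxE (negPf ij) andbF cabs0 expr0n.
Qed.

Lemma holomorphic_ext_holo f : holomorphic_on (ball_exterior R n) f ->
  forall l, ext_holo (fun z => f z 0 l).
Proof.
move=> hf l; split=> [z /ball_exteriorE/hf df|z u t /ball_exteriorE/hf df].
  by apply: cont_coord; exact: differentiable_continuous.
exact: differentiable_line.
Qed.

(** The escape argument from outside. The sphere is approached along radii only, where [line_holo]
    already provides continuity. *)
Lemma sphere_of_proper f F :
  proper_map (ball_exterior R n) (ball_exterior R N) f ->
  (forall l, line_holo (fun z => F z 0 l)) -> (forall z, 1 < enorm z -> F z = f z) ->
  forall z, enorm z = 1 -> enorm (F z) = 1.
Proof.
move=> pf hF fF z z1.
have near_z (e : R) : 0 < e -> exists x,
    [/\ ball_exterior R n x, enorm (x - z) < e & `|enorm (f x) - enorm (F z)| < e].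
  move=> e0; have c : {for (0 : R[i]), continuous (fun t : R[i] => F (z + t *: z))}.
    by apply: continuous_of_coords => l; apply: cdiff_continuous; exact: hF.
  have Fz : F (z + 0 *: z) = F z by rewrite scale0r addr0.
  have /near_cabs[d d0 Hd] := c _ (enorm_cont _ e0).
  pose q := Num.min (d / 2) (e / 2).
  have q0 : 0 < q by rewrite !lt_min !divr_gt0.
  have q2 : q <= d / 2 by rewrite !ge_min lexx.
  have q3 : q <= e / 2 by rewrite !ge_min lexx !orbT.
  have x1 : 1 < enorm (z + q%:C%C *: z).
    rewrite -{1}[z]scale1r -scalerDl enormZ z1 mulr1.
    have -> : 1 + q%:C%C = (1 + q)%:C%C :> R[i] by rewrite [RHS]rmorphD rmorph1.
    by rewrite cabsR ger0_norm; lra.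
  exists (z + q%:C%C *: z); split; first exact/ball_exteriorE.
    by rewrite addrC addKr enormZ z1 mulr1 cabsR ger0_norm; lra.
  rewrite -fF// -Fz; apply: Hd.
  by rewrite subr0 cabsR ger0_norm; lra.
have [fU _ _] := pf.
have F1 : 1 <= enorm (F z).
  rewrite leNgt; apply/negP => h; have h0 : 0 < 1 - enorm (F z) by rewrite subr_gt0.
  have [x [Ux _ hx]] := near_z _ h0.
  have /ball_exteriorE fx := fU _ Ux.
  by have := ler_norm (enorm (f x) - enorm (F z)); lra.
apply/eqP; rewrite eq_le F1 andbT leNgt; apply/negP => h.
have : ball_exterior R n z.
  apply: (@proper_escape _ _ _ f _ _ z ((1 + enorm (F z)) / 2) (enorm (F z) + 1) pf).
    by move=> w [hw _]; apply/ball_exteriorE; lra.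
  move=> e e0; pose e' := Num.min e (Num.min 1 ((enorm (F z) - 1) / 2)).
  have e'0 : 0 < e' by rewrite !lt_min e0 ltr01 divr_gt0// subr_gt0.
  have [x [Ux xz fx]] := near_z _ e'0.
  have e1 : e' <= e by rewrite ge_min lexx.
  have e2 : e' <= 1 by rewrite !ge_min lexx orbT.
  have e3 : e' <= (enorm (F z) - 1) / 2 by rewrite !ge_min lexx !orbT.
  exists x; split => //; first exact: lt_le_trans xz e1.
    by have := ler_norm (- (enorm (f x) - enorm (F z))); rewrite normrN; lra.
  by have := ler_norm (enorm (f x) - enorm (F z)); lra.
by move=> /ball_exteriorE; rewrite z1 ltxx.
Qed.

Lemma uniform_degree f F (v0 : 'rV[R[i]]_n) : (2 <= n)%N ->
  (forall l, ext_holo (fun z => f z 0 l)) ->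
  (forall l, line_holo (fun z => F z 0 l)) -> (forall z, 1 < enorm z -> F z = f z) ->
  (forall z, enorm z = 1 -> enorm (F z) = 1) ->
  forall (j : 'I_n) (l : 'I_N), exists d, forall z,
    exists2 Q : {poly R[i]}, (size Q <= d.+1)%N &
      forall t, F (z + t *: delta_mx 0 j) 0 l = Q.[t].
Proof.
move=> n2 hf hF fF F1 j l.
pose e : 'rV[R[i]]_n := delta_mx 0 j; have e1 : enorm e = 1 := enorm_delta j.
have dF z t : cdiff (fun t => F (z + t *: e) 0 l) t by exact: hF.
(* The contour of size [enorm z + 2] lies where [F] equals [f]; thus the Taylor coefficients of [F]
   along [e] inherit the continuity and holomorphy in [z] of [dircoef]. *)
have coefE k z : coef (fun t => F (z + t *: e) 0 l) k 1 = dircoef e k (fun z => f z 0 l) z.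
  have r0 : 0 < enorm z + 2 by have := enorm_ge0 z; lra.
  rewrite -(coef_entire k r0 (dF z)) /dircoef /coef; congr (_ * _).
  apply: (contour_ext (ltW r0)) => t [t1 _]; congr (_ * _).
  by rewrite fF//; apply: (far_exterior e1); lra.
(* For these [z] the point [perp e z] is nonzero, inside the ball and orthogonal to [e], as
   [polynomial_on_line] demands. *)
pose O := [set z : 'rV[R[i]]_n | enorm z < 1 /\ 0 < enorm (perp e z)].
have [d Hd] : exists d, forall k z, (d < k)%N -> dircoef e k (fun z => f z 0 l) z = 0.
  apply: (@uniform_vanishing _ _ _ O).
  - by move=> k z; exact: (@dircoef_cont _ _ e e1 k _ z (hf l)).
  - by move=> k; exact: (dircoef_line_holo e1 k (hf l)).
  - rewrite openE => z [z1 z2]; apply/near_enorm.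
    exists (Num.min (1 - enorm z) (enorm (perp e z))); first by rewrite lt_min subr_gt0 z1.
    move=> w; rewrite lt_min => /andP[w1 w2]; split.
      by have := enorm_tri w z 0; rewrite !subr0; lra.
    have pE : perp e z = perp e w + (-1) *: perp e (w - z).
      by rewrite -perp_line; congr perp; rewrite scaleN1r opprB addrC subrK.
    have := enormD (perp e w) ((-1) *: perp e (w - z)); rewrite -pE scaleN1r enormN.
    have := perp_le e1 (w - z) 0; rewrite scale0r addr0 => h1 h2.
    by rewrite -(ltrD2r (enorm (perp e (w - z)))) add0r (le_lt_trans h1)// (lt_le_trans w2).
  - have [u u0 ue] := exists_orthogonal e n2.
    have nu : 0 < enorm u by rewrite lt_def enorm_ge0 enorm_eq0 u0.
    exists ((2 * enorm u)^-1%:C%C *: u).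
    have h0 : 0 <= (2 * enorm u)^-1 by rewrite invr_ge0 mulr_ge0// ltW.
    have h : (2 * enorm u)^-1 * enorm u = 1 / 2 by field; rewrite gt_eqF.
    split; first by rewrite enormZ cabsR ger0_norm// h; lra.
    by rewrite /perp ipZl ue mulr0 scale0r subr0 enormZ cabsR ger0_norm// h; lra.
  - move=> z [z1 z2].
    have pz1 : enorm (perp e z) < 1.
      by have := perp_le e1 z 0; rewrite scale0r addr0; lra.
    have [P HP] := polynomial_on_line hf hF fF F1 e1 (perp_ip e1 z) z2 pz1.
    (* The line through [z] is the line through [perp e z] with its parameter shifted by
       [ip z e]. *)
    pose Q := P l \Po ('X + (ip z e)%:P); exists (size Q) => k Qk.
    rewrite -(coefE k z); apply: etrans (coef_horner_eq0 Qk); congr coef; apply/funext => t.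
    rewrite horner_comp hornerD hornerX hornerC -HP; congr (F _ 0 l).
    by apply/rowP => i; rewrite /perp !mxE; ring.
exists d => z; apply: horner_of_coef => [t|k dk]; first exact: dF.
by rewrite coefE; exact: Hd.
Qed.

(** If [1 <= enorm (p z)], the constant term exhausts Parseval's identity, so [p] is constant on a
    line through [z]. That line contains points of the sphere and of the exterior, whose images have
    norm 1 and more than 1. *)
Lemma exterior_to_ball (p : 'rV[R[i]]_n -> 'rV[R[i]]_N) : (2 <= n)%N -> polynomial_map p ->
  (forall z, enorm z = 1 -> enorm (p z) = 1) -> (forall z, 1 < enorm z -> 1 < enorm (p z)) ->
  forall z, enorm z < 1 -> enorm (p z) < 1.
Proof.
move=> n2 pp ps pe z z1; rewrite ltNge; apply/negP => pz.
have [u0 u00 u0z] := exists_orthogonal z n2.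
have nu : 0 < enorm u0 by rewrite lt_def enorm_ge0 enorm_eq0 u00.
have z0 := enorm_ge0 z.
(* This scaling makes [cabs t = 1] the circle in which the line [z + t *: u] meets the sphere. *)
pose s := Num.sqrt (1 - enorm z ^+ 2) / enorm u0.
have s2 : 0 < 1 - enorm z ^+ 2 by rewrite subr_gt0 expr_lt1.
have s0 : 0 < s by rewrite divr_gt0// sqrtr_gt0.
pose u := s%:C%C *: u0.
have zu t : ip z (t *: u) = 0 by rewrite !ipZr -ip_conj u0z rmorph0 !mulr0.
have u2 : enorm u ^+ 2 = 1 - enorm z ^+ 2.
  rewrite /u enormZ cabsR ger0_norm; last exact: ltW.
  by rewrite /s divfK ?gt_eqF// sqr_sqrtr// ltW.
have line t : enorm (z + t *: u) ^+ 2 = enorm z ^+ 2 + cabs t ^+ 2 * (1 - enorm z ^+ 2).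
  by rewrite (pythagoras (zu t)) (enormZ t u) exprMn u2.
have on1 t : cabs t = 1 -> enorm (z + t *: u) = 1.
  move=> t1; apply/eqP; rewrite -(@eqrXn2 _ 2) ?enorm_ge0// line t1.
  by apply/eqP; ring.
have [Q HQ] := polynomial_map_line z u pp.
pose M := \max_l size (Q l).
have QM l : (size (Q l) <= M.+1)%N.
  by apply: leqW; exact: (leq_bigmax (F := fun l => size (Q l))).
have Q1 t : cabs t = 1 -> \sum_l cabs (Q l).[t] ^+ 2 = 1.
  move=> t1; rewrite -(expr1n _ 2) -[in RHS](ps _ (on1 t t1)) enorm_sqr.
  by apply: eq_bigr => l _; rewrite HQ.
have := parseval_circle QM Q1 => PQ.
have p0 : \sum_l cabs (Q l)`_0 ^+ 2 = enorm (p z) ^+ 2.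
  rewrite enorm_sqr; apply: eq_bigr => l _; rewrite -horner_coef0 -HQ.
  by rewrite scale0r addr0.
have tail l : \sum_(k < M) cabs (Q l)`_k.+1 ^+ 2 = 0.
  have : \sum_l \sum_(k < M) cabs (Q l)`_k.+1 ^+ 2 <= 0.
    have : \sum_l cabs (Q l)`_0 ^+ 2 + \sum_l \sum_(k < M) cabs (Q l)`_k.+1 ^+ 2 = 1.
      by rewrite -[RHS]PQ -big_split; apply: eq_bigr => l' _; rewrite big_ord_recl.
    rewrite p0; have : 1 <= enorm (p z) ^+ 2 by rewrite exprn_ege1.
    lra.
  have nn l' : 0 <= \sum_(k < M) cabs (Q l')`_k.+1 ^+ 2.
    by apply: sumr_ge0 => k _; exact: sqr_ge0.
  rewrite (bigD1 l)//= => h; apply/eqP; rewrite eq_le nn andbT.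
  by apply: le_trans h; rewrite lerDl; apply: sumr_ge0.
have cst t : p (z + t *: u) = p z.
  apply/rowP => l; rewrite HQ (horner_coef_wide _ (QM l)) big_ord_recl /= expr0 mulr1.
  rewrite big1 ?addr0 => [|k _].
    by rewrite -horner_coef0 -HQ scale0r addr0.
  have : cabs (Q l)`_k.+1 ^+ 2 == 0.
    rewrite eq_le sqr_ge0 andbT -(tail l) (bigD1 k)//= lerDl.
    by apply: sumr_ge0 => i _; exact: sqr_ge0.
  by rewrite sqrf_eq0 cabs_eq0 /bump /= => /eqP->; rewrite mul0r.
have := ps _ (on1 1 (@cabs1 R)); rewrite cst => e.
suff /pe : 1 < enorm (z + 2 *: u) by rewrite cst e ltxx.
rewrite -(@ltr_pXn2r _ 2) ?nnegrE ?enorm_ge0// expr1n line cabs2; lra.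
Qed.

Lemma polynomial_of_exterior f : (2 <= n)%N ->
  holomorphic_on (ball_exterior R n) f ->
  proper_map (ball_exterior R n) (ball_exterior R N) f ->
  exists p : 'rV[R[i]]_n -> 'rV[R[i]]_N,
    [/\ polynomial_map p, forall z, ball_exterior R n z -> f z = p z &
        proper_map (unit_ball R n) (unit_ball R N) p].
Proof.
move=> n2 /holomorphic_ext_holo hf pf.
pose v : 'rV[R[i]]_n := delta_mx 0 (Ordinal n2); have v1 : enorm v = 1 := enorm_delta _.
pose F z : 'rV[R[i]]_N := \row_l hartogs_ext v (fun z => f z 0 l) z.
have hF l : line_holo (fun z => F z 0 l).
  have := dircoef_line_holo v1 0 (hf l); congr line_holo.
  by apply/funext => z; rewrite mxE.
have fF z : 1 < enorm z -> F z = f z.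
  by move=> z1; apply/rowP => l; rewrite mxE (hartogs_extE v1 n2 (hf l) z1).
have F1 := sphere_of_proper pf hF fF.
have /choice[d Hd] : forall jl : 'I_n * 'I_N, exists d, forall z,
    exists2 Q : {poly R[i]}, (size Q <= d.+1)%N & forall t, F (z + t *: delta_mx 0 jl.1) 0 jl.2 = Q.[t].
  by move=> [j l]; exact: (uniform_degree v n2 hf hF fF F1 j l).
have /choice[P HP] : forall l : 'I_N, exists P : mpoly n R[i],
    forall z, F z 0 l = meval (fun k => z 0 k) P.
  move=> l; apply: (@separately_polynomial _ _ _ (\max_jl d jl)) => j z.
  have [Q Qd HQ] := Hd (j, l) z; exists Q => //; apply: leq_trans Qd _.
  by rewrite ltnS; exact: (leq_bigmax (F := d) (j, l)).
have pF : polynomial_map F.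
  by exists P => z; apply/rowP => l; rewrite HP [RHS]mxE.
exists F; split=> //; first by move=> z /ball_exteriorE/fF.
apply: proper_ball => //; first exact: polynomial_map_continuous.
apply: exterior_to_ball => // z z1.
by rewrite fF//; apply/ball_exteriorE; have [fU _ _] := pf; apply: fU; exact/ball_exteriorE.
Qed.

(** Growth at infinity bounds the preimage of a compact set, and [ball_sphere] keeps it off the unit
    sphere, so it is closed in the whole space. *)
Lemma proper_exterior (p : 'rV[R[i]]_n -> 'rV[R[i]]_N) : polynomial_map p ->
  proper_map (unit_ball R n) (unit_ball R N) p -> tends_to_infinity p ->
  proper_map (ball_exterior R n) (ball_exterior R N) p.
Proof.
move=> pp pb pinf; have cp := polynomial_map_continuous pp.
split; last 2 first.
- exact: continuous_subspaceT.
- move=> K Ke cK; have [M HM] := compact_bounded_rV cK; have [r Hr] := pinf M.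
  apply: (@compact_preimage _ _ _ p _ [set z | 1 <= enorm z] K r) => //.
  + move=> z cz; rewrite /= leNgt; apply/negP => h.
    have /(enorm_cont z)/cz[x [/= h1 h2]] : 0 < 1 - enorm z by rewrite subr_gt0.
    by have := ler_norm (enorm x - enorm z); lra.
  + by move=> z /ball_exteriorE/ltW.
  + move=> z /= z1 Kz; apply/ball_exteriorE; rewrite lt_neqAle z1 andbT eq_sym.
    apply/eqP => /(ball_sphere cp pb) e.
    by have /ball_exteriorE := Ke _ Kz; rewrite e ltxx.
  + move=> z _ Kz; rewrite leNgt; apply/negP => /Hr; apply/negP; rewrite -leNgt.
    exact: HM.
by move=> z /ball_exteriorE/(ball_to_exterior pp pb) h; apply/ball_exteriorE.
Qed.

End Exterior.

Theorem theorem1p1 (R : realType) (n N : nat)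
    (hn : (2 <= n)%N) (hN : (1 <= N)%N) :
  (* (A) *)
  (forall f : 'rV[R[i]]_n -> 'rV[R[i]]_N,
     holomorphic_on (ball_exterior R n) f ->
     proper_map (ball_exterior R n) (ball_exterior R N) f ->
     exists p : 'rV[R[i]]_n -> 'rV[R[i]]_N,
       [/\ polynomial_map p,
           forall z, ball_exterior R n z -> f z = p z &
           proper_map (unit_ball R n) (unit_ball R N) p]) /\
  (* (B) *)
  (forall p : 'rV[R[i]]_n -> 'rV[R[i]]_N,
     polynomial_map p ->
     proper_map (unit_ball R n) (unit_ball R N) p ->
     (p @` ball_exterior R n `<=` ball_exterior R N) /\
     (tends_to_infinity p ->
      proper_map (ball_exterior R n) (ball_exterior R N) p)).
Proof.
split=> [f hf pf|p pp pb]; first exact: polynomial_of_exterior hn hf pf.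
split=> [_ [z /ball_exteriorE z1 <-]|]; last exact: proper_exterior.
exact/ball_exteriorE/(ball_to_exterior pp pb).
Qed.
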